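(* Let $(X_{\mathbf s})_{\mathbf s\in\mathbb Z^2}$ be a strictly stationary regularly varying random field with index $\alpha>0$ satisfying conditions (M1) and (M2) for the integer sequences $(m_n)$, $(r_n)$ and the mixing rate function $\bar\alpha$. Assume further that $$\lim_{n\to\infty}\frac{n}{\sqrt{m_n}}\sum_{\mathbf h:\,r_n<\|\mathbf h\|\le n}\gamma(\mathbf h)=0,\qquad \lim_{n\to\infty}n^7\bar\alpha(r_n)=0,\qquad (\log n)^4\frac{r_n^2}{m_n}+\frac{r_n^4}{m_n}=o(1).$$ Let $g$ be a periodic function satisfying $g(x_1,x_2+2\pi)=g(\mathbf x)=g(x_1+2\pi,x_2)$, $\mathbf x=(x_1,x_2)\in\Pi^2$, and $$\sup_{\mathbf x\in\Pi^2}\Big|\frac{\partial^2 g(\mathbf x)}{\partial x_1\partial x_2}\Big|<\infty,$$ and assume that the Fourier coefficients $\psi_{\mathbf h}=\int_{\Pi^2}\cos(\mathbf h^\top\boldsymbol\omega)\,g(\boldsymbol\omega)\,d\boldsymbol\omega$, $\mathbf h\in\mathbb Z^2$, are absolutely summable. Then, as $n\to\infty$, $$\frac{n}{\sqrt{m_n}}\,\frac{(2\pi)^2}{n^2}\sum_{\mathbf j\in\Lambda_n^2}\big(\widehat f(\boldsymbol\lambda_{\mathbf j})-f(\boldsymbol\lambda_{\mathbf j})\big)\,g(\boldsymbol\lambda_{\mathbf j})\ \stackrel{d}{\to}\ G:=\sum_{\mathbf h\in\mathbb Z^2}\psi_{\mathbf h}Z_{\mathbf h},$$ where $(Z_{\mathbf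 h})_{\mathbf h\in\mathbb Z^2}$ is the mean-zero Gaussian random field whose covariance structure is that of the limit in the central limit theorem for the empirical spatial extremogram, i.e., for every finite $A\subset\mathbb Z^2$ the vector $(Z_{\mathbf h})_{\mathbf h\in A}$ has the Gaussian law which is the limit in distribution, as $n\to\infty$, of $\frac{n}{\sqrt{m_n}}\big[\widetilde\gamma(\mathbf h)-p_m(\mathbf h)\big]_{\mathbf h\in A}$; and the infinite series defining $G$ converges in distribution.
   Context: $(X_{\mathbf s})_{\mathbf s\in\mathbb Z^2}$ is a real-valued strictly stationary random field with generic element $X$; $\|\cdot\|$ is the max-norm on $\mathbb R^2$. Regular variation with index $\alpha>0$: there is a random field $(\Xi_{\mathbf s})_{\mathbf s\in\mathbb Z^2}$ such that for every finite $A\subset\mathbb Z^2$, as $x\to\infty$, $\mathbb P\big((X_{\mathbf s}/|X_{\mathbf 0}|)_{\mathbf s\in A}\in\cdot\mid |X_{\mathbf 0}|>x\big)$ converges weakly to $\mathbb P((\Xi_{\mathbf s})_{\mathbf s\in A}\in\cdot)$, and $\mathbb P(|X|>tx)/\mathbb P(|X|>x)\to t^{-\alpha}$ for all $t>0$. $(a_n)$ is a sequence with $a_n\to\infty$ and $n\,\mathbb P(|X|>a_n)\to1$; write $a_m=a_{m_n}$. $\Lambda_n^2=\{1,\dots,n\}^2$, $\Pi^2=[0,2\pi]^2$, $\boldsymbol\lambda_{\mathbf j}=2\pi\mathbf j/n$. Extremogram: $\gamma(\mathbf h)=\lim_{x\to\infty}\mathbb P(|X_{\mathbf h}|>x\mid|X_{\mathbf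 0}|>x)$, assumed throughout to be absolutely summable on $\mathbb Z^2$; extremal spectral density $f(\boldsymbol\omega)=\sum_{\mathbf h\in\mathbb Z^2}e^{i\boldsymbol\omega^\top\mathbf h}\gamma(\mathbf h)$; pre-asymptotic extremogram $p_m(\mathbf h)=\mathbb P(|X_{\mathbf h}|>a_m\mid|X_{\mathbf 0}|>a_m)$; empirical spatial extremogram $\widetilde\gamma(\mathbf h)=\frac{m_n}{n^2}\sum_{\mathbf s,\mathbf s+\mathbf h\in\Lambda_n^2}\mathbf 1(|X_{\mathbf s}|>a_m,|X_{\mathbf s+\mathbf h}|>a_m)$. Under regular variation and (M1) the vectors $\frac{n}{\sqrt{m_n}}[\widetilde\gamma(\mathbf h)-p_m(\mathbf h)]_{\mathbf h\in A}$, $A\subset\mathbb Z^2$ finite, converge in distribution to mean-zero Gaussian vectors. Extremal periodogram: with $\widehat I_{\mathbf t}=\mathbf 1(|X_{\mathbf t}|>a_m)-\mathbb P(|X|>a_m)$, $\widehat f(\boldsymbol\omega)=\frac{m_n}{n^2}\big|\sum_{\mathbf t\in\Lambda_n^2}\widehat I_{\mathbf t}e^{i\boldsymbol\omega^\top\mathbf t}\big|^2$. Mixing coefficients: $\alpha_{j,k}(h)=\sup\,\sup_{B,C}|\mathbb P(B\cap C)-\mathbb P(B)\mathbb P(C)|$, the outer supremum over $S,T\subset\mathbb Z^2$ with $\#S\le j$, $\#T\le k$, $\|S-T\|\ge h$ (distance of sets in max-norm), the inner over $B\in\sigma(X_{\mathbf s},\mathbf s\in S)$, $C\in\sigma(X_{\mathbf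 t},\mathbf t\in T)$. Condition (M1): $m_n,r_n\to\infty$ are integer sequences with $m_n=o(n)$, $r_n=o(m_n)$, $n r_n/m_n^{3/2}\to0$, $r_n^4/m_n\to0$, and (1) for all $\delta>0$, $\lim_{h\to\infty}\limsup_{n\to\infty} m_n\sum_{\mathbf h:\,h<\|\mathbf h\|\le r_n}\mathbb P(|X_{\mathbf 0}|>\delta a_m,|X_{\mathbf h}|>\delta a_m)=0$; (2) there exist $K,\tau>0$, $\rho\in(0,1)$ and a non-increasing function $\bar\alpha(h)$ such that $\sup_{j,k}\alpha_{j,k}(h)\le\bar\alpha(h)\le K\rho^{h^\tau}$ and $\lim_{n\to\infty}m_n\bar\alpha(r_n)=0$. Condition (M2): $m_n\mathbb P(|X_{\mathbf 0}|>a_m)=1+O(m_n^{-1})$ and $\lim_{n\to\infty}\frac{n}{\sqrt{m_n}}\sup_{\mathbf h:1\le\|\mathbf h\|\le r_n}|p_m(\mathbf h)-\gamma(\mathbf h)|=0$.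
   Formalization: The bounded mixed derivative condition on g is read as including existence of both first-order partial derivatives on Π²; otherwise g(x)=u(x_1), u the indicator of rational multiples of 2π, has zero mixed derivative and all ψ_h=0, yet acts like g=1 at the Fourier frequencies. *)

(* Defs.v *)
From HB Require Import structures.
From mathcomp Require Import all_boot all_order all_algebra finmap.
From mathcomp Require Import complex.
From mathcomp Require Import zify.
From mathcomp Require Import all_classical all_reals all_analysis.

Set Implicit Arguments.
Unset Strict Implicit.
Unset Printing Implicit Defensive.

Import Order.TTheory GRing.Theory Num.Theory.
Import numFieldNormedType.Exports.

Local Open Scope classical_set_scope.
Local Open Scope ring_scope.
Local Open Scope complex_scope.

Section lattice.
Context {R : realType}.

Definition mnorm (h : int * int) : nat := maxn `|h.1|%N `|h.2|%N.

(* [Lam n] lists {1, ..., n}^2 and [box n] lists {h in Z^2 | mnorm h <= n},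
   both without repetition. *)
Definition Lam (n : nat) : seq (int * int) :=
  [seq (Posz i, Posz j) | i <- iota 1 n, j <- iota 1 n].

Definition box (n : nat) : seq (int * int) :=
  let I := [seq Posz k - Posz n | k <- iota 0 n.*2.+1] in
  [seq (i, j) | i <- I, j <- I].

Definition dot (w : R * R) (h : int * int) : R :=
  w.1 * h.1%:~R + w.2 * h.2%:~R.

Definition cis (t : R) : R[i] := cos t +i* sin t.

Definition freq (n : nat) (j : int * int) : R * R :=
  (2 * pi * j.1%:~R / n%:R, 2 * pi * j.2%:~R / n%:R).

(* Series over Z^2 are summed along the boxes; this is only used for absolutely
   summable families, where the order of summation does not matter. *)
Definition sumZ2 (u : int * int -> R) : R :=
  lim ((\sum_(h <- box N) u h) @[N --> \oo]).

Definition sumZ2C (u : int * int -> R[i]) : R[i] :=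
  sumZ2 (fun h => complex.Re (u h)) +i* sumZ2 (fun h => complex.Im (u h)).

Definition restr (A : {fset int * int}) (x : int * int -> R) : 'rV[R]_#|` A| :=
  \row_(i < #|` A|) x (nth 0 A i).

Definition abs_summable (u : int * int -> R) : Prop :=
  summable setT (fun h => (u h)%:E).

Lemma box_uniq n : uniq (box n).
Proof.
apply: allpairs_uniq => [||[? ?] [? ?] _ _ [-> ->]//].
- by rewrite map_inj_uniq ?iota_uniq// => i j /addIr [].
- by rewrite map_inj_uniq ?iota_uniq// => i j /addIr [].
Qed.

Lemma mem_box n h : (h \in box n) = (mnorm h <= n)%N.
Proof.
have memI (i : int) :
    (i \in [seq Posz k - Posz n | k <- iota 0 n.*2.+1]) = (`|i| <= n)%N.
  apply/mapP/idP => [[k]|ni]; first by rewrite mem_iota => + ->; lia.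
  by exists `|(i + Posz n)%R|%N; [rewrite mem_iota; lia|lia].
case: h => i j; rewrite /mnorm /= geq_max -!memI /box.
apply/allpairsP/andP => [[[x y] [? ? [-> ->]]]//|[? ?]]; by exists (i, j).
Qed.

Lemma mnormN h : mnorm (- h) = mnorm h.
Proof. by rewrite /mnorm /= !abszN. Qed.

Lemma box_opp n : perm_eq [seq - h | h <- box n] (box n).
Proof.
apply: uniq_perm; rewrite ?box_uniq ?(map_inj_uniq oppr_inj) ?box_uniq// => h.
by rewrite -[h in LHS]opprK mem_map ?mem_box ?mnormN//; exact: oppr_inj.
Qed.

End lattice.

Definition cvg_dist {R : realType} {E : topologicalType}
    d (T : measurableType d) (P : probability T R)
    d' (T' : measurableType d') (P' : probability T' R)
    (Y : nat -> T -> E) (Y' : T' -> E) : Prop :=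
  forall phi : E -> R, continuous phi -> bounded_fun phi ->
    ('E_P[fun w => phi (Y n w)])%E @[n --> \oo] -->
    ('E_P'[fun w => phi (Y' w)])%E.

Section gaussian.
Context {R : realType} d (T : measurableType d) (P : probability T R).

(* [normal_prob 0 0] is not the point mass at 0 in the library. *)
Definition centered_normal (sigma : R) (B : set R) : \bar R :=
  if sigma == 0 then \d_(0 : R) B else normal_prob 0 sigma B.

Definition centered_gaussian_field (Z : int * int -> {RV P >-> R}) : Prop :=
  forall (A : {fset int * int}) (c : int * int -> R),
  exists2 sigma : R, 0 <= sigma &
    forall B : set R, measurable B ->
      P [set w | B (\sum_(h <- A) c h * Z h w)] = centered_normal sigma B.

End gaussian.

Section random_field.
Context {R : realType} d (T : measurableType d) (P : probability T R).
Variable X : int * int -> {RV P >-> R}.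

(* [<<s open >>] is the Borel sigma-algebra of R^A. *)
Definition strictly_stationary : Prop :=
  forall (A : {fset int * int}) (h : int * int) (B : set 'rV[R]_#|` A|),
    <<s open >> B ->
    P [set w | B (restr A (fun s => X (s + h) w))] =
    P [set w | B (restr A (fun s => X s w))].

Definition exceed (x : R) (s : int * int) : set T := [set w | x < `|X s w|].

Definition cond_prob (A B : set T) : R := fine (P (A `&` B)) / fine (P B).

Definition cond_expect (f : T -> R) (B : set T) : R :=
  (\int[P]_(w in B) f w) / fine (P B).

Definition regularly_varying (alpha : R) : Prop :=
  (exists (d' : measure_display) (T' : measurableType d')
      (P' : probability T' R) (Xi : int * int -> {RV P' >-> R}),
    forall (A : {fset int * int}) (phi : 'rV[R]_#|` A| -> R),
      continuous phi -> bounded_fun phi ->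
      cond_expect (fun w => phi (restr A (fun s => X s w / `|X 0 w|)))
        (exceed x 0) @[x --> +oo] -->
      (\int[P']_w phi (restr A (fun s => Xi s w)))) /\
  (forall t : R, 0 < t ->
    fine (P (exceed (t * x) 0)) / fine (P (exceed x 0)) @[x --> +oo] -->
    t `^ (- alpha)).

Definition extremogram (h : int * int) : R :=
  lim (cond_prob (exceed x h) (exceed x 0) @[x --> +oo]).

(* A priori complex-valued; [Im_spectral_density] shows that it is real. *)
Definition spectral_density (w : R * R) : R[i] :=
  sumZ2C (fun h => cis (dot w h) * (extremogram h)%:C).

Lemma exceedI_shift x h s t : strictly_stationary ->
  P (exceed x (s + h) `&` exceed x (t + h)) = P (exceed x s `&` exceed x t).
Proof.
move=> st; pose A : {fset int * int} := [fset s; t]%fset.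
have idx u : u \in A -> (index u A < #|` A|)%N by rewrite index_mem.
have sA : s \in A by rewrite !inE eqxx.
have tA : t \in A by rewrite !inE eqxx orbT.
pose i := Ordinal (idx s sA); pose j := Ordinal (idx t tA).
pose B := [set v : 'rV[R]_#|` A| | x < `|v ord0 i| /\ x < `|v ord0 j|].
have oB k : open [set v : 'rV[R]_#|` A| | x < `|v ord0 k|].
  apply: (@open_comp _ _ (fun v : 'rV[R]_#|` A| => `|v ord0 k|) [set y | x < y]).
    move=> v _; apply: continuous_comp; last exact: norm_continuous.
    exact: coord_continuous.
  exact: open_gt.
have mB : <<s open >> B by apply: sub_gen_smallest; exact: (openI (oB i) (oB j)).
have E (y : int * int -> R) :
    B (restr A y) = (x < `|y s| /\ x < `|y t|).
  by rewrite /B /restr /= !mxE /= !nth_index.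
have := st A h B mB; rewrite /exceed /setI /=.
under eq_set do rewrite E.
by under [in RHS]eq_set do rewrite E.
Qed.

Lemma extremogramN h :
  strictly_stationary -> extremogram (- h) = extremogram h.
Proof.
move=> st; rewrite /extremogram; congr (lim (_ @ +oo)).
apply/funext => x; rewrite /cond_prob; congr (fine _ / _).
by rewrite -(exceedI_shift x h (- h) 0 st) addNr add0r setIC.
Qed.

Lemma Im_spectral_density w :
  strictly_stationary -> complex.Im (spectral_density w) = 0.
Proof.
move=> st; rewrite /spectral_density /sumZ2C /= /sumZ2.
pose u (h : int * int) : R :=
  cos (dot w h) * 0 + sin (dot w h) * extremogram h.
have uN h : u (- h) = - u h.
  rewrite /u /= extremogramN// !mulr0 !add0r.
  have -> : dot w (- h) = - dot w h.
    by rewrite /dot /= !rmorphN /= !mulrN -opprD.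
  by rewrite sinN mulNr.
rewrite (_ : (fun N => _) = cst 0) ?lim_cst//=.
apply/funext => N; rewrite -/(\sum_(h <- box N) u h) /cst.
apply/eqP; rewrite -eqNr -sumrN; apply/eqP.
rewrite (eq_bigr (fun h => u (- h))) => [|h _]; last by rewrite uN.
by rewrite -(big_map -%R predT u) (perm_big _ (box_opp N)).
Qed.

Definition sigma_field (S : {fset int * int}) : set (set T) :=
  <<s \bigcup_(s in [set` S]) preimage_set_system setT (X s) measurable >>.

(* The distance of two finite subsets of Z^2 is an integer, or infinite if one of
   them is empty, so the lag h ranges over nat. *)
Definition mixing_coef (j k h : nat) : \bar R :=
  ereal_sup [set x | exists S S' : {fset int * int},
    [/\ (#|` S| <= j)%N, (#|` S'| <= k)%N,
        (forall s t, s \in S -> t \in S' -> (h <= mnorm (s - t)%R)%N) &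
        exists B C : set T, [/\ sigma_field S B, sigma_field S' C &
          x = `|P (B `&` C) - P B * P C|%E]]].

Variables (a : nat -> R) (m r : nat -> nat) (abar : nat -> R).

Definition normalizing_sequence : Prop :=
  a n @[n --> \oo] --> +oo /\
  n%:R * fine (P (exceed (a n) 0)) @[n --> \oo] --> (1 : R).

Definition pre_extremogram (n : nat) (h : int * int) : R :=
  cond_prob (exceed (a (m n)) h) (exceed (a (m n)) 0).

Definition emp_extremogram (n : nat) (h : int * int) (w : T) : R :=
  (m n)%:R / n%:R ^+ 2 *
  \sum_(s <- Lam n | s + h \in Lam n)
    \1_(exceed (a (m n)) s `&` exceed (a (m n)) (s + h)) w.

Definition centered_ind (n : nat) (t : int * int) (w : T) : R :=
  \1_(exceed (a (m n)) t) w - fine (P (exceed (a (m n)) 0)).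

Definition periodogram (n : nat) (om : R * R) (w : T) : R :=
  (m n)%:R / n%:R ^+ 2 *
  ComplexField.Normc.normc (\sum_(t <- Lam n) (centered_ind n t w)%:C * cis (dot om t)) ^+ 2.

Definition condition_M1 : Prop :=
  [/\ m n @[n --> \oo] --> \oo, r n @[n --> \oo] --> \oo,
      (m n)%:R / n%:R @[n --> \oo] --> (0 : R) &
      (r n)%:R / (m n)%:R @[n --> \oo] --> (0 : R)] /\
  [/\ n%:R * (r n)%:R / (m n)%:R `^ (3 / 2) @[n --> \oo] --> (0 : R),
      (r n)%:R ^+ 4 / (m n)%:R @[n --> \oo] --> (0 : R),
      (forall delta : R, 0 < delta ->
        limn_esup (fun n => (m n)%:R%:E *
          \sum_(k <- box (r n) | (h < mnorm k)%N)
             P (exceed (delta * a (m n))%R 0%R `&` exceed (delta * a (m n))%R k))%E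
        @[h --> \oo] --> (0 : \bar R)%E) &
      (exists K tau rho : R,
        [/\ 0 < K, 0 < tau, 0 < rho < 1, nonincreasing_seq abar &
          (forall j k h, mixing_coef j k h <= (abar h)%:E)%E /\
          (forall h, abar h <= K * rho `^ (h%:R `^ tau))]) /\
      (m n)%:R * abar (r n) @[n --> \oo] --> (0 : R)].

Definition condition_M2 : Prop :=
  (exists C : R, \forall n \near \oo,
     `|(m n)%:R * fine (P (exceed (a (m n)) 0)) - 1| <= C / (m n)%:R) /\
  n%:R / Num.sqrt (m n)%:R *
    \big[Num.max/0]_(h <- box (r n) | (1 <= mnorm h)%N)
      `|pre_extremogram n h - extremogram h| @[n --> \oo] --> (0 : R).

(* This is the defining property of Z: each (Z_h)_(h in A) has the limit law of
   the normalized empirical extremogram. *)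
Definition extremogram_clt d' (T' : measurableType d') (P' : probability T' R)
    (Z : int * int -> {RV P' >-> R}) : Prop :=
  forall A : {fset int * int},
    cvg_dist P P'
      (fun n w => restr A (fun h => n%:R / Num.sqrt (m n)%:R *
         (emp_extremogram n h w - pre_extremogram n h)))
      (fun w => restr A (fun h => Z h w)).

(* The spectral density is real, so taking its real part loses nothing. *)
Definition integrated_error (g : R * R -> R) (n : nat) (w : T) : R :=
  n%:R / Num.sqrt (m n)%:R * ((2 * pi) ^+ 2 / n%:R ^+ 2 *
  \sum_(j <- Lam n)
    (periodogram n (freq n j) w - complex.Re (spectral_density (freq n j))) *
    g (freq n j)).

End random_field.

Section weight.
Context {R : realType}.

Definition Pi2 : set (R * R) := `[0, 2 * pi] `*` `[0, 2 * pi].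

Definition periodic2 (g : R * R -> R) : Prop :=
  forall x : R * R,
    g (x.1, x.2 + 2 * pi) = g x /\ g (x.1 + 2 * pi, x.2) = g x.

(* d^2 g / dx1 dx2 is the iterated derivative d/dx1 (d g / dx2), existing on Pi2
   together with both first-order partial derivatives.  With only d g / dx2
   required, g could be an arbitrary, even non-measurable, function of x1. *)
Definition bounded_mixed_partial (g : R * R -> R) : Prop :=
  (forall x, Pi2 x ->
    [/\ derivable g x (1, 0), derivable g x (0, 1) &
        derivable ('D_(0, 1) g) x (1, 0)]) /\
  (ereal_sup [set `|'D_(1, 0) ('D_(0, 1) g) x|%:E | x in Pi2] < +oo)%E.

Definition fourier_coef (g : R * R -> R) (h : int * int) : R :=
  \int[(lebesgue_measure \x lebesgue_measure)%E]_(w in Pi2)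
    (cos (dot w h) * g w).

End weight.

(* Main.v *)
From HB Require Import structures.
Require Import Defs.
From mathcomp Require Import all_boot all_order all_algebra finmap.
From mathcomp Require Import complex zify ring lra.
From mathcomp Require Import all_classical all_reals all_analysis.
From mathcomp Require Import measurable_realfun.
Import Order.TTheory GRing.Theory Num.Theory.
Import numFieldNormedType.Exports.
Local Open Scope classical_set_scope.
Local Open Scope ring_scope.

Set Implicit Arguments.
Unset Strict Implicit.
Unset Printing Implicit Defensive.

(* On the grid of frequencies only the even part of [g] matters, and Fejer's theorem writes
   it as a limit, in the order [mu], of trigonometric polynomials with coefficients
   [(lagcount mu k / mu ^ 2) psi k]. Hence the integrated error is, up to an arbitrarily
   small amount, the sum over [k] of these coefficients times the rescaled difference
   between the circular empirical autocovariance at [k] and the sum of the extremogram over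
   the lags congruent to [k] modulo [n].
   The expectation of this difference is a bias that vanishes uniformly in [k], because
   (M2) controls the lags up to [r n], mixing and the tail hypothesis control those up to
   [n], and (M2) combined with mixing forces [extremogram h = O(mnorm h ^- 4)] beyond. Its
   fluctuation is bounded in L^1 uniformly in [n] and [k] by a covariance estimate from mixing
   and the anti-clustering condition of (M1), and for fixed [k] it is asymptotically
   [n / sqrt (m n) * (emp_extremogram k - pre_extremogram k)]. As [psi] is summable, the
   sum may be truncated to a box uniformly in [n], and the assumed central limit theorem
   applies there. The bound in L^1 passes to the limit [Z], so the series defining [G]
   converges almost surely. *)

(** * Periodic functions with a bounded mixed partial derivative *)

Section mixed_partial.
Context {R : realType}.
Implicit Types (g : R * R -> R) (x y : R * R).

(** Summability of [psi] says nothing by itself about [g]: the cosine series must first be shown to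
    represent its even part. The price of the grid is aliasing. A residue class meets the box of
    radius [n] in at most 9 lags, and those other than [k] contribute fluctuations of order
    [n ^ (-1/2)] only. Errors are measured in L^1 because such bounds add up against [psi] without
    any joint estimate across lags. The exponent 4 in the decay of the extremogram is dictated by
    the plane: the shell at distance q has 8 q lags, so the tail beyond [n] has order [n ^ -2],
    against a factor [n / sqrt (m n)] of at most [n]. Of the seventh power of [n] in the mixing
    hypothesis, the bias spends six: one for this factor, one for [m n] and four for a generous
    count of lags. *)

Lemma slice1E g (s t : R) :
  (fun h : R => h^-1 *: (g (h *: ((1, 0) : R * R) + (s, t)) - g (s, t))) =
  (fun h : R => h^-1 *: (g (h *: (1 : R) + s, t) - g (s, t))).
Proof.
apply/funext => h; congr (_ *: (g _ - _)).
by apply/pair_equal_spec; split => //=; rewrite scaler0 add0r.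
Qed.

Lemma slice2E g (s t : R) :
  (fun h : R => h^-1 *: (g (h *: ((0, 1) : R * R) + (s, t)) - g (s, t))) =
  (fun h : R => h^-1 *: (g (s, h *: (1 : R) + t) - g (s, t))).
Proof.
apply/funext => h; congr (_ *: (g _ - _)).
by apply/pair_equal_spec; split => //=; rewrite scaler0 add0r.
Qed.

Lemma is_derive_slice1 g (s t : R) : derivable g (s, t) (1, 0) ->
  is_derive s 1 (fun u => g (u, t)) ('D_(1, 0) g (s, t)).
Proof.
move=> dg; split; first by rewrite /derivable -slice1E.
by rewrite /derive -slice1E.
Qed.

Lemma is_derive_slice2 g (s t : R) : derivable g (s, t) (0, 1) ->
  is_derive t 1 (fun u => g (s, u)) ('D_(0, 1) g (s, t)).
Proof.
move=> dg; split; first by rewrite /derivable -slice2E.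
by rewrite /derive -slice2E.
Qed.

Lemma shiftE g (p v x : R * R) : (forall y, g (y + p) = g y) ->
  (fun h : R => h^-1 *: (g (h *: v + (x + p)) - g (x + p))) =
  (fun h : R => h^-1 *: (g (h *: v + x) - g x)).
Proof. by move=> gp; apply/funext => h; rewrite addrA !gp. Qed.

Lemma derivable_shift g p v x : (forall y, g (y + p) = g y) ->
  derivable g x v -> derivable g (x + p) v.
Proof. by move=> gp; rewrite /derivable shiftE. Qed.

Lemma derive_shift g p v x : (forall y, g (y + p) = g y) ->
  'D_v g (x + p) = 'D_v g x.
Proof. by move=> gp; rewrite /derive shiftE. Qed.

Definition period (k l : int) : R * R := (2 * pi * k%:~R, 2 * pi * l%:~R).

Lemma periodic1_nat (f : R -> R) p : (forall t, f (t + p) = f t) ->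
  forall (n : nat) t, f (t + p * n%:R) = f t.
Proof.
move=> fp; elim=> [|n IH] t; first by rewrite mulr0 addr0.
by rewrite -addn1 natrD mulrDr mulr1 addrA fp IH.
Qed.

Lemma periodic1_int (f : R -> R) p : (forall t, f (t + p) = f t) ->
  forall (k : int) t, f (t + p * k%:~R) = f t.
Proof.
move=> fp [n|n] t; first exact: periodic1_nat.
rewrite NegzE rmorphN mulrN /=.
by rewrite -[LHS](periodic1_nat fp n.+1) subrK.
Qed.

Lemma periodic2_int g : periodic2 g -> forall k l x, g (x + period k l) = g x.
Proof.
move=> gp k l [s t] /=.
have /= -> := periodic1_int (f := fun u => g (s + 2 * pi * k%:~R, u))
  (fun u => (gp (s + 2 * pi * k%:~R, u)).1) l t.
exact: (periodic1_int (f := fun u => g (u, t)) (fun u => (gp (u, t)).2) k s).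
Qed.

(** Transports to the whole plane, by periodicity, what is assumed on [Pi2] only. *)
Lemma Pi2_cover x : exists k l y, Pi2 y /\ x = y + period k l.
Proof.
have pi2 : 0 < 2 * pi :> R by rewrite mulr_gt0// pi_gt0.
have red (t : R) : exists (k : int) u, 0 <= u <= 2 * pi /\ t = u + 2 * pi * k%:~R.
  exists (Num.floor (t / (2 * pi))), (t - 2 * pi * (Num.floor (t / (2 * pi)))%:~R).
  split; last by rewrite subrK.
  rewrite subr_ge0 lerBlDr.
  have := Num.Theory.floor_itv (t / (2 * pi)).
  rewrite ler_pdivlMr// ltr_pdivrMr// intrD => /andP[]; nra.
case: x => s t; have [k [u [u1 ->]]] := red s; have [l [v [v1 ->]]] := red t.
exists k, l, (u, v); split; last by [].
by split; rewrite /= in_itv.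
Qed.

Lemma is_derive_continuous (f : R -> R) (f' t : R) : is_derive t 1 f f' ->
  {for t, continuous f}.
Proof. by case=> df _; exact/differentiable_continuous/derivable1_diffP. Qed.

Lemma lipschitz_is_derive (f f' : R -> R) (M : R) :
  (forall t : R, is_derive t 1 f (f' t)) -> (forall t, `|f' t| <= M) ->
  forall s t, `|f s - f t| <= M * `|s - t|.
Proof.
move=> df f'M; suff H s t : s <= t -> `|f t - f s| <= M * `|t - s|.
  move=> s t; case/orP: (le_total s t) => /H //.
  by rewrite distrC (distrC t).
move=> st.
have [|c _ ->] := @MVT_segment R f f' s t st (fun (u : R) _ => df u).
  by apply: continuous_subspaceT => u; exact: is_derive_continuous (df u).
by rewrite normrM ler_wpM2r.
Qed.

(** Difference quotients commute with shifts by a period, so both ['D_(0, 1) g] and the mixed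
    derivative inherit the periods of [g]. *)
Lemma bounded_mixed_partial_everywhere g :
  periodic2 g -> bounded_mixed_partial g ->
  exists2 M : R, 0 <= M & forall x,
    [/\ derivable g x (1, 0), derivable g x (0, 1),
        derivable ('D_(0, 1) g) x (1, 0) &
        `|'D_(1, 0) ('D_(0, 1) g) x| <= M].
Proof.
move=> /periodic2_int gp [gd gM].
have d2p k l x : 'D_(0, 1) g (x + period k l) = 'D_(0, 1) g x.
  by apply: derive_shift; exact: gp.
have d12p k l x : 'D_(1, 0) ('D_(0, 1) g) (x + period k l) =
    'D_(1, 0) ('D_(0, 1) g) x.
  by apply: derive_shift; exact: d2p.
have [M MP] : exists M : R, forall x, Pi2 x ->
    `|'D_(1, 0) ('D_(0, 1) g) x| <= M.
  move: gM; set S := ereal_sup _.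
  have SP x : Pi2 x -> (`|'D_(1, 0) ('D_(0, 1) g) x|%:E <= S)%E.
    by move=> xP; apply: ereal_sup_ubound; exists x.
  case: S SP => [M| |] SP // _; first by exists M => x /SP; rewrite lee_fin.
  by exists 0 => x /SP; rewrite leeNy_eq.
exists (Num.max 0 M); first by rewrite le_max lexx.
move=> x; have [k [l [y [yP ->]]]] := Pi2_cover x.
have [d1 d2 d12] := gd y yP.
split; [exact: derivable_shift (gp k l) d1|exact: derivable_shift (gp k l) d2|
  exact: derivable_shift (d2p k l) d12|].
by rewrite d12p le_max MP ?orbT.
Qed.

(** The mean value inequality is applied twice, in the second variable to a difference of two slices
    and in the first variable to ['D_(0, 1) g]. Existence and boundedness of the mixed derivative
    suffice for this, without its continuity. *)
Lemma mixed_difference_le g (M : R) :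
  (forall x, [/\ derivable g x (1, 0), derivable g x (0, 1),
        derivable ('D_(0, 1) g) x (1, 0) &
        `|'D_(1, 0) ('D_(0, 1) g) x| <= M]) ->
  forall s s' t t', `|(g (s, t) - g (s', t)) - (g (s, t') - g (s', t'))| <=
    M * `|s - s'| * `|t - t'|.
Proof.
move=> H s s' t t'.
apply: (@lipschitz_is_derive (fun u => g (s, u) - g (s', u))
  (fun u => 'D_(0, 1) g (s, u) - 'D_(0, 1) g (s', u))) => u.
  by apply: is_deriveB; apply: is_derive_slice2; case: (H (s, u)); case: (H (s', u)).
apply: (@lipschitz_is_derive (fun w => 'D_(0, 1) g (w, u))
  (fun w => 'D_(1, 0) ('D_(0, 1) g) (w, u))) => w; have [_ _ d12 le12] := H (w, u).
  exact: is_derive_slice1 d12.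
exact: le12.
Qed.

(** Around [(s, t)], [g] is the sum of its two slices through that point, minus a constant, plus a
    mixed second difference. The slices are continuous because they are differentiable; the mixed
    difference is at most [M] times a product of increments. *)
Lemma bounded_mixed_partial_continuous g :
  periodic2 g -> bounded_mixed_partial g -> continuous g.
Proof.
move=> gp gd [s t].
have [M M0 H] := bounded_mixed_partial_everywhere gp gd.
have D := mixed_difference_le H; have [d1 d2 _ _] := H (s, t).
have c1 : {for s, continuous (fun u => g (u, t))}.
  exact: is_derive_continuous (is_derive_slice1 d1).
have c2 : {for t, continuous (fun u => g (s, u))}.
  exact: is_derive_continuous (is_derive_slice2 d2).
have E : g = fun z : R * R =>
    (g (z.1, t) + g (s, z.2) - g (s, t)) +
    ((g (z.1, z.2) - g (s, z.2)) - (g (z.1, t) - g (s, t))).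
  by apply/funext => -[u v] /=; ring.
have f1 : {for (s, t), continuous (@fst R R)} by exact: cvg_fst.
have f2 : {for (s, t), continuous (@snd R R)} by exact: cvg_snd.
have g1 : {for (s, t), continuous (fun z : R * R => g (z.1, t))}.
  exact: (@continuous_comp _ _ _ fst (fun u => g (u, t)) _ f1 c1).
have g2 : {for (s, t), continuous (fun z : R * R => g (s, z.2))}.
  exact: (@continuous_comp _ _ _ snd (fun u => g (s, u)) _ f2 c2).
rewrite E /prop_for /continuous_at /=.
apply: cvgD; first by apply: cvgB; [exact: cvgD g1 g2|exact: cvg_cst].
rewrite !subrr.
apply: (@squeeze_cvgr _ _ _ _ (fun z : R * R => - (M * `|z.1 - s| * `|z.2 - t|))
  (fun z : R * R => M * `|z.1 - s| * `|z.2 - t|)).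
- by near=> z; rewrite -ler_norml.
- have -> : 0 = - (M * `|s - s| * `|t - t|) by rewrite !subrr normr0 !mulr0 oppr0.
  apply: cvgN; apply: cvgM; first apply: cvgM; first exact: cvg_cst.
    by apply: cvg_norm; apply: cvgB; [exact: cvg_fst|exact: cvg_cst].
  by apply: cvg_norm; apply: cvgB; [exact: cvg_snd|exact: cvg_cst].
- have -> : 0 = (M * `|s - s| * `|t - t|) by rewrite !subrr normr0 !mulr0.
  apply: cvgM; first apply: cvgM; first exact: cvg_cst.
    by apply: cvg_norm; apply: cvgB; [exact: cvg_fst|exact: cvg_cst].
  by apply: cvg_norm; apply: cvgB; [exact: cvg_snd|exact: cvg_cst].
Unshelve. all: by end_near. Qed.

Lemma periodic_continuous_bounded g :
  periodic2 g -> continuous g -> exists2 M : R, 0 <= M & forall x, `|g x| <= M.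
Proof.
move=> gp gc.
have cP : compact (Pi2 : set (R * R)).
  by apply: compact_setX; exact: segment_compact.
have : bounded_set [set g x | x in Pi2].
  apply: compact_bounded; apply: continuous_compact => //.
  exact: continuous_subspaceT.
move=> [M [_ MM]].
have MP := MM (M + 1) (ltr_pwDr ltr01 (lexx M)).
exists (Num.max 0 (M + 1)); first by rewrite le_max lexx.
move=> x; have [k [l [y [yP ->]]]] := Pi2_cover x.
by rewrite periodic2_int// le_max; apply/orP; right; apply: MP; exists y.
Qed.

End mixed_partial.

(** * Fourier analysis on the grid *)

Section grid.
Context {R : realType}.
Implicit Types (n : nat) (h k s t j : int * int).

Lemma cos_int (x : R) (z : int) : cos (x + 2 * pi * z%:~R) = cos x.
Proof. by apply: periodic1_int => u; rewrite mulr_natl cosD2pi. Qed.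

Lemma sin_int (x : R) (z : int) : sin (x + 2 * pi * z%:~R) = sin x.
Proof. by apply: periodic1_int => u; rewrite mulr_natl sinD2pi. Qed.

(** The factor [2 * sin (x / 2)] turns each term into a difference of consecutive half-integer
    values. Keeping it on the left avoids a division that fails at multiples of 2 pi. *)
Lemma sum_cos_telescope (x : R) n :
  2 * sin (x / 2) * (\sum_(j <- iota 1 n) cos (x * j%:R)) =
  sin (x * n%:R + x / 2) - sin (x / 2).
Proof.
elim: n => [|n IH]; first by rewrite big_nil !mulr0 add0r subrr.
rewrite -(addn1 n) iotaD big_cat big_seq1 /= mulrDr IH add1n addn1.
rewrite (_ : x * n%:R + x / 2 = x * n.+1%:R - x / 2); last first.
  by rewrite -addn1 natrD; field.
rewrite !(sinD, cosD, sinN, cosN); ring.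
Qed.

Lemma sum_sin_telescope (x : R) n :
  2 * sin (x / 2) * (\sum_(j <- iota 1 n) sin (x * j%:R)) =
  cos (x / 2) - cos (x * n%:R + x / 2).
Proof.
elim: n => [|n IH]; first by rewrite big_nil !mulr0 add0r subrr.
rewrite -(addn1 n) iotaD big_cat big_seq1 /= mulrDr IH add1n addn1.
rewrite (_ : x * n%:R + x / 2 = x * n.+1%:R - x / 2); last first.
  by rewrite -addn1 natrD; field.
rewrite !(sinD, cosD, sinN, cosN); ring.
Qed.

Lemma sin_pi_frac_neq0 n (k : int) : (0 < n)%N -> ~~ (n%:Z %| k)%Z ->
  sin (2 * pi * k%:~R / n%:R / 2) != 0 :> R.
Proof.
move=> n0 nk.
have n0' : n%:R != 0 :> R by rewrite pnatr_eq0 -lt0n.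
rewrite (divz_eq k n%:Z) intrD intrM.
set q := (k %/ n)%Z; set m := (k %% n)%Z.
have m0 : 0 < m.
  rewrite lt_neqAle modz_ge0 ?eqz_nat -?lt0n// andbT eq_sym.
  by apply: contra nk => /eqP/dvdz_mod0P.
have mn : m < n%:Z by rewrite ltz_pmod.
rewrite (_ : _ / _ = pi * m%:~R / n%:R + pi * q%:~R); last by field.
have sm : 0 < sin (pi * m%:~R / n%:R) :> R.
  apply: sin_gt0_pi; rewrite divr_gt0 ?mulr_gt0 ?pi_gt0 ?ltr0z ?ltr0n//=.
  rewrite ltr_pdivrMr ?ltr0n// ltr_pM2l ?pi_gt0//.
  by rewrite -(ltr_int R) in mn.
(* A shift by pi only flips the sign of the sine, so the quotient [q] disappears in absolute
   value. *)
have alt : forall z : int, `|sin (pi * m%:~R / n%:R + pi * z%:~R)| = `|sin (pi * m%:~R / n%:R)| :> R.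
  move=> z; apply: (@periodic1_int _ (fun u => `|sin u|)) => u /=.
  by rewrite sinDpi normrN.
by rewrite -normr_eq0 alt normr_eq0 gt_eqF.
Qed.

Lemma sum_cos_sin_grid n (k : int) : (0 < n)%N ->
  \sum_(j <- iota 1 n) cos (2 * pi * j%:R / n%:R * k%:~R) =
    (if (n%:Z %| k)%Z then n%:R else 0) :> R /\
  \sum_(j <- iota 1 n) sin (2 * pi * j%:R / n%:R * k%:~R) = 0 :> R.
Proof.
move=> n0; have n0' : n%:R != 0 :> R by rewrite pnatr_eq0 -lt0n.
case: ifPn => [/dvdzP[q ->]|nk].
  have E (j : nat) : 2 * pi * j%:R / n%:R * (q * n%:Z)%:~R =
      0 + 2 * pi * (q * j%:Z)%:~R :> R by rewrite !intrM; field.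
  split; last by apply: big1 => j _; rewrite E sin_int sin0.
  under eq_bigr do rewrite E cos_int cos0.
  by rewrite big_const_seq count_predT size_iota iter_addr_0.
have E (j : nat) : 2 * pi * j%:R / n%:R * k%:~R =
    2 * pi * k%:~R / n%:R * j%:R :> R by ring.
have := sin_pi_frac_neq0 n0 nk; set x := 2 * pi * k%:~R / n%:R => sx.
(* The angle [x * n] is a multiple of 2 pi, so the two ends of the telescoped sum coincide. *)
have nx : x * n%:R + x / 2 = x / 2 + 2 * pi * k%:~R by rewrite /x; field.
have s0 : 2 * sin (x / 2) != 0 by rewrite mulf_neq0.
under eq_bigr do rewrite E; under [in X in _ /\ X]eq_bigr do rewrite E.
split; apply: (mulfI s0); rewrite mulr0.
  by rewrite sum_cos_telescope nx sin_int subrr.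
by rewrite sum_sin_telescope nx cos_int subrr.
Qed.

Definition zdiv n h : bool := (n%:Z %| h.1)%Z && (n%:Z %| h.2)%Z.

Lemma zdivN n h : zdiv n (- h) = zdiv n h.
Proof. by rewrite /zdiv /= !dvdzE !abszN. Qed.

Lemma dotD (w : R * R) s t : dot w (s + t) = dot w s + dot w t.
Proof. by rewrite /dot /= !intrD; ring. Qed.

Lemma dotN (w : R * R) s : dot w (- s) = - dot w s.
Proof. by rewrite /dot /= !rmorphN /=; ring. Qed.

Lemma sum_Lam n (F : int * int -> R) :
  \sum_(j <- Lam n) F j =
  \sum_(a <- iota 1 n) \sum_(b <- iota 1 n) F (Posz a, Posz b).
Proof. by rewrite /Lam big_allpairs_dep. Qed.

Lemma sum_cos_sin_Lam n h : (0 < n)%N ->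
  \sum_(j <- Lam n) cos (dot (freq n j) h) =
    (if zdiv n h then n%:R ^+ 2 else 0) :> R /\
  \sum_(j <- Lam n) sin (dot (freq n j) h) = 0 :> R.
Proof.
move=> n0; have [c1 s1] := sum_cos_sin_grid h.1 n0.
have [c2 s2] := sum_cos_sin_grid h.2 n0.
rewrite !sum_Lam /dot /=; split.
  under eq_bigr do (under eq_bigr do rewrite cosD; rewrite sumrB -!mulr_sumr).
  rewrite sumrB -!mulr_suml c1 s1 c2 s2 mul0r subr0 /zdiv.
  by do 2 case: ifP => _; rewrite ?mul0r ?mulr0//= -expr2.
under eq_bigr do (under eq_bigr do rewrite sinD; rewrite big_split -!mulr_sumr).
rewrite big_split -!mulr_suml s1 s2 mul0r mulr0. by rewrite /= addr0.
Qed.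

Lemma cosM_half (x y : R) : cos x * cos y = (cos (x - y) + cos (x + y)) / 2.
Proof. by rewrite cosB cosD; field. Qed.

(** Orthogonality on the grid, up to aliasing. Cosines do not distinguish [k] from [- k], hence two
    residue classes; the symmetry of the coefficients merges them wherever the identity is applied
    to sums over lags. *)
Lemma sum_cosM_Lam n h k : (0 < n)%N ->
  \sum_(j <- Lam n) cos (dot (freq n j) h) * cos (dot (freq n j) k) =
  n%:R ^+ 2 * ((zdiv n (h - k))%:R + (zdiv n (h + k))%:R) / 2 :> R.
Proof.
move=> n0; under eq_bigr do rewrite cosM_half -dotN -!dotD.
rewrite -mulr_suml big_split /= !(sum_cos_sin_Lam _ n0).1.
by do 2 case: ifP; rewrite ?addr0 ?add0r ?mulr1n ?mulr0n => *; field.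
Qed.

Lemma mem_Lam n t : (t \in Lam n) = [&& 1 <= t.1, t.1 <= n%:Z, 1 <= t.2 & t.2 <= n%:Z].
Proof.
case: t => x y; apply/allpairsP/idP => [[[i j] /= [+ + [-> ->]]]|/= /and4P[? ? ? ?]].
  by rewrite !mem_iota; lia.
by exists (`|x|%N, `|y|%N); split => /=; rewrite ?mem_iota; [lia..|congr pair; lia].
Qed.

Lemma Lam_uniq n : uniq (Lam n).
Proof. by apply: allpairs_uniq => [||[? ?] [? ?] _ _ [-> ->]//]; exact: iota_uniq. Qed.

Lemma size_Lam n : size (Lam n) = (n * n)%N.
Proof. by rewrite size_allpairs !size_iota. Qed.

Lemma Lam_diff n s t : s \in Lam n -> t \in Lam n -> (mnorm (t - s)%R <= n)%N.
Proof. by rewrite !mem_Lam /mnorm /=; lia. Qed.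

Lemma Lam_shift_perm n s : s \in Lam n ->
  perm_eq (Lam n) [seq s + h | h <- box n & s + h \in Lam n].
Proof.
move=> sn; apply: uniq_perm => [||t]; first exact: Lam_uniq.
  by rewrite map_inj_uniq ?filter_uniq ?box_uniq//; exact: addrI.
apply/idP/mapP => [tn|[h]]; last by rewrite mem_filter => /andP[hn _] ->.
exists (t - s); last by rewrite addrC subrK.
by rewrite mem_filter addrC subrK tn mem_box Lam_diff.
Qed.

Lemma sum_Lam_lag n (F : int * int -> int * int -> R) :
  \sum_(s <- Lam n) \sum_(t <- Lam n) F s t =
  \sum_(h <- box n) \sum_(s <- Lam n | s + h \in Lam n) F s (s + h).
Proof.
under [RHS]eq_bigr do rewrite big_mkcond /=.
rewrite [RHS]exchange_big /=; apply: eq_big_seq => s sn.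
by rewrite (perm_big _ (Lam_shift_perm sn)) big_map big_filter big_mkcond.
Qed.

Lemma sqr_trig_sum n (c : int * int -> R) (w : R * R) :
  (\sum_(s <- Lam n) c s * cos (dot w s)) ^+ 2 +
  (\sum_(s <- Lam n) c s * sin (dot w s)) ^+ 2 =
  \sum_(s <- Lam n) \sum_(t <- Lam n) c s * c t * cos (dot w (t - s)).
Proof.
rewrite !expr2 !mulr_suml -big_split; apply: eq_bigr => s _ /=.
rewrite !mulr_sumr -big_split; apply: eq_bigr => t _ /=.
by rewrite dotD dotN cosB; ring.
Qed.

End grid.

(** * The Fejer kernel and Fejer inversion through grid sums *)

Section fejer.
Context {R : realType}.
Implicit Types (M N : nat) (h s t j : int * int) (g : R * R -> R) (x z : R * R).

(* The Riemann sums of the Fourier coefficients; unlike the latter, they interact with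
   the Fejer kernel through exact identities. *)
Definition rcoef g N h : R := (2 * pi) ^+ 2 / N%:R ^+ 2 *
  \sum_(j <- Lam N) cos (dot (freq N j) h) * g (freq N j).

(** This is the squared modulus of the sum of [exp (i a x)] over [1 <= a <= M], divided by [M]; in
    this form nonnegativity is immediate. *)
Definition fejer M (x : R) : R :=
  ((\sum_(a <- iota 1 M) cos (x * a%:R)) ^+ 2 +
   (\sum_(a <- iota 1 M) sin (x * a%:R)) ^+ 2) / M%:R.

Lemma fejer_ge0 M (x : R) : 0 <= fejer M x.
Proof. by rewrite divr_ge0// addr_ge0// sqr_ge0. Qed.

(** The telescoped sums show that [1 - cos x] times the numerator equals [1 - cos (x * M)], which is
    at most 2. *)
Lemma fejer_le M (x e : R) : (0 < M)%N -> 0 < e -> e <= 1 - cos x ->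
  fejer M x <= 2 / (M%:R * e).
Proof.
move=> M0 e0 ex.
have M0' : 0 < M%:R :> R by rewrite ltr0n.
have S2 : 2 * sin (x / 2) ^+ 2 = 1 - cos x.
  rewrite [in RHS](_ : x = x / 2 + x / 2); last by field.
  by rewrite cosD -!expr2 cos2sin2; ring.
set A := (\sum_(a <- iota 1 M) cos (x * a%:R)) ^+ 2 +
         (\sum_(a <- iota 1 M) sin (x * a%:R)) ^+ 2.
have E : (1 - cos x) * A * 2 = 2 - 2 * cos (x * M%:R).
  rewrite -S2.
  transitivity ((sin (x * M%:R + x / 2) - sin (x / 2)) ^+ 2 +
    (cos (x / 2) - cos (x * M%:R + x / 2)) ^+ 2).
    by rewrite -sum_cos_telescope -sum_sin_telescope /A; ring.
  have := cos2Dsin2 (x * M%:R + x / 2); have := cos2Dsin2 (x / 2).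
  have -> : cos (x * M%:R) = cos (x * M%:R + x / 2 - x / 2) by rewrite addrK.
  by rewrite cosB; move: (cos _) (cos _) (sin _) (sin _) => *; nra.
have A0 : 0 <= A by rewrite addr_ge0// sqr_ge0.
have A2 : e * A <= 2.
  apply: (le_trans (ler_wpM2r A0 ex)).
  by have := cos_geN1 (x * M%:R); lra.
rewrite /fejer -/A ler_pdivrMr// (_ : 2 / (M%:R * e) * M%:R = 2 / e); last first.
  by field; rewrite !gt_eqF.
by rewrite ler_pdivlMr// mulrC.
Qed.

Lemma fejerE M (x : R) : fejer M x =
  (\sum_(a <- iota 1 M) \sum_(b <- iota 1 M) cos (x * (b%:Z - a%:Z)%:~R)) / M%:R.
Proof.
rewrite /fejer; congr (_ / _).
rewrite !expr2 !mulr_suml -big_split; apply: eq_bigr => a _ /=.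
rewrite !mulr_sumr -big_split; apply: eq_bigr => b _ /=.
by rewrite intrB mulrBr cosB; ring.
Qed.

(** Since [M <= N], two distinct indices below [M] are never congruent modulo [N], so only the
    diagonal survives. The grid average is thus exactly 1 at every [x], not merely in the limit. *)
Lemma fejer_mean M N (x : R) : (0 < M)%N -> (M <= N)%N ->
  \sum_(j <- iota 1 N) fejer M (x - 2 * pi * j%:R / N%:R) = N%:R.
Proof.
move=> M0 MN; have N0 := leq_trans M0 MN.
under eq_bigr do rewrite fejerE.
rewrite -mulr_suml exchange_big /=.
rewrite (eq_big_seq (fun=> N%:R)); last first.
  move=> a; rewrite mem_iota => aM; rewrite exchange_big /=.
  rewrite (bigD1_seq a) ?iota_uniq ?mem_iota//=.
  rewrite [X in X + _](_ : _ = N%:R); last first.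
    under eq_bigr do rewrite subrr mulr0 cos0.
    by rewrite big_const_seq count_predT size_iota iter_addr_0.
  rewrite big_seq_cond big1 ?addr0// => b; rewrite mem_iota => /andP[bM ba].
  have [c s] := @sum_cos_sin_grid R N (b%:Z - a%:Z) N0.
  under eq_bigr do rewrite mulrBl cosB.
  have nd : (N%:Z %| b%:Z - a%:Z)%Z = false.
    rewrite dvdzE; apply/negP => /dvdn_leq.
    by move: aM bM ba; lia.
  by rewrite big_split -!mulr_sumr s c nd /= !mulr0 addr0.
rewrite big_const_seq count_predT size_iota iter_addr_0.
by rewrite -[_ *+ M]mulr_natr mulfK// pnatr_eq0 -lt0n.
Qed.

Lemma fejer2E M x : fejer M x.1 * fejer M x.2 =
  (\sum_(s <- Lam M) \sum_(t <- Lam M) cos (dot x (t - s))) / M%:R ^+ 2.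
Proof.
transitivity (((\sum_(s <- Lam M) cos (dot x s)) ^+ 2 +
  (\sum_(s <- Lam M) sin (dot x s)) ^+ 2) / M%:R ^+ 2).
  rewrite !sum_Lam /dot /=.
  under eq_bigr do (under eq_bigr do rewrite cosD; rewrite sumrB -!mulr_sumr).
  rewrite sumrB -!mulr_suml.
  under [in RHS]eq_bigr do (under eq_bigr do rewrite sinD; rewrite big_split -!mulr_sumr).
  rewrite big_split -!mulr_suml /fejer expr2 invfM.
  by rewrite /=; ring.
have := sqr_trig_sum M (fun=> 1) x.
under eq_bigr do rewrite mul1r; under [X in _ + X ^+ 2]eq_bigr do rewrite mul1r.
move=> ->; congr (_ / _).
by apply: eq_bigr => s _; apply: eq_bigr => t _; rewrite !mul1r.
Qed.

Lemma fejer2_mean M N x : (0 < M)%N -> (M <= N)%N ->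
  \sum_(j <- Lam N) fejer M (x.1 - (freq N j).1) * fejer M (x.2 - (freq N j).2) =
  N%:R ^+ 2.
Proof.
move=> M0 MN; rewrite sum_Lam /freq /=.
under eq_bigr do rewrite -mulr_sumr.
by rewrite -mulr_suml !fejer_mean.
Qed.

(** For the grid points far from [x] in the second coordinate: there the second kernel is bounded by
    a small constant and the first one alone remains to be averaged. *)
Lemma fejer_mean1 M N x : (0 < M)%N -> (M <= N)%N ->
  \sum_(j <- Lam N) fejer M (x.1 - (freq N j).1) = N%:R ^+ 2.
Proof.
move=> M0 MN; rewrite sum_Lam /freq /=.
rewrite exchange_big /=; under eq_bigr do rewrite fejer_mean//.
by rewrite big_const_seq count_predT size_iota iter_addr_0 -[LHS]mulr_natr.
Qed.

Lemma fejer_mean2 M N x : (0 < M)%N -> (M <= N)%N ->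
  \sum_(j <- Lam N) fejer M (x.2 - (freq N j).2) = N%:R ^+ 2.
Proof.
move=> M0 MN; rewrite sum_Lam /freq /=.
under eq_bigr do rewrite fejer_mean//.
by rewrite big_const_seq count_predT size_iota iter_addr_0 -[LHS]mulr_natr.
Qed.

Lemma cos_near (d y : R) : 0 < d -> d <= pi -> 1 - cos y < 1 - cos d ->
  exists k : int, `|y + 2 * pi * k%:~R| < d.
Proof.
move=> d0 dpi cy.
(* The shift by pi puts the representative [z - pi] in [[- pi, pi]], where the cosine decreases in
   the absolute value. *)
have [k [l [[z t] [[/= zP _] /= zE]]]] := Pi2_cover (y + pi, 0).
have [zE1 _] : y + pi = z + 2 * pi * k%:~R /\ True by case: zE.
have yE : z - pi = y + 2 * pi * (- k)%:~R by rewrite rmorphN /=; lra.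
exists (- k); rewrite -yE ltNge; apply/negP => dz.
have zpi : `|z - pi| <= pi by rewrite ler_norml; move: zP; rewrite in_itv/=; lra.
have : cos `|z - pi| <= cos d.
  by rewrite leNgt ltr_cos ?in_itv/= ?dpi ?(ltW d0) ?zpi ?normr_ge0// -leNgt.
have -> : cos `|z - pi| = cos (z - pi) by case: ger0P => // _; rewrite cosN.
rewrite yE cos_int; lra.
Qed.

(** [1 - cos] measures distance on the circle in precisely the form required by [fejer_le]. A small
    value places some translate of [z] close to [x], and [g] does not see the translation. *)
Lemma continuous_periodic_near g x (e : R) : periodic2 g -> {for x, continuous g} ->
  0 < e -> exists2 eta : R, 0 < eta & forall z,
    1 - cos (x.1 - z.1) < eta -> 1 - cos (x.2 - z.2) < eta -> `|g x - g z| < e.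
Proof.
move=> gp /cvgrPdist_lt gc e0.
have /nbhs_ballP [d0 /= d0pos dP] := gc e e0.
pose d := Num.min d0 pi.
have dpos : 0 < d by rewrite lt_min d0pos pi_gt0.
have dpi : d <= pi by rewrite ge_min lexx orbT.
exists (1 - cos d).
  rewrite subr_gt0 -[ltRHS]cos0.
  by rewrite ltr_cos ?in_itv/= ?dpi ?(ltW dpos) ?lexx ?pi_ge0.
move=> z /(cos_near dpos dpi)[k zk] /(cos_near dpos dpi)[l zl].
have -> : g z = g (z + period (- k) (- l)) by rewrite periodic2_int.
apply: dP; split; rewrite /ball /=.
  move: zk; rewrite lt_min => /andP[+ _]; congr (`|_| < _).
  by rewrite rmorphN /=; ring.
move: zl; rewrite lt_min => /andP[+ _]; congr (`|_| < _).
by rewrite rmorphN /=; ring.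
Qed.

(** The threshold for [M] does not depend on [N]; this uniformity is what later allows [N] to tend
    to infinity with [M] fixed. *)
Lemma fejer_approx g (B : R) x (e : R) : periodic2 g -> {for x, continuous g} ->
  (forall z, `|g z| <= B) -> 0 < e ->
  \forall M \near \oo, forall N, (M <= N)%N ->
  `|(\sum_(j <- Lam N)
      fejer M (x.1 - (freq N j).1) * fejer M (x.2 - (freq N j).2) * g (freq N j))
     / N%:R ^+ 2 - g x| <= e.
Proof.
move=> gp gc gB e0.
have B0 : 0 <= B by apply: le_trans (gB x).
have e20 : 0 < e / 2 by rewrite divr_gt0.
have [eta eta0 etaP] := continuous_periodic_near gp gc e20.
near=> M => N MN.
have M0 : (0 < M)%N by near: M; exists 1%N.
have N0 : 0 < N%:R :> R by rewrite ltr0n (leq_trans M0 MN).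
(* Outside the neighborhood of [x], the oscillation [2 * B] times the kernel bound [2 / (M * eta)],
   for each of the two coordinates, averages to [8 * B / (M * eta)]. *)
have Mbig : 8 * B / (e / 2) <= M%:R * eta.
  rewrite -ler_pdivrMr//; near: M; exact: nbhs_infty_ger.
pose c := 2 / (M%:R * eta).
have c0 : 0 <= c by rewrite divr_ge0// mulr_ge0// ltW.
pose k1 j := fejer M (x.1 - (freq N j).1).
pose k2 j := fejer M (x.2 - (freq N j).2).
(* Close to [x] in both coordinates, continuity gives the first term; otherwise one kernel is at
   most [c], which gives the second. *)
have step j : k1 j * k2 j * `|g (freq N j) - g x| <=
    e / 2 * (k1 j * k2 j) + 2 * B * c * (k1 j + k2 j).
  have k10 : 0 <= k1 j by exact: fejer_ge0.
  have k20 : 0 <= k2 j by exact: fejer_ge0.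
  have g2 : `|g (freq N j) - g x| <= 2 * B.
    apply: le_trans (ler_normB _ _) _.
    by have := gB (freq N j); have := gB x; lra.
  have Bc : 0 <= B * c by exact: mulr_ge0.
  have k12 : 0 <= k1 j * k2 j by exact: mulr_ge0.
  have [l1|l1] := ltP (1 - cos (x.1 - (freq N j).1)) eta; last first.
    have k1c : k1 j <= c by exact: fejer_le.
    apply: (@le_trans _ _ (c * k2 j * (2 * B))).
      by apply: ler_pM => //; exact: ler_wpM2r.
    have : 0 <= e / 2 * (k1 j * k2 j) by rewrite mulr_ge0// ltW.
    have : 0 <= B * c * k1 j by rewrite mulr_ge0.
    lra.
  have [l2|l2] := ltP (1 - cos (x.2 - (freq N j).2)) eta; last first.
    have k2c : k2 j <= c by exact: fejer_le.
    apply: (@le_trans _ _ (k1 j * c * (2 * B))).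
      by apply: ler_pM => //; exact: ler_wpM2l.
    have : 0 <= e / 2 * (k1 j * k2 j) by rewrite mulr_ge0// ltW.
    have : 0 <= B * c * k2 j by rewrite mulr_ge0.
    lra.
  have := etaP _ l1 l2; rewrite distrC => /ltW gl.
  rewrite mulrC; apply: (le_trans (ler_wpM2r k12 gl)).
  by rewrite lerDl; apply: mulr_ge0; [rewrite -mulrA mulr_ge0|exact: addr_ge0].
have -> : g x = (\sum_(j <- Lam N) k1 j * k2 j * g x) / N%:R ^+ 2.
  by rewrite -mulr_suml fejer2_mean// mulrAC mulfV ?mul1r// expf_neq0// gt_eqF.
rewrite -mulrBl -sumrB normrM normfV (ger0_norm (sqr_ge0 _)).
rewrite ler_pdivrMr ?exprn_gt0//.
apply: le_trans (ler_norm_sum _ _ _) _.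
apply: (@le_trans _ _ (\sum_(j <- Lam N) (e / 2 * (k1 j * k2 j) + 2 * B * c * (k1 j + k2 j)))).
  apply: ler_sum => j _; apply: le_trans (step j).
  by rewrite -mulrBr normrM ger0_norm// mulr_ge0// fejer_ge0.
rewrite big_split -!mulr_sumr big_split /= fejer2_mean// fejer_mean1// fejer_mean2//.
have c8 : 8 * B / (M%:R * eta) <= e / 2.
  have Me : 0 < M%:R * eta by rewrite mulr_gt0// ltr0n.
  by move: Mbig; rewrite ler_pdivrMr// => Mbig; rewrite ler_pdivrMr// (mulrC (e / 2)).
have cE : 2 * B * c * (N%:R ^+ 2 + N%:R ^+ 2) = 8 * B / (M%:R * eta) * N%:R ^+ 2.
  by rewrite /c; ring.
rewrite cE -mulrDl ler_pM2r ?exprn_gt0//; lra.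
Unshelve. all: by end_near. Qed.

(** Adding the means at [x] and [- x] cancels the sines, so only the cosine coefficients of [g]
    enter. *)
Lemma fejer_sum_sym g N M x : (0 < N)%N -> (0 < M)%N ->
  (\sum_(j <- Lam N)
     fejer M (x.1 - (freq N j).1) * fejer M (x.2 - (freq N j).2) * g (freq N j))
     / N%:R ^+ 2 +
  (\sum_(j <- Lam N)
     fejer M ((- x).1 - (freq N j).1) * fejer M ((- x).2 - (freq N j).2) * g (freq N j))
     / N%:R ^+ 2 =
  2 / (2 * pi) ^+ 2 * ((\sum_(s <- Lam M) \sum_(t <- Lam M)
     rcoef g N (t - s) * cos (dot x (t - s))) / M%:R ^+ 2).
Proof.
move=> N0 M0.
have N0' : N%:R != 0 :> R by rewrite pnatr_eq0 -lt0n.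
have M0' : M%:R != 0 :> R by rewrite pnatr_eq0 -lt0n.
have pi0 : pi != 0 :> R by rewrite gt_eqF// pi_gt0.
rewrite -mulrDl -big_split /=.
have E j : fejer M (x.1 - (freq N j).1) * fejer M (x.2 - (freq N j).2) * g (freq N j) +
   fejer M ((- x).1 - (freq N j).1) * fejer M ((- x).2 - (freq N j).2) * g (freq N j) =
   \sum_(s <- Lam M) \sum_(t <- Lam M)
     (2 / M%:R ^+ 2 * cos (dot x (t - s))) * (cos (dot (freq N j) (t - s)) * g (freq N j)).
  rewrite (fejer2E M (x - freq N j)) (fejer2E M (- x - freq N j)) -!mulrDl -big_split /= !mulr_suml.
  apply: eq_bigr => s _; rewrite -big_split !mulr_suml; apply: eq_bigr => t _ /=.
  have -> u : dot (x - freq N j) u = dot x u - dot (freq N j) u by rewrite /dot /=; ring.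
  have -> u : dot (- x - freq N j) u = - dot x u - dot (freq N j) u by rewrite /dot /=; ring.
  by rewrite !cosB cosN sinN; field.
under eq_bigr do rewrite E.
rewrite exchange_big /= !mulr_suml mulr_sumr; apply: eq_bigr => s _.
rewrite exchange_big /= !mulr_suml mulr_sumr; apply: eq_bigr => t _.
rewrite -mulr_sumr /rcoef; move: pi pi0 => p p0; field; exact/and3P.
Qed.

Lemma cvg_sumr (I T : Type) (F : set_system T) (s : seq I) (u : I -> T -> R)
    (l : I -> R) : Filter F -> (forall i, u i n @[n --> F] --> l i) ->
  \sum_(i <- s) u i n @[n --> F] --> \sum_(i <- s) l i.
Proof. by move=> FF ul; apply: cvg_big => //; exact: add_continuous. Qed.

(** With [M] fixed, [N] tends to infinity in [fejer_sum_sym]: the finitely many [rcoef g N] become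
    [psi], while the approximation bound is uniform in [N] and passes to the limit. *)
Lemma fejer_inversion g (B : R) (psi : int * int -> R) x :
  periodic2 g -> continuous g -> (forall z, `|g z| <= B) ->
  (forall h, rcoef g N h @[N --> \oo] --> psi h) ->
  (\sum_(s <- Lam M) \sum_(t <- Lam M) psi (t - s) * cos (dot x (t - s))) / M%:R ^+ 2
    @[M --> \oo] --> (2 * pi) ^+ 2 * ((g x + g (- x)) / 2).
Proof.
move=> gp gc gB psiP.
pose A M := (\sum_(s <- Lam M) \sum_(t <- Lam M) psi (t - s) * cos (dot x (t - s))) / M%:R ^+ 2.
suff H : 2 / (2 * pi) ^+ 2 * A M @[M --> \oo] --> g x + g (- x).
  have pi0 : pi != 0 :> R by rewrite gt_eqF// pi_gt0.
  have -> : (2 * pi) ^+ 2 * ((g x + g (- x)) / 2) = (2 * pi) ^+ 2 / 2 * (g x + g (- x)).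
    by field.
  rewrite (_ : (fun M => _) = (fun M => (2 * pi) ^+ 2 / 2 * (2 / (2 * pi) ^+ 2 * A M))).
    by apply: cvgM => //; exact: cvg_cst.
  apply/funext => M; rewrite -/(A M); move: pi pi0 => p p0; field.
  by rewrite p0.
apply/cvgrPdist_le => e e0.
have e20 : 0 < e / 2 by rewrite divr_gt0.
move: (fejer_approx gp (gc x) gB e20) (fejer_approx gp (gc (- x)) gB e20)
  (nbhs_infty_gt 0).
apply: filterS3 => M H1 H2 M0.
rewrite distrC.
have L : `|2 / (2 * pi) ^+ 2 * ((\sum_(s <- Lam M) \sum_(t <- Lam M)
     rcoef g N (t - s) * cos (dot x (t - s))) / M%:R ^+ 2) - (g x + g (- x))|
     @[N --> \oo] --> `|2 / (2 * pi) ^+ 2 * A M - (g x + g (- x))|.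
  apply: cvg_norm; apply: cvgB; last exact: cvg_cst.
  apply: cvgM; first exact: cvg_cst.
  apply: cvgM; last exact: cvg_cst.
  apply: cvg_sumr => s; apply: cvg_sumr => t.
  by apply: cvgM; [exact: psiP|exact: cvg_cst].
apply: (cvgr_to_le L).
near=> N.
have MN : (M <= N)%N by near: N; exact: nbhs_infty_ge.
rewrite -fejer_sum_sym ?(leq_trans M0 MN)//.
have := H1 N MN; have := H2 N MN; rewrite !ler_norml; lra.
Unshelve. all: by end_near. Qed.

End fejer.

(** * Finite sums and dominated convergence for real-valued integrals *)

Section Rintegral_facts.
Context {d} {T : measurableType d} {R : realType}.
Variable mu : {measure set T -> \bar R}.
Variable D : set T.
Hypothesis mD : measurable D.

Lemma integrable_sumr (I : Type) (s : seq I) (f : I -> T -> R) :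
  (forall i, mu.-integrable D (EFin \o f i)) ->
  mu.-integrable D (EFin \o (fun w => \sum_(i <- s) f i w)).
Proof.
move=> fi; rewrite (_ : _ \o _ = fun w => (\sum_(i <- s) (f i w)%:E)%E).
  by apply: integrable_sum => // i _; exact: fi.
by apply/funext => w /=; rewrite sumEFin.
Qed.

Lemma Rintegral_sum (I : Type) (s : seq I) (f : I -> T -> R) :
  (forall i, mu.-integrable D (EFin \o f i)) ->
  \int[mu]_(w in D) (\sum_(i <- s) f i w) = \sum_(i <- s) \int[mu]_(w in D) f i w.
Proof.
move=> fi; elim: s => [|i s IH].
  by under eq_Rintegral do rewrite big_nil; rewrite big_nil Rintegral_cst// mul0r.
under eq_Rintegral do rewrite big_cons.
by rewrite RintegralD//; [rewrite IH big_cons|exact: integrable_sumr].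
Qed.

Lemma bounded_integrable (f : T -> R) (B : R) : (mu D < +oo)%E ->
  measurable_fun D f -> (forall w, D w -> `|f w| <= B) ->
  mu.-integrable D (EFin \o f).
Proof.
move=> muD mf fB; apply: measurable_bounded_integrable => //.
exists B; split; first exact: num_real.
by move=> M BM w /= Dw; apply: le_trans (fB w Dw) (ltW BM).
Qed.

Lemma Rintegral_dominated (f_ : nat -> T -> R) (f : T -> R) (B : R) :
  (mu D < +oo)%E -> (forall n, measurable_fun D (f_ n)) ->
  (forall n w, D w -> `|f_ n w| <= B) ->
  (forall w, D w -> f_ n w @[n --> \oo] --> f w) ->
  \int[mu]_(w in D) f_ n w @[n --> \oo] --> \int[mu]_(w in D) f w.
Proof.
move=> muD mf fB ff.
have mfl : measurable_fun D f by exact: measurable_fun_cvg mf ff.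
have [|||||ifl _ H] := @dominated_convergence _ _ _ mu D mD
  (fun n => EFin \o f_ n) (EFin \o f) (EFin \o cst B).
- by move=> n; exact/measurable_EFinP.
- exact/measurable_EFinP.
- by apply: aeW => w Dw; apply: cvg_EFin; [exact: nearW|exact: ff].
- by apply: (@bounded_integrable _ `|B|) => // w _; exact: ler_norm.
- by apply: aeW => w n Dw /=; rewrite lee_fin fB.
apply: fine_cvg; rewrite fineK//.
exact: integrable_fin_num.
Qed.

End Rintegral_facts.

(** * Riemann sums over the frequency grid *)

Section riemann.
Context {R : realType}.
Implicit Types (N i : nat) (G : R * R -> R).

(** Half-open to the left, except for the first cell, which also contains 0: the [N] cells partition
    the closed interval, and each is indexed by its right endpoint, as the frequencies are. *)
Definition cell N i : set R :=
  [set` Interval (BSide (i == 1)%N (2 * pi * (i.-1)%:R / N%:R))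
                 (BRight (2 * pi * i%:R / N%:R))].

Lemma cell_uniq N i i' t : (0 < N)%N -> (0 < i)%N -> (0 < i')%N ->
  cell N i t -> cell N i' t -> i = i'.
Proof.
move=> N0; wlog ii' : i i' / (i < i')%N => [H|] i0 i'0 ci ci'.
  by case: (ltngtP i i') => // ?; [exact: H|apply/esym; exact: H].
move: ci ci'; rewrite /cell /= !itv_boundlr => /andP[_ +] /andP[+ _].
rewrite (_ : (i' == 1)%N = false); last by lia.
rewrite !bnd_simp => ti it.
suff : 2 * pi * i%:R / N%:R <= 2 * pi * (i'.-1)%:R / N%:R :> R.
  by move=> /(le_trans ti)/(lt_le_trans it); rewrite ltxx.
by rewrite ler_pM2r ?invr_gt0 ?ltr0n// ler_pM2l ?mulr_gt0 ?pi_gt0// ler_nat; lia.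
Qed.

Lemma cell_exists N (t : R) : (0 < N)%N -> 0 <= t <= 2 * pi ->
  exists i, [/\ i \in iota 1 N, cell N i t & `|t - 2 * pi * i%:R / N%:R| <= 2 * pi / N%:R].
Proof.
move=> N0 /andP[t0 t2].
have N0' : 0 < N%:R :> R by rewrite ltr0n.
pose p i := (0 < i)%N && (t <= 2 * pi * i%:R / N%:R).
have [|i /andP[i0 ti] imin] := @ex_minnP p.
  by exists N; rewrite /p N0 mulfK// gt_eqF.
have iN : (i <= N)%N by apply: imin; rewrite /p N0 mulfK// gt_eqF.
have it : (if i == 1%N then 2 * pi * (i.-1)%:R / N%:R <= t
  else 2 * pi * (i.-1)%:R / N%:R < t).
  case: eqP => [->|/eqP i1]; first by rewrite mulr0 mul0r.
  rewrite ltNge; apply/negP => ti'; suff : (i <= i.-1)%N by lia.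
  by apply: imin; rewrite /p ti' andbT; lia.
have it' : 2 * pi * (i.-1)%:R / N%:R <= t by move: it; case: ifP => // _ /ltW.
exists i; split.
- by rewrite mem_iota; lia.
- rewrite /cell /= itv_boundlr; case: (i == 1%N) it => it; rewrite !bnd_simp ti andbT//.
- rewrite ler_norml; apply/andP; split; last first.
    by apply: (@le_trans _ _ 0); [rewrite subr_le0|rewrite divr_ge0// mulr_ge0// pi_ge0].
  have iE : i%:R = i.-1%:R + 1 :> R by rewrite -(natrD _ _ 1) addn1 prednK.
  by move: it'; rewrite iE; lra.
Qed.

Lemma measurable_cell N i : measurable (cell N i).
Proof. exact: measurable_itv. Qed.

Lemma measure_cell N i : i \in iota 1 N ->
  lebesgue_measure (cell N i) = (2 * pi / N%:R)%:E.
Proof.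
rewrite mem_iota => iN; have N0 : 0 < N%:R :> R by rewrite ltr0n; lia.
rewrite lebesgue_measure_itv /= lte_fin ltr_pM2r ?invr_gt0// ltr_pM2l ?mulr_gt0 ?pi_gt0//.
rewrite ltr_nat (_ : (i.-1 < i)%N); last by lia.
rewrite -EFinB; congr (_%:E); rewrite -mulrBl -mulrBr.
have -> : i%:R = i.-1%:R + 1 :> R by rewrite -(natrD _ _ 1) addn1 prednK//; lia.
by rewrite addrAC subrr add0r mulr1.

Qed.

Lemma cell_sub N i : i \in iota 1 N -> cell N i `<=` `[0, 2 * pi].
Proof.
rewrite mem_iota => iN; have N0 : 0 < N%:R :> R by rewrite ltr0n; lia.
have l0 : 0 <= 2 * pi * i.-1%:R / N%:R :> R by rewrite divr_ge0// !mulr_ge0// pi_ge0.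
have r2 : 2 * pi * i%:R / N%:R <= 2 * pi :> R.
  by rewrite ler_pdivrMr// ler_pM2l ?mulr_gt0 ?pi_gt0// ler_nat; lia.
move=> t; rewrite /cell /= in_itv/= itv_boundlr.
by case: (i == 1)%N; rewrite !bnd_simp => /andP[/= ? ?]; lra.
Qed.

Local Notation mu2 := (@lebesgue_measure R \x @lebesgue_measure R)%E.

Lemma measurable_Pi2 : measurable (Pi2 : set (R * R)).
Proof. by apply: measurableX; exact: measurable_itv. Qed.

Lemma measure_Pi2 : mu2 Pi2 = ((2 * pi) ^+ 2)%:E.
Proof.
pose J : set R := [set` `[0, 2 * pi]].
have L : lebesgue_measure J = (2 * pi)%:E.
  by rewrite lebesgue_measure_itv /= lte_fin mulr_gt0 ?pi_gt0// sube0.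
transitivity (lebesgue_measure J * lebesgue_measure J)%E.
  by apply: product_measure1E; exact: measurable_itv.
by rewrite L expr2.
Qed.

(** The Riemann sum is the integral of a step function that converges pointwise to [G] and is
    bounded by [B], so dominated convergence applies. *)
Lemma riemann_sum_cvg G (B : R) : continuous G -> (forall w, `|G w| <= B) ->
  (2 * pi) ^+ 2 / N%:R ^+ 2 * \sum_(j <- Lam N) G (freq N j) @[N --> \oo] -->
  \int[mu2]_(w in Pi2) G w.
Proof.
move=> Gc GB.
have muf : (mu2 Pi2 < +oo)%E by rewrite measure_Pi2 ltry.
pose A N (j : int * int) := cell N `|j.1|%N `*` cell N `|j.2|%N.
have mA N j : measurable (A N j) by apply: measurableX; exact: measurable_cell.
pose H N (w : R * R) := \sum_(j <- Lam N) G (freq N j) * \1_(A N j) w.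
have mH N : measurable_fun Pi2 (H N).
  apply: measurable_sum => j; apply: measurable_funM; first exact: measurable_cst.
  exact: measurable_indic.
have HE N w : (0 < N)%N -> Pi2 w -> exists j, [/\ H N w = G (freq N j),
    `|w.1 - (freq N j).1| <= 2 * pi / N%:R & `|w.2 - (freq N j).2| <= 2 * pi / N%:R].
  move=> N0 [/= w1 w2].
  have [i1 [iN1 ci1 d1]] := cell_exists N0 w1.
  have [i2 [iN2 ci2 d2]] := cell_exists N0 w2.
  have jN : (Posz i1, Posz i2) \in Lam N by apply/allpairsP; exists (i1, i2).
  exists (Posz i1, Posz i2); split => //.
  rewrite /H (bigD1_seq _ jN (Lam_uniq _))/= indicE mem_set ?mulr1; last by split.
  rewrite big_seq_cond big1 ?addr0// => -[j1 j2] /andP[].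
  move=> /allpairsP[[k1 k2] /= [kN1 kN2 [-> ->]]] /= ne.
  rewrite indicE memNset ?mulr0//= => -[/= c1 c2].
  move: iN1 iN2 kN1 kN2; rewrite !mem_iota => ? ? ? ?.
  have E1 : k1 = i1 by apply: (cell_uniq N0 _ _ c1 ci1); lia.
  have E2 : k2 = i2 by apply: (cell_uniq N0 _ _ c2 ci2); lia.
  by move: ne; rewrite E1 E2 eqxx.
have HB N w : Pi2 w -> `|H N w| <= B.
  case: N => [|N] wP; last by have [|j [-> _ _]] := HE N.+1 w _ wP.
  by rewrite /H big_nil normr0; apply: le_trans (GB w).
have Hc w : Pi2 w -> H N w @[N --> \oo] --> G w.
  move=> wP; apply/cvgrPdist_lt => e e0.
  have /cvgrPdist_lt/(_ e e0)/nbhs_ballP[del /= del0 delP] := Gc w.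
  near=> N.
  have N0 : (0 < N)%N by near: N; exact: nbhs_infty_gt.
  have [j [-> d1 d2]] := HE N w N0 wP.
  have Nd : 2 * pi / N%:R < del.
    rewrite ltr_pdivrMr ?ltr0n// (mulrC del) -ltr_pdivrMr//.
    by near: N; exact: nbhs_infty_gtr.
  by apply: delP; split; apply: le_lt_trans Nd.
have := @Rintegral_dominated _ _ R mu2 Pi2 measurable_Pi2 H G B muf mH HB Hc.
apply: cvg_trans; apply: near_eq_cvg; near=> N.
have N0 : (0 < N)%N by near: N; exact: nbhs_infty_gt.
have mI j : measurable_fun Pi2 (\1_(A N j) : R * R -> R) by exact: measurable_indic.
have I1 j w : `|\1_(A N j) w : R| <= 1.
  by rewrite indicE; case: (w \in _); rewrite ?normr1 ?normr0.
have iI j : mu2.-integrable Pi2 (EFin \o (\1_(A N j) : R * R -> R)).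
  exact: (@bounded_integrable _ _ R mu2 Pi2 measurable_Pi2 (\1_(A N j)) 1 muf (mI j) (fun w _ => I1 j w)).
have iGI j : mu2.-integrable Pi2 (EFin \o (fun w => G (freq N j) * \1_(A N j) w)).
  apply: (@bounded_integrable _ _ R mu2 Pi2 measurable_Pi2 _ B muf).
    exact: measurable_funM (measurable_cst _) (mI j).
  move=> w _; rewrite normrM -[leRHS]mulr1; apply: ler_pM => //; exact: GB.
rewrite /H (@Rintegral_sum _ _ R mu2 Pi2 measurable_Pi2 _ (Lam N)
  (fun j w => G (freq N j) * \1_(A N j) w) iGI).
rewrite mulr_sumr; apply: eq_big_seq => j jN.
rewrite (@RintegralZl _ _ R mu2 Pi2 (\1_(A N j)) (G (freq N j)) measurable_Pi2 (iI j)).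
rewrite /Rintegral (@integral_indic _ _ R mu2 Pi2 measurable_Pi2 (A N j) (mA N j)).
move/allpairsP: jN => [[j1 j2] /= [jN1 jN2 jE]].
rewrite setIidl; last by rewrite /A jE /= => w [/= w1 w2]; split; [exact: cell_sub w1|exact: cell_sub w2].
rewrite (_ : mu2 (A N j) = (2 * pi / N%:R)%R%:E * (2 * pi / N%:R)%R%:E)%E; last first.
  rewrite /A jE -{1}(measure_cell jN1) -(measure_cell jN2).
  by apply: product_measure1E; exact: measurable_cell.
rewrite /=.
by rewrite mulrC; congr (_ * _); field; rewrite pnatr_eq0 -lt0n.
Unshelve. all: by end_near. Qed.

Lemma rcoef_cvg (g : R * R -> R) (B : R) h : continuous g -> (forall w, `|g w| <= B) ->
  rcoef g N h @[N --> \oo] --> fourier_coef g h.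
Proof.
move=> gc gB; apply: (@riemann_sum_cvg (fun w => cos (dot w h) * g w) B).
  move=> w; apply: cvgM; last exact: gc.
  apply: (@continuous_comp _ _ _ (fun w : R * R => dot w h) cos); last exact: continuous_cos.
  apply: cvgD; apply: cvgM; [exact: cvg_fst|exact: cvg_cst|exact: cvg_snd|exact: cvg_cst].
move=> w; rewrite normrM -[leRHS]mul1r; apply: ler_pM => //.
by rewrite ler_norml cos_geN1 cos_le1.
Qed.

End riemann.

(** * Covariances of threshold exceedances under mixing *)

Section bounded_rv.
Context {R : realType} {d} {T : measurableType d}.
Implicit Types (U V : T -> R) (c : R).

(** For fixed [n] every statistic of the field is bounded. The class is closed under algebraic
    operations, so that integrability never has to be discussed again. *)
Definition bdm U : Prop := measurable_fun setT U /\ exists B : R, forall w, `|U w| <= B.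

Lemma bdm_cst c : bdm (fun=> c).
Proof. by split; [exact: measurable_cst|exists `|c|]. Qed.

Lemma bdmD U V : bdm U -> bdm V -> bdm (fun w => U w + V w).
Proof.
move=> [mU [A UA]] [mV [B VB]]; split; first exact: measurable_funD.
by exists (A + B) => w; apply: le_trans (ler_normD _ _) _; exact: lerD.
Qed.

Lemma bdmM U V : bdm U -> bdm V -> bdm (fun w => U w * V w).
Proof.
move=> [mU [A UA]] [mV [B VB]]; split; first exact: measurable_funM.
by exists (A * B) => w; rewrite normrM; apply: ler_pM.
Qed.

Lemma bdmN U : bdm U -> bdm (fun w => - U w).
Proof.
move=> [mU [A UA]]; split; first exact: measurable_funN.
by exists A => w; rewrite normrN.
Qed.

Lemma bdmB U V : bdm U -> bdm V -> bdm (fun w => U w - V w).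
Proof. by move=> bU bV; apply: bdmD => //; exact: bdmN. Qed.

Lemma bdmZ c U : bdm U -> bdm (fun w => c * U w).
Proof. by move=> bU; apply: bdmM => //; exact: bdm_cst. Qed.

Lemma bdm_indic (A : set T) : measurable A -> bdm (\1_A : T -> R).
Proof.
move=> mA; split; first exact: measurable_indic.
by exists 1 => w; rewrite indicE; case: (w \in A); rewrite ?normr1 ?normr0.
Qed.

Lemma bdm_norm U : bdm U -> bdm (fun w => `|U w|).
Proof.
move=> [mU [A UA]]; split; first exact: measurableT_comp.
by exists A => w; rewrite normr_id.
Qed.

Lemma bdm_sum (I : Type) (s : seq I) (p : pred I) (F : I -> T -> R) :
  (forall i, bdm (F i)) -> bdm (fun w => \sum_(i <- s | p i) F i w).
Proof.
move=> bF; elim: s => [|i s IH].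
  by under eq_fun do rewrite big_nil; exact: bdm_cst.
under eq_fun do rewrite big_cons; case: (p i) => //; exact: bdmD.
Qed.

Lemma bdm_comp (phi : R -> R) (B : R) U : continuous phi ->
  (forall x, `|phi x| <= B) -> measurable_fun setT U -> bdm (fun w => phi (U w)).
Proof.
move=> cphi phiB mU; split; last by exists B.
by apply: measurableT_comp => //; exact: continuous_measurable_fun.
Qed.

Variable P : probability T R.

Definition Ex U : R := \int[P]_w U w.

Lemma bdm_integrable U : bdm U -> P.-integrable setT (EFin \o U).
Proof.
move=> [mU [B UB]]; apply: (@bounded_integrable _ _ _ _ _ _ _ B) => //.
exact: le_lt_trans (probability_le1 P measurableT) (ltry 1).
Qed.

Lemma expectationE U : bdm U -> 'E_P[U]%E = (Ex U)%:E.
Proof.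
move=> bU; rewrite unlock /Ex /Rintegral fineK//.
exact/integrable_fin_num/bdm_integrable.
Qed.

Lemma Ex_cst c : Ex (fun=> c) = c.
Proof.
transitivity (c * fine (P setT)); first exact: Rintegral_cst.
by rewrite probability_setT mulr1.
Qed.

Lemma ExD U V : bdm U -> bdm V -> Ex (fun w => U w + V w) = Ex U + Ex V.
Proof. by move=> /bdm_integrable iU /bdm_integrable iV; rewrite /Ex RintegralD. Qed.

Lemma ExZ c U : bdm U -> Ex (fun w => c * U w) = c * Ex U.
Proof. by move=> /bdm_integrable iU; rewrite /Ex RintegralZl. Qed.

Lemma ExN U : bdm U -> Ex (fun w => - U w) = - Ex U.
Proof.
move=> bU; rewrite -mulN1r -ExZ//; congr Ex.
by apply/funext => w; rewrite mulN1r.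
Qed.

Lemma ExB U V : bdm U -> bdm V -> Ex (fun w => U w - V w) = Ex U - Ex V.
Proof. by move=> bU bV; rewrite ExD ?ExN//; exact: bdmN. Qed.

Lemma Ex_sum (I : Type) (s : seq I) (p : pred I) (F : I -> T -> R) :
  (forall i, bdm (F i)) ->
  Ex (fun w => \sum_(i <- s | p i) F i w) = \sum_(i <- s | p i) Ex (F i).
Proof.
move=> bF; elim: s => [|i s IH].
  by under eq_fun do rewrite big_nil; rewrite Ex_cst big_nil.
under eq_fun do rewrite big_cons; rewrite big_cons; case: (p i) => //.
by rewrite ExD ?IH//; exact: bdm_sum.
Qed.

Lemma Ex_le U V : bdm U -> bdm V -> (forall w, U w <= V w) -> Ex U <= Ex V.
Proof. by move=> /bdm_integrable iU /bdm_integrable iV UV; apply: le_Rintegral. Qed.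

Lemma Ex_ge0 U : (forall w, 0 <= U w) -> 0 <= Ex U.
Proof. by move=> U0; apply: Rintegral_ge0. Qed.

Lemma Ex_normr U : bdm U -> `|Ex U| <= Ex (fun w => `|U w|).
Proof. by move=> /bdm_integrable iU; exact: le_normr_Rintegral. Qed.

Lemma Ex_indic (A : set T) : measurable A -> Ex (\1_A) = fine (P A).
Proof. by move=> mA; rewrite /Ex /Rintegral integral_indic// setIT. Qed.

(** Nonnegativity of the expectation of the square of [|U| - c], where [c] is the mean of [|U|]. *)
Lemma Ex_norm_sqr U : bdm U -> Ex (fun w => `|U w|) ^+ 2 <= Ex (fun w => U w ^+ 2).
Proof.
move=> bU; set c := Ex (fun w => `|U w|).
have bn := bdm_norm bU.
have bs : bdm (fun w => U w ^+ 2) by exact: bdmM.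
have : 0 <= Ex (fun w => (U w ^+ 2 + c ^+ 2) - 2 * c * `|U w|).
  apply: Ex_ge0 => w; rewrite -(real_normK (num_real (U w))).
  rewrite (_ : _ - _ = (`|U w| - c) ^+ 2) ?sqr_ge0//; ring.
have bc := bdm_cst (c ^+ 2).
rewrite ExB; [|exact: bdmD|exact: bdmZ].
by rewrite ExD// ExZ// Ex_cst -/c; lra.
Qed.

Lemma Ex_norm_sum (I : Type) (s : seq I) (p : pred I) (F : I -> T -> R) :
  (forall i, bdm (F i)) ->
  Ex (fun w => `|\sum_(i <- s | p i) F i w|) <= \sum_(i <- s | p i) Ex (fun w => `|F i w|).
Proof.
move=> bF; rewrite -Ex_sum; last by move=> i; exact: bdm_norm.
apply: Ex_le => [||w]; [exact/bdm_norm/bdm_sum|by apply: bdm_sum => i; exact: bdm_norm|].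
exact: ler_norm_sum.
Qed.

End bounded_rv.

(** * Products of centered threshold indicators *)

Section exceedances.
Context {R : realType} {d} {T : measurableType d} {P : probability T R}.
Variable X : int * int -> {RV P >-> R}.
Implicit Types (x : R) (s t h u v : int * int) (S : {fset int * int}) (B C : set T).

Local Notation Ex := (Ex P).

Lemma measurable_abs_gt x : measurable [set y : R | x < `|y|].
Proof.
rewrite (_ : [set y | _] = setT `&` (fun y : R => `|y|) @^-1` `]x, +oo[).
  by apply: (continuous_measurable_fun (@norm_continuous _ R)) => //; exact: measurable_itv.
by apply/seteqP; split => y /=; rewrite in_itv/= andbT// => -[].
Qed.

Lemma measurable_exceed x s : measurable (exceed X x s).
Proof.
rewrite (_ : exceed X x s = X s @^-1` [set y : R | x < `|y|])//.
exact: measurable_funPTI (measurable_abs_gt x).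
Qed.

Lemma sigma_field_exceed x s S : s \in S -> sigma_field X S (exceed X x s).
Proof.
move=> sS; apply: sub_gen_smallest; exists s => //.
by exists [set y : R | x < `|y|]; [exact: measurable_abs_gt|rewrite setTI].
Qed.

Lemma sigma_fieldT S : sigma_field X S setT.
Proof. exact: (@measurableT _ (g_sigma_algebraType _)). Qed.

Lemma sigma_fieldI S B C : sigma_field X S B -> sigma_field X S C ->
  sigma_field X S (B `&` C).
Proof. exact: (@measurableI _ (g_sigma_algebraType _)). Qed.

Lemma mixing_coefP abar S S' r B C :
  (forall j k l : nat, (mixing_coef X j k l <= (abar l)%:E)%E) ->
  (forall s t, s \in S -> t \in S' -> (r <= mnorm (s - t)%R)%N) ->
  measurable B -> measurable C -> sigma_field X S B -> sigma_field X S' C ->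
  `|fine (P (B `&` C)) - fine (P B) * fine (P C)| <= abar r.
Proof.
move=> ab sep mB mC sB sC.
rewrite -lee_fin; apply: le_trans (ab #|` S| #|` S'| r).
apply: ereal_sup_ubound; exists S, S'; split => //.
exists B, C; split => //.
rewrite -[in RHS](fineK (fin_num_measure P _ (measurableI _ _ mB mC))).
rewrite -[in RHS](fineK (fin_num_measure P _ mB)).
by rewrite -[in RHS](fineK (fin_num_measure P _ mC)).
Qed.

Variable x : R.

Definition plevel : R := fine (P (exceed X x 0)).

Definition cexc t (w : T) : R := \1_(exceed X x t) w - plevel.

Definition pair_prob v : R := fine (P (exceed X x 0 `&` exceed X x v)).

Lemma plevel_ge0 : 0 <= plevel.
Proof. exact: fine_ge0. Qed.

Lemma plevel_le1 : plevel <= 1.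
Proof.
have := probability_le1 P (measurable_exceed x 0).
by rewrite -(fineK (fin_num_measure P _ (measurable_exceed x 0))) lee_fin.
Qed.

Lemma pair_prob_ge0 v : 0 <= pair_prob v.
Proof. exact: fine_ge0. Qed.

Lemma bdm_cexc t : bdm (cexc t).
Proof. by apply: bdmB; [exact/bdm_indic/measurable_exceed|exact: bdm_cst]. Qed.

Lemma bdm_iexc t : bdm (\1_(exceed X x t) : T -> R).
Proof. exact/bdm_indic/measurable_exceed. Qed.

Lemma cexc_le1 t w : `|cexc t w| <= 1.
Proof.
rewrite /cexc indicE; have := plevel_ge0; have := plevel_le1.
by case: (w \in _) => /= *; rewrite ler_norml; lra.
Qed.

Lemma cexc_le t w : `|cexc t w| <= \1_(exceed X x t) w + plevel.
Proof.
rewrite /cexc indicE; have := plevel_ge0; have := plevel_le1.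
by case: (w \in _) => /= *; rewrite ler_norml; lra.
Qed.

Definition cprod (l : seq (int * int)) (w : T) : R := \prod_(t <- l) cexc t w.

Lemma bdm_cprod l : bdm (cprod l).
Proof.
rewrite /cprod; elim: l => [|t l IH].
  by under eq_fun do rewrite big_nil; exact: bdm_cst.
by under eq_fun do rewrite big_cons; apply: bdmM => //; exact: bdm_cexc.
Qed.

Lemma cprod_cons t l w : cprod (t :: l) w = cexc t w * cprod l w.
Proof. by rewrite /cprod big_cons. Qed.

Lemma indicI_mul B C w : \1_(B `&` C) w = \1_B w * \1_C w :> R.
Proof. by rewrite !indicE in_setI; case: (w \in B); case: (w \in C); rewrite ?mulr1 ?mulr0. Qed.

(* Auxiliary indicators of [B] and [C] make the covariance of two products of centered
   indicators amenable to induction: expanding one factor replaces [B] by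
   [B `&` exceed X x t] or leaves it unchanged, and the base case is the mixing bound. *)
Definition cdev B l C l' : R :=
  Ex (fun w => (\1_B w * cprod l w) * (\1_C w * cprod l' w)) -
  Ex (fun w => \1_B w * cprod l w) * Ex (fun w => \1_C w * cprod l' w).

Lemma cdev_cons t B l C l' : measurable B -> measurable C ->
  cdev B (t :: l) C l' = cdev (B `&` exceed X x t) l C l' - plevel * cdev B l C l'.
Proof.
move=> mB mC; have mE := measurable_exceed x t.
have bl := bdm_cprod l; have bl' := bdm_cprod l'.
have bB : bdm (\1_B : T -> R) by exact: bdm_indic.
have bC : bdm (\1_C : T -> R) by exact: bdm_indic.
have bE : bdm (\1_(B `&` exceed X x t) : T -> R) by apply: bdm_indic; exact: measurableI.
have bCl := bdmM bC bl'; have bBl := bdmM bB bl; have bEl := bdmM bE bl.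
rewrite /cdev.
have -> : (fun w => \1_B w * cprod (t :: l) w) =
    (fun w => \1_(B `&` exceed X x t) w * cprod l w - plevel * (\1_B w * cprod l w)) :> (T -> R).
  by apply/funext => w; rewrite cprod_cons indicI_mul /cexc; ring.
have -> : (fun w => \1_B w * cprod (t :: l) w * (\1_C w * cprod l' w)) =
    (fun w => (\1_(B `&` exceed X x t) w * cprod l w) * (\1_C w * cprod l' w) -
              plevel * ((\1_B w * cprod l w) * (\1_C w * cprod l' w))) :> (T -> R).
  by apply/funext => w; rewrite cprod_cons indicI_mul /cexc; ring.
have b1 := bdmM bEl bCl; have b2 := bdmM bBl bCl.
rewrite !ExB//; [|exact: bdmZ..].
by rewrite !ExZ//; ring.
Qed.

Lemma cdev_sym B l C l' : cdev B l C l' = cdev C l' B l.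
Proof.
rewrite /cdev; congr (_ - _); last exact: mulrC.
by congr Ex; apply/funext => w; rewrite mulrC.
Qed.

(** Each factor splits the deviation into two of the same kind, with weights 1 and [plevel <= 1];
    this doubles the bound once per factor. The left list is exhausted first, then the right one by
    symmetry. *)
Lemma cdev_le (al : R) S S' : 0 <= al ->
  (forall B C, measurable B -> measurable C -> sigma_field X S B -> sigma_field X S' C ->
     `|fine (P (B `&` C)) - fine (P B) * fine (P C)| <= al) ->
  forall l l' B C, {subset l <= S} -> {subset l' <= S'} ->
  measurable B -> measurable C -> sigma_field X S B -> sigma_field X S' C ->
  `|cdev B l C l'| <= 2 ^+ (size l + size l') * al.
Proof.
move=> al0 mix l l' B C + + + + + +.
have [p0 p1] := (plevel_ge0, plevel_le1).
have half (a b c : R) : `|a| <= c -> `|b| <= c -> `|a - plevel * b| <= 2 * c.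
  move=> ac bc; apply: le_trans (ler_normB _ _) _.
  rewrite normrM (ger0_norm p0); have : plevel * `|b| <= 1 * c by apply: ler_pM.
  by lra.
elim: l B => [|t l IH] B; last first.
  move=> lS l'S mB mC sB sC; rewrite cdev_cons//= addSn exprS -mulrA.
  have tS : t \in S by apply: lS; rewrite inE eqxx.
  have lS' : {subset l <= S} by move=> u ul; apply: lS; rewrite inE ul orbT.
  apply: half; last exact: IH.
  apply: IH => //; first by apply: measurableI => //; exact: measurable_exceed.
  by apply: sigma_fieldI => //; exact: sigma_field_exceed.
elim: l' C => [|t l' IH] C _ lS mB mC sB sC; last first.
  rewrite cdev_sym cdev_cons// !(cdev_sym _ l') /= !add0n exprS -mulrA.
  have tS : t \in S' by apply: lS; rewrite inE eqxx.
  have lS' : {subset l' <= S'} by move=> u ul; apply: lS; rewrite inE ul orbT.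
  apply: half; last by have := IH C; rewrite add0n; apply.
  have := IH (C `&` exceed X x t); rewrite add0n; apply => //.
    by apply: measurableI => //; exact: measurable_exceed.
  by apply: sigma_fieldI => //; exact: sigma_field_exceed.
have c1 D : (fun w => \1_D w * cprod [::] w) = \1_D :> (T -> R).
  by apply/funext => w; rewrite /cprod big_nil mulr1.
rewrite /cdev !c1 /= mul1r.
have -> : (fun w => \1_B w * cprod [::] w * (\1_C w * cprod [::] w)) = \1_(B `&` C) :> (T -> R).
  by apply/funext => w; rewrite indicI_mul /cprod !big_nil !mulr1.
rewrite !Ex_indic//; last exact: measurableI.
exact: mix.
Qed.

Variables (r : nat) (al : R).
Hypothesis al0 : 0 <= al.
Hypothesis mixP : forall S S' B C,
  (forall s t, s \in S -> t \in S' -> (r <= mnorm (s - t)%R)%N) ->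
  measurable B -> measurable C -> sigma_field X S B -> sigma_field X S' C ->
  `|fine (P (B `&` C)) - fine (P B) * fine (P C)| <= al.

Lemma cprod_cov_le l l' :
  (forall s t, s \in l -> t \in l' -> (r <= mnorm (s - t)%R)%N) ->
  `|Ex (fun w => cprod l w * cprod l' w) - Ex (cprod l) * Ex (cprod l')|
    <= 2 ^+ (size l + size l') * al.
Proof.
move=> sep.
pose S := [fset t in l]%fset; pose S' := [fset t in l']%fset.
have mix B C := @mixP S S' B C.
have e1 k : (fun w => \1_setT w * cprod k w) = cprod k.
  by apply/funext => w; rewrite indicE in_setT mul1r.
have := @cdev_le al S S' al0 _ l l' setT setT; rewrite /cdev !e1.
have -> : (fun w => \1_setT w * cprod l w * (\1_setT w * cprod l' w)) =
   (fun w => cprod l w * cprod l' w) by apply/funext => w; rewrite indicE in_setT !mul1r.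
apply => //; try exact: sigma_fieldT; last 2 first.
- by move=> t; rewrite /S !inE.
- by move=> t; rewrite /S' !inE.
move=> B C mB mC sB sC; apply: mixP mB mC sB sC => s t.
by rewrite !inE; exact: sep.
Qed.

Hypothesis stat : strictly_stationary X.

Lemma P_exceed s : fine (P (exceed X x s)) = plevel.
Proof.
have := exceedI_shift x s 0 0 stat; rewrite !setIid add0r => E.
by rewrite /plevel E.
Qed.

Lemma P_exceedI s t : fine (P (exceed X x s `&` exceed X x t)) = pair_prob (t - s).
Proof.
by have := exceedI_shift x s 0 (t - s) stat; rewrite add0r subrK => E; rewrite /pair_prob E.
Qed.

Lemma pair_prob0 : pair_prob 0 = plevel.
Proof. by rewrite /pair_prob setIid. Qed.

Lemma Ex_cexc t : Ex (cexc t) = 0.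
Proof.
rewrite /cexc ExB; [|exact: bdm_iexc|exact: bdm_cst].
by rewrite Ex_indic ?P_exceed ?Ex_cst ?subrr//; exact: measurable_exceed.
Qed.

Lemma Ex_iexcI s t : Ex (fun w => \1_(exceed X x s) w * \1_(exceed X x t) w) = pair_prob (t - s).
Proof.
rewrite -P_exceedI -Ex_indic; last by apply: measurableI; exact: measurable_exceed.
by congr Ex; apply/funext => w; rewrite indicI_mul.
Qed.

Lemma Ex_norm_cexc t : Ex (fun w => `|cexc t w|) <= 2 * plevel.
Proof.
have bi := bdm_iexc t.
apply: (@le_trans _ _ (Ex (fun w => \1_(exceed X x t) w + plevel))).
  apply: Ex_le; [exact/bdm_norm/bdm_cexc| |exact: cexc_le].
  by apply: bdmD => //; exact: bdm_cst.
rewrite ExD ?Ex_cst ?Ex_indic ?P_exceed//; [lra|exact: measurable_exceed|exact: bdm_cst].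
Qed.

Lemma Ex_norm_cexc2 s t :
  Ex (fun w => `|cexc s w * cexc t w|) <= pair_prob (t - s) + 3 * plevel ^+ 2.
Proof.
have [bs bt] := (bdm_iexc s, bdm_iexc t).
pose V w : R := \1_(exceed X x s) w * \1_(exceed X x t) w + (plevel * \1_(exceed X x s) w +
  (plevel * \1_(exceed X x t) w + plevel ^+ 2)).
have b1 := bdmM bs bt; have b2 := bdmZ plevel bs; have b3 := bdmZ plevel bt.
have b4 := @bdm_cst R _ T (plevel ^+ 2).
have b34 := bdmD b3 b4; have b234 := bdmD b2 b34; have bV : bdm V := bdmD b1 b234.
apply: (@le_trans _ _ (Ex V)).
  apply: Ex_le => [||w]; [by apply/bdm_norm/bdmM; exact: bdm_cexc|exact: bV|].
  rewrite normrM; apply: le_trans (ler_pM (normr_ge0 _) (normr_ge0 _) (cexc_le s w) (cexc_le t w)) _.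
  by rewrite /V; lra.
rewrite /V ExD// ExD// ExD// Ex_cst !ExZ// Ex_iexcI !Ex_indic ?P_exceed; last 2 first.
- exact: measurable_exceed.
- exact: measurable_exceed.
by lra.
Qed.

(** The 7 is 3 + 4: the 3 comes from expanding the product of two centered indicators, and the 4
    from the product of two means, each at most [2 * plevel]. *)
Definition Kexc v : R := pair_prob v + 7 * plevel ^+ 2.

Lemma Kexc_ge0 v : 0 <= Kexc v.
Proof. by rewrite addr_ge0 ?pair_prob_ge0// mulr_ge0// sqr_ge0. Qed.

Definition near_bound v : R := if (mnorm v <= r)%N then Kexc v else 0.

Lemma near_bound_ge0 v : 0 <= near_bound v.
Proof. by rewrite /near_bound; case: ifP => // _; exact: Kexc_ge0. Qed.

Definition lagprod h s (w : T) : R := cexc s w * cexc (s + h) w.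

Lemma bdm_lagprod h s : bdm (lagprod h s).
Proof. by apply: bdmM; exact: bdm_cexc. Qed.

Lemma Ex_lagprod h s : Ex (lagprod h s) = pair_prob h - plevel ^+ 2.
Proof.
have [bs bt] := (bdm_iexc s, bdm_iexc (s + h)).
have b1 := bdmM bs bt; have b2 := bdmZ plevel bs; have b3 := bdmZ plevel bt.
have b4 := @bdm_cst R _ T (plevel ^+ 2).
have b23 := bdmD b2 b3; have b123 := bdmB b1 b23.
have -> : lagprod h s = (fun w => (\1_(exceed X x s) w * \1_(exceed X x (s + h)) w -
   (plevel * \1_(exceed X x s) w + plevel * \1_(exceed X x (s + h)) w)) + plevel ^+ 2).
  by apply/funext => w; rewrite /lagprod /cexc; ring.
rewrite ExD// ExB// ExD// Ex_cst !ExZ// Ex_iexcI !Ex_indic ?P_exceed; last 2 first.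
- exact: measurable_exceed.
- exact: measurable_exceed.
by rewrite [s + h]addrC addrK; ring.
Qed.

Lemma Ex_lagprod_far h s : (r < mnorm h)%N -> `|Ex (lagprod h s)| <= 4 * al.
Proof.
move=> rh; have := @cprod_cov_le [:: s] [:: s + h].
have e k : cprod [:: k] = cexc k by apply/funext => w; rewrite /cprod big_seq1.
rewrite !e !Ex_cexc mulr0 subr0 /= -natrX; apply => u v; rewrite !inE => /eqP-> /eqP->.
by rewrite opprD addrA subrr add0r mnormN ltnW.
Qed.

(** The pairs with one site in [{s, s + h}] and one in [{t, t + h}] have only three differences,
    since [t - s] occurs twice. If all three exceed [r], the two products are separated and mixing
    of four factors costs [2 ^ 4]; otherwise a close pair bounds the covariance. *)
Lemma lagprod_cov_le h s t :
  `|Ex (fun w => lagprod h s w * lagprod h t w) - Ex (lagprod h s) * Ex (lagprod h t)| <=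
  near_bound (t - s) + near_bound (t - (s + h)) + near_bound (t - (s - h)) + 16 * al.
Proof.
have n0 := near_bound_ge0.
set A1 := near_bound (t - s); set A2 := near_bound (t - (s + h)).
set A3 := near_bound (t - (s - h)).
have [A10 A20 A30] : [/\ 0 <= A1, 0 <= A2 & 0 <= A3] by split; exact: n0.
(* Each covariance is dominated by any single pair of the four sites. *)
have crude (a b : int * int) (V : T -> R) : bdm V -> (forall w, `|V w| <= 1) ->
    (forall w, lagprod h s w * lagprod h t w = cexc a w * cexc b w * V w) ->
  `|Ex (fun w => lagprod h s w * lagprod h t w) - Ex (lagprod h s) * Ex (lagprod h t)|
  <= Kexc (b - a).
  move=> bV V1 E.
  have bab : bdm (fun w => cexc a w * cexc b w) by apply: bdmM; exact: bdm_cexc.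
  have H1 : `|Ex (fun w => lagprod h s w * lagprod h t w)| <= pair_prob (b - a) + 3 * plevel ^+ 2.
    apply: (le_trans _ (Ex_norm_cexc2 a b)).
    under eq_fun do rewrite E.
    apply: le_trans (Ex_normr P (bdmM bab bV)) _.
    apply: Ex_le => [||w]; [exact/bdm_norm/bdmM|exact: bdm_norm|].
    by rewrite normrM ler_piMr.
  have H2 k : `|Ex (lagprod h k)| <= 2 * plevel.
    apply: (le_trans _ (Ex_norm_cexc k)).
    apply: le_trans (Ex_normr P (bdm_lagprod h k)) _.
    apply: Ex_le => [||w]; [exact/bdm_norm/bdm_lagprod|exact/bdm_norm/bdm_cexc|].
    by rewrite /lagprod normrM ler_piMr// cexc_le1.
  have H3 : `|Ex (lagprod h s) * Ex (lagprod h t)| <= 2 * plevel * (2 * plevel).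
    by rewrite normrM; apply: ler_pM.
  by apply: le_trans (ler_normB _ _) _; rewrite /Kexc; lra.
have bc := bdm_cexc; have c1 := cexc_le1.
have b2 a b : bdm (fun w => cexc a w * cexc b w) by apply: bdmM.
have c2 a b w : `|cexc a w * cexc b w| <= 1 by rewrite normrM mulr_ile1.
have [l1|l1] := leqP (mnorm (t - s)) r.
  have A1E : A1 = Kexc (t - s) by rewrite /A1 /near_bound l1.
  have := crude s t _ (b2 (s + h) (t + h)) (c2 (s + h) (t + h)).
  rewrite -A1E => H; apply: le_trans (H _) _ => [w|]; first by rewrite /lagprod; ring.
  by have := al0; lra.
have [l2|l2] := leqP (mnorm (t - (s + h))) r.
  have A2E : A2 = Kexc (t - (s + h)) by rewrite /A2 /near_bound l2.
  have := crude (s + h) t _ (b2 s (t + h)) (c2 s (t + h)).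
  rewrite -A2E => H; apply: le_trans (H _) _ => [w|]; first by rewrite /lagprod; ring.
  by have := al0; lra.
have [l3|l3] := leqP (mnorm (t - (s - h))) r.
  have A3E : A3 = Kexc ((t + h) - s).
    by rewrite /A3 /near_bound l3; congr Kexc; rewrite opprB addrA addrAC.
  have := crude s (t + h) _ (b2 (s + h) t) (c2 (s + h) t).
  rewrite -A3E => H; apply: le_trans (H _) _ => [w|]; first by rewrite /lagprod; ring.
  by have := al0; lra.
have e k : cprod [:: k; k + h] = lagprod h k.
  by apply/funext => w; rewrite /cprod big_cons big_seq1.
have := @cprod_cov_le [:: s; s + h] [:: t; t + h].
rewrite !e /= -natrX => H; apply: (le_trans (H _)); last by have := al0; rewrite /=; lra.
have E3 : t + h - s = t - (s - h) by rewrite opprB addrA addrAC.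
have E4 : t + h - (s + h) = t - s by rewrite opprD addrACA subrr addr0.
move=> u v; rewrite !inE => /orP[]/eqP-> /orP[]/eqP->; rewrite -mnormN opprB.
- exact: ltnW l1.
- rewrite E3; exact: ltnW l3.
- exact: ltnW l2.
- rewrite E4; exact: ltnW l1.
Qed.

Lemma cexc_cov_le s t :
  `|Ex (fun w => cexc s w * cexc t w)| <= near_bound (t - s) + 4 * al.
Proof.
have [l1|l1] := leqP (mnorm (t - s)) r; last first.
  rewrite -[t](subrK s) addrC -/(lagprod (t - s) s); apply: le_trans (Ex_lagprod_far s l1) _.
  by rewrite addrC addrK lerDr near_bound_ge0.
have bst : bdm (fun w => cexc s w * cexc t w) by apply: bdmM; exact: bdm_cexc.
apply: le_trans (Ex_normr P bst) _; apply: le_trans (Ex_norm_cexc2 s t) _.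
rewrite /near_bound l1 /Kexc; have := sqr_ge0 plevel; have := al0; lra.
Qed.

Lemma sum_near_bound n c : \sum_(t <- Lam n) near_bound (t - c) <= \sum_(v <- box r) Kexc v.
Proof.
have -> : \sum_(t <- Lam n) near_bound (t - c) =
    \sum_(v <- [seq t - c | t <- Lam n] | (mnorm v <= r)%N) Kexc v.
  by rewrite big_map [RHS]big_mkcond.
rewrite -big_filter.
have U : uniq [seq v <- [seq t - c | t <- Lam n] | (mnorm v <= r)%N].
  by rewrite filter_uniq// map_inj_uniq ?Lam_uniq//; exact: addIr.
rewrite [leRHS](bigID (mem [seq v <- [seq t - c | t <- Lam n] | (mnorm v <= r)%N])) /=.
apply: ler_wpDr; first by apply: sumr_ge0 => v _; exact: Kexc_ge0.
rewrite -[leRHS]big_filter le_eqVlt; apply/orP; left; apply/eqP; apply: perm_big.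
apply: uniq_perm => // [|v]; first by rewrite filter_uniq// box_uniq.
rewrite !mem_filter mem_box; case: (mnorm v <= r)%N => //=.
by rewrite andbT.
Qed.

(** Bounds the covariances of one summand with all others: three translates of [near_bound], and the
    mixing remainder at each of the [n ^ 2] sites. It does not involve the lag, which makes the
    later estimates uniform in [k]. *)
Definition Sexc n : R := 3 * \sum_(v <- box r) Kexc v + 16 * n%:R ^+ 2 * al.

Lemma sum_Lam_const n (c : R) : \sum_(t <- Lam n) c = n%:R ^+ 2 * c.
Proof. by rewrite big_const_seq count_predT size_Lam iter_addr_0 expr2 -natrM mulr_natl. Qed.

Definition lagcount n h : nat := count (fun s => s + h \in Lam n) (Lam n).

(** The outer sum keeps the factor [lagcount n h] instead of [n ^ 2]: aliased lags become negligible
    only because their counts are small. *)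
Lemma lagprod_var_le n h :
  Ex (fun w => (\sum_(s <- Lam n | s + h \in Lam n) (lagprod h s w - Ex (lagprod h s))) ^+ 2) <=
  (lagcount n h)%:R * Sexc n.
Proof.
have bY s := bdm_lagprod h s; have bc s : bdm (fun w => lagprod h s w - Ex (lagprod h s)).
  by apply: bdmB => //; exact: bdm_cst.
have -> : (fun w => (\sum_(s <- Lam n | s + h \in Lam n) (lagprod h s w - Ex (lagprod h s))) ^+ 2) =
  (fun w => \sum_(s <- Lam n | s + h \in Lam n) \sum_(t <- Lam n | t + h \in Lam n)
     (lagprod h s w - Ex (lagprod h s)) * (lagprod h t w - Ex (lagprod h t))).
  apply/funext => w; rewrite expr2 mulr_suml; apply: eq_bigr => s _.
  by rewrite mulr_sumr.
rewrite Ex_sum; last by move=> s; apply: bdm_sum => t; exact: bdmM.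
rewrite /lagcount -sum1_count natr_sum mulr_suml; apply: ler_sum => s _.
rewrite mul1r Ex_sum; last by move=> t; exact: bdmM.
have E t : Ex (fun w => (lagprod h s w - Ex (lagprod h s)) * (lagprod h t w - Ex (lagprod h t))) =
    Ex (fun w => lagprod h s w * lagprod h t w) - Ex (lagprod h s) * Ex (lagprod h t).
  have -> : (fun w => (lagprod h s w - Ex (lagprod h s)) * (lagprod h t w - Ex (lagprod h t))) =
   (fun w => (lagprod h s w * lagprod h t w - (Ex (lagprod h t) * lagprod h s w +
       Ex (lagprod h s) * lagprod h t w)) + Ex (lagprod h s) * Ex (lagprod h t)).
    by apply/funext => w; ring.
  have b1 := bdmM (bY s) (bY t).
  have b2 := bdmZ (Ex (lagprod h t)) (bY s); have b3 := bdmZ (Ex (lagprod h s)) (bY t).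
  have b23 := bdmD b2 b3; have b123 := bdmB b1 b23.
  rewrite ExD//; last exact: bdm_cst.
  by rewrite ExB// ExD// Ex_cst !ExZ//; ring.
apply: (@le_trans _ _ (\sum_(t <- Lam n) (near_bound (t - s) + near_bound (t - (s + h)) +
    near_bound (t - (s - h)) + 16 * al))).
  rewrite big_mkcond; apply: ler_sum => t _.
  have := lagprod_cov_le h s t; rewrite -E; case: ifP => _; first exact/le_trans/ler_norm.
  exact/le_trans.
rewrite !big_split /= sum_Lam_const /Sexc.
have := sum_near_bound n s; have := sum_near_bound n (s + h); have := sum_near_bound n (s - h).
lra.
Qed.

(** The predicate allows for the sums over sites whose translate by a lag remains in the square. *)
Lemma cexc_var_le n (p : pred (int * int)) :
  Ex (fun w => (\sum_(s <- Lam n | p s) cexc s w) ^+ 2) <= n%:R ^+ 2 * Sexc n.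
Proof.
have bc := bdm_cexc.
have -> : (fun w => (\sum_(s <- Lam n | p s) cexc s w) ^+ 2) =
  (fun w => \sum_(s <- Lam n | p s) \sum_(t <- Lam n | p t) cexc s w * cexc t w).
  apply/funext => w; rewrite expr2 mulr_suml; apply: eq_bigr => s _.
  by rewrite mulr_sumr.
rewrite Ex_sum; last by move=> s; apply: bdm_sum => t; exact: bdmM.
have S0 : 0 <= \sum_(v <- box r) Kexc v by apply: sumr_ge0 => v _; exact: Kexc_ge0.
have n2a : 0 <= n%:R ^+ 2 * al by rewrite mulr_ge0// sqr_ge0.
have Sn0 : 0 <= Sexc n by rewrite /Sexc; lra.
rewrite -sum_Lam_const big_mkcond; apply: ler_sum => s _; case: ifP => // _.
rewrite Ex_sum; last by move=> t; exact: bdmM.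
apply: (@le_trans _ _ (\sum_(t <- Lam n) (near_bound (t - s) + 4 * al))).
  rewrite big_mkcond; apply: ler_sum => t _.
  have := cexc_cov_le s t; case: ifP => _; first exact/le_trans/ler_norm.
  exact/le_trans.
rewrite big_split /= sum_Lam_const /Sexc; have := sum_near_bound n s; lra.
Qed.

End exceedances.

(** * Convergence in distribution *)

Section lower_envelope.
Context {R : realType}.
Variables (phi : R -> R) (B : R).
Hypothesis phiB : forall x, `|phi x| <= B.

(* Lipschitz regularization: the largest [L]-Lipschitz minorant of [phi]. *)
Definition lower_env (L x : R) : R := inf [set phi y + L * `|x - y| | y in setT].

Variable L : R.
Hypothesis L0 : 0 <= L.

Lemma lower_env_le x y : lower_env L x <= phi y + L * `|x - y|.
Proof.
apply: ge_inf; last by exists y.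
exists (- B) => _ [z _ <-]; have := phiB z; rewrite ler_norml => /andP[h _].
by apply: le_trans h _; rewrite lerDl mulr_ge0.
Qed.

Lemma lower_env_ge x (c : R) : (forall y, c <= phi y + L * `|x - y|) -> c <= lower_env L x.
Proof.
move=> cP; apply: lb_le_inf; first by exists (phi 0 + L * `|x - 0|), 0.
by move=> _ [y _ <-]; exact: cP.
Qed.

Lemma lower_env_le_self x : lower_env L x <= phi x.
Proof. by apply: le_trans (lower_env_le x x) _; rewrite subrr normr0 mulr0 addr0. Qed.

Lemma lower_env_bound x : `|lower_env L x| <= B.
Proof.
rewrite ler_norml; apply/andP; split; last first.
  by apply: le_trans (lower_env_le_self x) _; apply: le_trans (ler_norm _) (phiB x).
apply: lower_env_ge => y; have := phiB y; rewrite ler_norml => /andP[h _].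
by apply: le_trans h _; rewrite lerDl mulr_ge0.
Qed.

Lemma lower_env_lip1 x z : lower_env L x - lower_env L z <= L * `|x - z|.
Proof.
rewrite lerBlDl -lerBlDr; apply: lower_env_ge => y.
rewrite lerBlDr; apply: le_trans (lower_env_le x y) _.
have := ler_wpM2l L0 (ler_distD z x y); rewrite mulrDr; lra.
Qed.

Lemma lower_env_lip x z : `|lower_env L x - lower_env L z| <= L * `|x - z|.
Proof.
rewrite ler_norml lower_env_lip1 andbT lerNl opprB distrC.
exact: lower_env_lip1.
Qed.

Lemma lower_env_continuous : continuous (lower_env L).
Proof.
move=> x; apply/cvgrPdist_le => e e0.
have h : 0 < e / (L + 1) by rewrite divr_gt0// ltr_wpDl.
have : id z @[z --> x] --> x by exact: cvg_id.
move=> /cvgrPdist_le/(_ _ h); apply: filterS => z xz.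
apply: le_trans (lower_env_lip x z) _.
apply: (@le_trans _ _ (L * (e / (L + 1)))).
  exact: ler_wpM2l.
by rewrite mulrCA ger_pMr// ler_pdivrMr ?mul1r ?ltr_wpDl// lerDl.
Qed.

End lower_envelope.

Section lower_envelope_limit.
Context {R : realType}.
Variables (phi : R -> R) (B : R).
Hypothesis phiB : forall x, `|phi x| <= B.
Hypothesis phic : continuous phi.

Lemma lower_env_cvg x : lower_env phi k%:R x @[k --> \oo] --> phi x.
Proof.
apply/cvgrPdist_le => e e0.
have /cvgrPdist_le/(_ e e0)/nbhs_ballP[del /= del0 delP] := @phic x.
near=> k.
have k0 : 0 <= k%:R :> R by [].
rewrite ger0_norm; last by rewrite subr_ge0; exact: (lower_env_le_self phiB k0).
rewrite lerBlDr -lerBlDl; apply: lower_env_ge => y.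
have [yd|yd] := ltP `|x - y| del.
  have := delP y yd; rewrite ler_norml => /andP[_ h].
  have : 0 <= k%:R * `|x - y| by rewrite mulr_ge0.
  lra.
(* Beyond distance [del] the penalty exceeds [2 * B], the largest possible drop of [phi]. *)
have kd : 2 * B <= k%:R * del.
  by rewrite -ler_pdivrMr//; near: k; exact: nbhs_infty_ger.
have : k%:R * del <= k%:R * `|x - y| by rewrite ler_wpM2l.
have := phiB x; have := phiB y; rewrite !ler_norml => /andP[h1 _] /andP[_ h2].
lra.
Unshelve. all: by end_near. Qed.

End lower_envelope_limit.

Section weak_convergence.
Context {R : realType}.

Lemma bounded_funP (E : Type) (phi : E -> R) :
  bounded_fun phi <-> exists B, forall x, `|phi x| <= B.
Proof.
split=> [[M [_ MM]]|[B phiB]].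
  by exists (M + 1) => x; apply: (MM (M + 1) (ltr_pwDr ltr01 (lexx M))).
exists B; split; first exact: num_real.
by move=> M BM x _ /=; apply: le_trans (phiB x) (ltW BM).
Qed.

Context {d} {T : measurableType d} (P : probability T R).
Context {d'} {T' : measurableType d'} (P' : probability T' R).

Lemma cvg_distP (E : topologicalType) (Y : nat -> T -> E) (Y' : T' -> E) :
  (forall phi : E -> R, continuous phi -> bounded_fun phi ->
     (forall n, bdm (phi \o Y n)) /\ bdm (phi \o Y')) ->
  cvg_dist P P' Y Y' <->
  forall phi : E -> R, continuous phi -> bounded_fun phi ->
    Ex P (phi \o Y n) @[n --> \oo] --> Ex P' (phi \o Y').
Proof.
move=> H; split=> YY' phi phic phib; have [b1 b2] := H phi phic phib.
  have := YY' phi phic phib; rewrite (expectationE P' b2).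
  rewrite (_ : (fun n => _) = (fun n => (Ex P (phi \o Y n))%:E)); last first.
    by apply/funext => n; rewrite -expectationE.
  by move=> /fine_cvg.
rewrite (expectationE P' b2) (_ : (fun n => _) = (fun n => (Ex P (phi \o Y n))%:E)); last first.
  by apply/funext => n; rewrite -expectationE.
by apply: cvg_EFin; [exact: nearW|exact: YY'].
Qed.

Lemma cvg_distR (Y : nat -> T -> R) (Y' : T' -> R) :
  (forall n, measurable_fun setT (Y n)) -> measurable_fun setT Y' ->
  cvg_dist P P' Y Y' <->
  forall (phi : R -> R) (B : R), continuous phi -> (forall x, `|phi x| <= B) ->
    Ex P (phi \o Y n) @[n --> \oo] --> Ex P' (phi \o Y').
Proof.
move=> mY mY'; rewrite cvg_distP.
  split=> H phi; first by move=> B phic phiB; apply: H => //; apply/bounded_funP; exists B.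
  by move=> phic /bounded_funP[B phiB]; exact: H phiB.
move=> phi phic /bounded_funP[B phiB].
by split=> [n|]; exact: bdm_comp phiB _.
Qed.

End weak_convergence.

Section weak_approximation.
Context {R : realType}.
Context {d} {T : measurableType d} (P : probability T R).
Context {d'} {T' : measurableType d'} (P' : probability T' R).
Variables (Y : nat -> T -> R) (V : nat -> nat -> T -> R).
Variables (Y' : T' -> R) (V' : nat -> T' -> R).
Hypotheses (bY : forall n, bdm (Y n)) (bV : forall k n, bdm (V k n)).
Hypotheses (mY' : measurable_fun setT Y') (mV' : forall k, measurable_fun setT (V' k)).
Hypothesis VV' : forall k, cvg_dist P P' (V k) (V' k).
Hypothesis V'Y' : cvg_dist P' P' V' Y'.
Hypothesis YV : forall e : R, 0 < e -> \forall k \near \oo, \forall n \near \oo,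
  Ex P (fun w => `|Y n w - V k n w|) <= e.

(* Expectations of continuous bounded functions are approximated from below by those of
   Lipschitz functions, for which closeness in mean suffices. *)
Let lower (phi : R -> R) (B e : R) : continuous phi -> (forall x, `|phi x| <= B) ->
  0 < e -> \forall n \near \oo, Ex P' (phi \o Y') - e <= Ex P (phi \o Y n).
Proof.
move=> phic phiB e0.
have mY n : measurable_fun setT (Y n) by case: (bY n).
have mV k n : measurable_fun setT (V k n) by case: (bV k n).
(* The four quarters: the Lipschitz minorant at [Y'], the passage from [Y'] to [V' k], the
   convergence of [V k n], and the closeness of [V k n] to [Y n] in mean. *)
have e4 : 0 < e / 4 by rewrite divr_gt0.
have [l lP] : exists l : nat, Ex P' (phi \o Y') - e / 4 <= Ex P' (lower_env phi l%:R \o Y').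
  have mlower l : bdm (lower_env phi l%:R \o Y').
    apply: (bdm_comp (B := B)) => //; first exact: (lower_env_continuous phiB).
    by move=> x; exact: (lower_env_bound phiB).
  have muP : (P' setT < +oo)%E by exact: le_lt_trans (probability_le1 P' measurableT) (ltry 1).
  have := @Rintegral_dominated _ _ R P' setT measurableT
    (fun l => lower_env phi l%:R \o Y') (phi \o Y') B muP (fun l => (mlower l).1).
  move=> /(_ (fun l w _ => lower_env_bound phiB (ler0n _ l) (Y' w))).
  move=> /(_ (fun w _ => @lower_env_cvg _ phi B phiB phic (Y' w))).
  move=> /cvgrPdist_le/(_ _ e4)[l _ /(_ l (leqnn l))]; rewrite ler_norml => /andP[_ h].
  by exists l; rewrite /Ex; lra.
set psi := lower_env phi l%:R in lP *.
have l0 : 0 <= l%:R :> R by [].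
have psiB : forall x, `|psi x| <= B := lower_env_bound phiB l0.
have psic : continuous psi := lower_env_continuous phiB l0.
have e'0 : 0 < e / 4 / (l%:R + 1) by rewrite divr_gt0// ltr_wpDl.
have H1 : \forall k \near \oo, `|Ex P' (psi \o Y') - Ex P' (psi \o V' k)| <= e / 4.
  by move: V'Y' => /(cvg_distR P' P' mV' mY')/(_ psi B psic psiB)/cvgrPdist_le/(_ _ e4).
have [k [kY kP]] : exists k, (\forall n \near \oo, Ex P (fun w => `|Y n w - V k n w|) <= e / 4 / (l%:R + 1)) /\
   `|Ex P' (psi \o Y') - Ex P' (psi \o V' k)| <= e / 4.
  by near \oo => k; exists k; split; near: k => //; exact: YV.
move: (@VV' k) => /(cvg_distR P P' (mV k) (mV' k))/(_ psi B psic psiB)/cvgrPdist_le/(_ _ e4).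
move: kY; apply: filterS2 => n nY nV.
have b1 : bdm (psi \o Y n) by exact: bdm_comp psiB _.
have b2 : bdm (psi \o V k n) by exact: bdm_comp psiB _.
have b3 : bdm (phi \o Y n) by exact: bdm_comp phiB _.
have S1 : Ex P (psi \o Y n) <= Ex P (phi \o Y n).
  by apply: Ex_le => // w; exact: (lower_env_le_self phiB l0 (Y n w)).
have S2 : `|Ex P (psi \o Y n) - Ex P (psi \o V k n)| <= e / 4.
  rewrite -ExB//; apply: le_trans (Ex_normr P (bdmB b1 b2)) _.
  have bn := bdm_norm (bdmB (bY n) (bV k n)).
  apply: (@le_trans _ _ (Ex P (fun w => l%:R * `|Y n w - V k n w|))).
    apply: Ex_le => [||w]; [exact/bdm_norm/bdmB|exact: bdmZ|].
    exact: (lower_env_lip phiB l0 (Y n w) (V k n w)).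
  rewrite ExZ//; apply: le_trans (ler_wpM2l l0 nY) _.
  by rewrite mulrCA ger_pMr// ler_pdivrMr ?mul1r ?ltr_wpDl// lerDl.
move: S2 kP nV; rewrite !ler_norml => /andP[? ?] /andP[? ?] /andP[? ?].
lra.
Unshelve. all: by end_near. Qed.

(** The asymptotic lower bound for [- phi] is the upper bound for [phi]. *)
Lemma cvg_dist_approx : cvg_dist P P' Y Y'.
Proof.
apply/cvg_distR => [n||phi B phic phiB]; [by case: (bY n)|exact: mY'|].
apply/cvgrPdist_le => e e0.
have phiN : continuous (fun x => - phi x) by move=> x; apply: cvgN; exact: phic.
have phiNB x : `|- phi x| <= B by rewrite normrN.
have b' : bdm (phi \o Y') by exact: bdm_comp phiB _.
move: (lower phic phiB e0) (lower phiN phiNB e0); apply: filterS2 => n H1.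
have bn : bdm (phi \o Y n) by apply: (bdm_comp _ phiB) => //; case: (bY n).
have -> : (fun x => - phi x) \o Y' = (fun w => - (phi \o Y') w) by [].
have -> : (fun x => - phi x) \o Y n = (fun w => - (phi \o Y n) w) by [].
rewrite !ExN// => H2; rewrite ler_norml; lra.
Qed.

End weak_approximation.

(** * Absolutely summable families and growing boxes *)

Section box_sums.
Context {R : realType}.
Implicit Types (u : int * int -> R) (h : int * int).

Lemma box_mono_filter K N : (K <= N)%N ->
  perm_eq [seq h <- box N | (mnorm h <= K)%N] (box K).
Proof.
move=> KN; apply: uniq_perm; rewrite ?filter_uniq ?box_uniq// => h.
rewrite mem_filter !mem_box; case: leqP => //= hK; exact: leq_trans KN.
Qed.

Lemma sum_box_split (V : nmodType) (F : int * int -> V) K N : (K <= N)%N ->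
  \sum_(h <- box N) F h = \sum_(h <- box K) F h + \sum_(h <- box N | (K < mnorm h)%N) F h.
Proof.
move=> KN; rewrite (bigID (fun h => (mnorm h <= K)%N)) /=; congr (_ + _).
  by rewrite -big_filter; apply: perm_big; exact: box_mono_filter.
by apply: eq_bigl => h; rewrite ltnNge.
Qed.

Lemma sum_box_nondecreasing u : (forall h, 0 <= u h) ->
  {homo (fun N => \sum_(h <- box N) u h) : m n / (m <= n)%N >-> m <= n}.
Proof.
move=> u0 m n mn; rewrite (sum_box_split _ mn) lerDl.
by apply: sumr_ge0 => h _; exact: u0.
Qed.

Lemma sum_box_tail_le u K N : (forall h, 0 <= u h) -> (N <= K)%N ->
  \sum_(h <- box N | (K < mnorm h)%N) u h = 0.
Proof.
move=> u0 NK; rewrite big_seq_cond big1// => h; rewrite mem_box => /andP[hN Kh].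
by have := leq_trans hN NK; rewrite leqNgt Kh.
Qed.

Lemma abs_summable_box u : abs_summable u ->
  exists2 B : R, 0 <= B & forall N, \sum_(h <- box N) `|u h| <= B.
Proof.
rewrite /abs_summable /summable => us.
have e0 : (0 <= \esum_(x in [set: int * int]) `|(u x)%:E|)%E.
  by apply: esum_ge0 => x _; exact: abse_ge0.
exists (fine (\esum_(x in [set: int * int]) `|(u x)%:E|)%E); first exact: fine_ge0.
move=> N; rewrite -lee_fin fineK; last by rewrite ge0_fin_numE.
apply: esum_ge; exists [set` box N]; first by split => //; exact: finite_seq.
by rewrite -fsbig_seq ?box_uniq// -sumEFin.
Qed.

Lemma sum_box_cvg_bounded u (B : R) : (forall N, \sum_(h <- box N) `|u h| <= B) ->
  cvgn (fun N => \sum_(h <- box N) u h).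
Proof.
move=> uB.
have H v : (forall h, 0 <= v h) -> (forall h, v h <= `|u h|) ->
    cvgn (fun N => \sum_(h <- box N) v h).
  move=> v0 vu; apply: nondecreasing_is_cvgn; first exact: sum_box_nondecreasing.
  by exists B => _ [N _ <-]; apply: le_trans (uB N); exact: ler_sum.
pose up h := (`|u h| + u h) / 2; pose un h := (`|u h| - u h) / 2.
have un_le h : - `|u h| <= u h <= `|u h| by rewrite -ler_norml.
have cp : cvgn (fun N => \sum_(h <- box N) up h).
  by apply: H => h; rewrite /up; have := un_le h; lra.
have cn : cvgn (fun N => \sum_(h <- box N) un h).
  by apply: H => h; rewrite /un; have := un_le h; lra.
rewrite (_ : (fun N => _) = (fun N => \sum_(h <- box N) up h - \sum_(h <- box N) un h)).
  exact: is_cvgB.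
by apply/funext => N; rewrite -sumrB; apply: eq_bigr => h _; rewrite /up /un; lra.
Qed.

Lemma abs_summable_tail u : abs_summable u -> forall e : R, 0 < e ->
  exists K0, forall K N, (K0 <= K)%N -> \sum_(h <- box N | (K < mnorm h)%N) `|u h| <= e.
Proof.
move=> us e e0; have [B B0 uB] := abs_summable_box us.
pose b N := \sum_(h <- box N) `|u h|.
have bmono : {homo b : m n / (m <= n)%N >-> m <= n}.
  by apply: sum_box_nondecreasing => h; exact: normr_ge0.
have cb : cvgn b.
  by apply: (@sum_box_cvg_bounded _ B) => N; under eq_bigr do rewrite normr_id.
have bl N : b N <= limn b by exact: nondecreasing_cvgn_le.
have /cvgrPdist_le/(_ e e0)[K0 _ K0P] := cb.
exists K0 => K N K0K.
have [NK|KN] := leqP N K.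
  by rewrite sum_box_tail_le// ltW.
have := K0P K K0K; rewrite ger0_norm ?subr_ge0//.
have := bl N; rewrite /b (sum_box_split _ (ltnW KN)); lra.
Qed.

End box_sums.

(** * Random series with summable coefficients *)

Section random_series.
Context {R : realType} {d} {T : measurableType d} (P : probability T R).

Lemma Rintegral_dominated_ae (f_ : nat -> T -> R) (f : T -> R) (B : R) :
  (forall n, measurable_fun setT (f_ n)) -> measurable_fun setT f ->
  (forall n w, `|f_ n w| <= B) ->
  {ae P, forall w, f_ n w @[n --> \oo] --> f w} ->
  Ex P (f_ n) @[n --> \oo] --> Ex P f.
Proof.
move=> mf_ mf fB ff.
have [|||||ifl _ H] := @dominated_convergence _ _ _ P setT measurableT
  (fun n => EFin \o f_ n) (EFin \o f) (EFin \o cst B).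
- by move=> n; exact/measurable_EFinP.
- exact/measurable_EFinP.
- by apply: filterS ff => w fw _; apply: cvg_EFin; [exact: nearW|exact: fw].
- by apply: bdm_integrable; exact: bdm_cst.
- by apply: aeW => w n _ /=; rewrite lee_fin fB.
apply: fine_cvg; rewrite fineK//.
exact: integrable_fin_num.
Qed.

Variables (psi : int * int -> R) (Z : int * int -> T -> R) (C : R).
Hypothesis psis : abs_summable psi.
Hypothesis mZ : forall h, measurable_fun setT (Z h).
Hypothesis ZC : forall h, (\int[P]_w (`|Z h w|)%:E <= C%:E)%E.

Let S N (w : T) : R := \sum_(h <- box N) `|psi h * Z h w|.

Let mS N : measurable_fun setT (S N).
Proof.
apply: measurable_sum => h; apply: measurableT_comp => //.
by apply: measurable_funM => //; exact: measurable_cst.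
Qed.

Let S_nd w : {homo S ^~ w : m n / (m <= n)%N >-> m <= n}.
Proof. by apply: sum_box_nondecreasing => h; exact: normr_ge0. Qed.

(** Taken in the extended reals, so that the limit exists and is measurable at every point; a finite
    integral then makes it finite almost surely. *)
Let F w : \bar R := limn (fun N => (S N w)%:E).

Let cS w : cvgn (fun N => (S N w)%:E).
Proof. by apply: ereal_nondecreasing_is_cvgn => m n mn; rewrite lee_fin S_nd. Qed.

Let mF : measurable_fun setT F.
Proof.
apply: (emeasurable_fun_cvg (fun N => EFin \o S N)) => [N|w _]; first exact/measurable_EFinP.
exact: cS.
Qed.

Let intF : (\int[P]_w F w < +oo)%E.
Proof.
have [B B0 psiB] := abs_summable_box psis.
have C0 : 0 <= C.
  by rewrite -lee_fin; apply: le_trans (ZC 0); apply: integral_ge0 => w _; rewrite lee_fin.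
apply: (@le_lt_trans _ _ (B * C)%:E); last exact: ltry.
have H := @cvg_monotone_convergence _ _ R P setT measurableT (fun N => EFin \o S N).
have {}H : (\int[P]_w (S N w)%:E)%E @[N --> \oo] --> (\int[P]_w F w)%E.
  apply: H => [N|N w _|w _ m n mn]; first exact/measurable_EFinP.
    by rewrite lee_fin sumr_ge0.
  by rewrite lee_fin S_nd.
apply: (cvge_to_le H); apply: nearW => N.
under eq_integral do rewrite /S -sumEFin.
rewrite ge0_integral_sum//; last first.
  move=> h; apply/measurable_EFinP; apply: measurableT_comp => //.
  by apply: measurable_funM => //; exact: measurable_cst.
apply: (@le_trans _ _ (\sum_(h <- box N) (`|psi h| * C)%:E)%E); last first.
  by rewrite sumEFin lee_fin -mulr_suml ler_wpM2r.
apply: lee_sum => h _; under eq_integral do rewrite normrM EFinM.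
rewrite ge0_integralZl//; last first.
  by apply/measurable_EFinP; exact: measurableT_comp.
by rewrite EFinM; apply: lee_wpmul2l; rewrite ?lee_fin.
Qed.

Lemma random_series_cvg : exists G : {RV P >-> R},
  cvg_dist P P (fun N w => \sum_(h <- box N) psi h * Z h w) G.
Proof.
pose V N w : R := \sum_(h <- box N) psi h * Z h w.
have mV N : measurable_fun setT (V N).
  by apply: measurable_sum => h; apply: measurable_funM => //; exact: measurable_cst.
pose A := [set w | F w \is a fin_num].
have mA : measurable A.
  by have := emeasurable_fin_num measurableT mF; rewrite setTI.
have VA w : A w -> cvgn (V ^~ w).
  rewrite /A /= => Fw; apply: (@sum_box_cvg_bounded _ _ (fine (F w))) => N.
  rewrite -lee_fin fineK//.
  apply: lime_ge; first exact: cS.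
  by exists N => // m /= Nm; rewrite lee_fin S_nd.
(* Killing the partial sums off [A] makes them converge at every point, so that the limit [G] is
   measurable as an everywhere limit. *)
pose U N w : R := V N w * \1_A w.
have cU w : cvgn (U ^~ w).
  rewrite /U indicE; have [wA|wA] := boolP (w \in A).
    by apply: is_cvgM; [exact/VA/set_mem|exact: is_cvg_cst].
  by under eq_fun do rewrite mulr0; exact: is_cvg_cst.
pose G w : R := limn (U ^~ w).
have mG : measurable_fun setT G.
  apply: (@measurable_fun_cvg _ _ _ _ U) => [N|w _]; last exact: cU.
  by apply: measurable_funM => //; exact: measurable_indic.
have aeV : {ae P, forall w, V N w @[N --> \oo] --> G w}.
  have iF : P.-integrable setT F.
    apply/integrableP; split => //.
    rewrite (eq_integral F)// => w _; rewrite gee0_abs//.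
    apply: lime_ge; first exact: cS.
    by apply: nearW => N; rewrite lee_fin sumr_ge0.
  have := integrable_ae measurableT iF.
  apply: filterS => w /(_ I) Fw.
  have wA : w \in A by apply/mem_set.
  have := cU w; rewrite /G /U indicE wA.
  by under eq_fun do rewrite mulr1.
pose Gm : {mfun T >-> R} := HB.pack G (isMeasurableFun.Build _ _ _ _ G mG).
exists Gm.
apply/cvg_distR => [N||phi B phic phiB]; [exact: mV|exact: mG|].
apply: (@Rintegral_dominated_ae (fun N => phi \o V N) (phi \o G) B).
- by move=> N; apply: measurableT_comp (mV N); exact: continuous_measurable_fun.
- by apply: (measurableT_comp _ mG); exact: continuous_measurable_fun.
- by move=> N w; exact: phiB.
- by apply: filterS aeV => w Vw; apply: (cvg_comp _ _ Vw); exact: phic.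
Qed.

End random_series.

(** * Lag counts and the reflection of the frequency grid *)

Section counting.
Context {R : realType}.
Implicit Types (n : nat) (h k s t : int * int).

Lemma count_iota_le (n k : nat) : count (fun i => i <= k)%N (iota 1 n) = minn n k.
Proof.
elim: n => [|n IH]; first by rewrite min0n.
by rewrite -(addn1 n) iotaD count_cat IH /= add1n; case: leqP => ? /=; lia.
Qed.

Lemma count_iota_shift n (z : int) :
  count (fun i : nat => (1 <= i%:Z + z) && (i%:Z + z <= n%:Z)) (iota 1 n) = (n - `|z|)%N.
Proof.
have [z0|z0] := leP 0 z.
  have E : {in iota 1 n, (fun i : nat => (1 <= i%:Z + z) && (i%:Z + z <= n%:Z)) =1
      (fun i => (i <= n - `|z|)%N && (`|z| <= n)%N)}.
    by move=> i; rewrite mem_iota => iN; apply/idP/idP; lia.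
  rewrite (eq_in_count E); have [zn|zn] := leqP `|z| n.
    by under eq_count do rewrite andbT; rewrite count_iota_le; lia.
  by under eq_count do rewrite andbF; rewrite count_pred0; lia.
have E : {in iota 1 n, (fun i : nat => (1 <= i%:Z + z) && (i%:Z + z <= n%:Z)) =1
    predC (fun i => (i <= `|z|)%N)}.
  by move=> i; rewrite mem_iota => iN /=; apply/idP/idP; lia.
rewrite (eq_in_count E); have := count_predC (fun i => (i <= `|z|)%N) (iota 1 n).
rewrite size_iota count_iota_le => C; apply: (@addnI (minn n `|z|)).
by rewrite C; lia.
Qed.

Lemma lagcountE n h : lagcount n h = ((n - `|h.1|) * (n - `|h.2|))%N.
Proof.
rewrite /lagcount -!count_iota_shift -!sum1_count [LHS]big_mkcond {1}/Lam big_allpairs_dep /=.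
rewrite [X in (X * _)%N]big_mkcond [X in (_ * X)%N]big_mkcond big_distrl; apply: eq_bigr => i _.
rewrite big_distrr; apply: eq_bigr => j _; rewrite mem_Lam /=.
by do 4 case: (_ <= _).
Qed.

Lemma lagcount_le n h : (lagcount n h <= n * n)%N.
Proof. by rewrite lagcountE leq_mul// leq_subr. Qed.

Lemma lagcount_ge n h : (n * n <= lagcount n h + 2 * mnorm h * n)%N.
Proof. rewrite lagcountE /mnorm; case: h => x y /=; nia. Qed.

Lemma lagcount_frac_ge n h : (0 < n)%N ->
  1 - 2 * (mnorm h)%:R / n%:R <= (lagcount n h)%:R / n%:R ^+ 2 :> R.
Proof.
move=> n0; have n0' : 0 < n%:R :> R by rewrite ltr0n.
rewrite ler_pdivlMr ?exprn_gt0// mulrBl mul1r.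
rewrite (_ : 2 * (mnorm h)%:R / n%:R * n%:R ^+ 2 = 2 * (mnorm h)%:R * n%:R); last first.
  by field; rewrite gt_eqF.
by rewrite lerBlDr -natrX -!natrM -natrD ler_nat expnS expn1 lagcount_ge.
Qed.

Lemma lagcount_frac_le1 n h : (lagcount n h)%:R / n%:R ^+ 2 <= 1 :> R.
Proof.
case: n => [|n]; first by rewrite expr0n /= invr0 mulr0.
by rewrite ler_pdivrMr ?exprn_gt0// mul1r -natrX ler_nat expnS expn1 lagcount_le.
Qed.

Lemma lagcount_frac_ge0 n h : 0 <= (lagcount n h)%:R / n%:R ^+ 2 :> R.
Proof. by rewrite divr_ge0// exprn_ge0. Qed.

(* A nonzero shift of [k] by a multiple of [n] has few admissible base points. *)
Lemma lagcount_alias n h k : zdiv n (h - k) -> h != k -> (lagcount n h <= mnorm k * n)%N.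
Proof.
move=> /andP[/= /dvdzP[q1 E1] /dvdzP[q2 E2]] hk; rewrite lagcountE.
have large (x y q : int) : x - y = q * n%:Z -> q != 0 -> (n - `|x| <= `|y|)%N by nia.
case: h k hk E1 E2 => [h1 h2] [k1 k2] /= hk E1 E2.
rewrite /mnorm /=; have [q10|q10] := eqVneq q1 0; last first.
  by apply: leq_mul; [have := large _ _ _ E1 q10; lia|exact: leq_subr].
have [q20|q20] := eqVneq q2 0; last first.
  by rewrite mulnC; apply: leq_mul; [have := large _ _ _ E2 q20; lia|exact: leq_subr].
move: E1 E2; rewrite q10 q20 !mul0r => /eqP; rewrite subr_eq0 => /eqP E1 /eqP.
by rewrite subr_eq0 => /eqP E2; move: hk; rewrite E1 E2 eqxx.
Qed.

(** In each coordinate, a residue class has at most three members in [[- n, n]]: the remainder and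
    its translates by [n] and [- n]. *)
Lemma count_class_le n k : (0 < n)%N -> (count (fun h => zdiv n (h - k)%R) (box n) <= 9)%N.
Proof.
move=> n0; pose J (z : int) := [:: (z %% n%:Z)%Z - n%:Z; (z %% n%:Z)%Z; (z %% n%:Z)%Z + n%:Z].
have JP (z i : int) : (n%:Z %| i - z)%Z -> (`|i| <= n)%N -> i \in J z.
  move=> /dvdzP[q E] iN; rewrite !inE.
  have m0 : 0 <= (z %% n)%Z by apply: modz_ge0; lia.
  have m1 : (z %% n)%Z < n%:Z by apply: ltz_pmod; lia.
  have Ez := divz_eq z n%:Z; move: m0 m1 Ez.
  move: (z %% n)%Z (z %/ n)%Z => c e m0 m1 Ez.
  have Ei : i = c + (q + e) * n%:Z by rewrite mulrDl -E Ez; ring.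
  have [q2|q2] := leP 2 (q + e); first by nia.
  have [q3|q3] := leP (q + e) (-2); first by nia.
  have : q + e = -1 \/ q + e = 0 \/ q + e = 1 by lia.
  by case=> [|[|]] q4; move: Ei; rewrite q4 => ->; lia.
rewrite -size_filter; have -> : 9%N = size [seq (i, j) | i <- J k.1, j <- J k.2] by [].
apply: uniq_leq_size; first by rewrite filter_uniq// box_uniq.
move=> [i j]; rewrite mem_filter mem_box => /andP[/andP[d1 d2]].
rewrite /mnorm geq_max => /andP[i1 i2].
by apply/allpairsP; exists (i, j); split => //; exact: JP.
Qed.

Lemma sum_Lam_reindex n k (F : int * int -> R) :
  \sum_(s <- Lam n | s + k \in Lam n) F (s + k) = \sum_(t <- Lam n | t - k \in Lam n) F t.
Proof.
rewrite -[LHS]big_filter -[RHS]big_filter -(big_map (fun s => s + k) xpredT F).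
apply: perm_big; apply: uniq_perm.
- by rewrite map_inj_uniq ?filter_uniq ?Lam_uniq//; exact: addIr.
- by rewrite filter_uniq ?Lam_uniq.
move=> t; apply/mapP/idP => [[s]|].
  by rewrite !mem_filter => /andP[skn sn] ->; rewrite addrK sn skn.
rewrite mem_filter => /andP[tk tn]; exists (t - k); last by rewrite subrK.
by rewrite mem_filter subrK tn.
Qed.

(* The reflection of the frequency grid; [n] plays the role of [0] in the index set. *)
Definition refl n (j : int * int) : int * int :=
  (if j.1 == n%:Z then n%:Z else n%:Z - j.1, if j.2 == n%:Z then n%:Z else n%:Z - j.2).

Lemma refl_freq n j : (0 < n)%N ->
  exists k l : int, freq n (refl n j) = - freq n j + period k l :> R * R.
Proof.
move=> n0; have n0' : n%:R != 0 :> R by rewrite pnatr_eq0 -lt0n.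
have one (x : int) : exists k : int, 2 * pi * (if x == n%:Z then n%:Z else n%:Z - x)%:~R / n%:R =
    - (2 * pi * x%:~R / n%:R) + 2 * pi * k%:~R :> R.
  case: eqP => [->|_]; [exists 2|exists 1]; last by rewrite intrB; field.
  by field.
have [k Ek] := one j.1; have [l El] := one j.2.
by exists k, l; rewrite /freq /refl /= Ek El.
Qed.

Lemma sum_refl n (F : int * int -> R) :
  \sum_(j <- Lam n) F (refl n j) = \sum_(j <- Lam n) F j.
Proof.
rewrite -(big_map (refl n) xpredT F); apply: perm_big.
have inv j : j \in Lam n -> refl n j \in Lam n /\ refl n (refl n j) = j.
  have one (x : int) : 1 <= x -> x <= n%:Z ->
      let y := if x == n%:Z then n%:Z else n%:Z - x in
      [/\ 1 <= y, y <= n%:Z & (if y == n%:Z then n%:Z else n%:Z - y) = x].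
    move=> x1 xn /=; have [->|xn'] := eqVneq x n%:Z.
      by rewrite eqxx; split=> //; lia.
    by rewrite ifF; [split; lia|apply/eqP; lia].
  move=> jN; have := jN; rewrite (mem_Lam n j) => /and4P[x1 xn y1 yn].
  have [a1 a2 a3] := one _ x1 xn; have [b1 b2 b3] := one _ y1 yn.
  rewrite mem_Lam /refl /= a1 a2 b1 b2; split => //.
  by rewrite a3 b3 -surjective_pairing.
apply: uniq_perm; last 1 first.
- move=> j; apply/mapP/idP => [[i iN ->]|jN]; first by case: (inv i iN).
  by exists (refl n j); case: (inv j jN).
- rewrite map_inj_in_uniq ?Lam_uniq// => i j iN jN E.
  by rewrite -(inv i iN).2 E (inv j jN).2.
- exact: Lam_uniq.
Qed.

End counting.

(** * Decay of the extremogram and the bias *)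

Section stretched_exponential.
Context {R : realType}.

(** With [y = l ^ tau], the power [l ^ b] is at most [y ^ k.+1] once [k.+1 * tau >= b], and the
    exponential dominates [(c * y) ^ k.+1 / (k.+1)!]. *)
Lemma stretched_exp_le (rho tau : R) (b : nat) : 0 < rho < 1 -> 0 < tau ->
  exists2 C : R, 0 <= C & forall l : nat, (0 < l)%N ->
    l%:R ^+ b * rho `^ (l%:R `^ tau) <= C.
Proof.
move=> /andP[rho0 rho1] tau0.
pose c := - ln rho.
have c0 : 0 < c by rewrite oppr_gt0 ln_lt0// rho0.
have [k kb] : exists k : nat, b%:R <= k.+1%:R * tau.
  have [k _ kP] := @nbhs_infty_ger R (b%:R / tau) .
  exists k; have := kP k (leqnn k); rewrite /= ler_pdivrMr// => H.
  by apply: le_trans H _; rewrite ler_pM2r// ler_nat.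
exists ((k.+1)`!%:R / c ^+ k.+1); first by rewrite divr_ge0// exprn_ge0// ltW.
move=> l l0; have l0' : 0 < l%:R :> R by rewrite ltr0n.
have l1 : 1 <= l%:R :> R by rewrite ler1n.
set y := l%:R `^ tau; have y0 : 0 < y by exact: powR_gt0.
have E : rho `^ y = (expR (c * y))^-1.
  by rewrite /powR gt_eqF// -expRN mulrC /c mulNr opprK.
have yb : l%:R ^+ b <= y ^+ k.+1.
  rewrite -!powR_mulrn ?(ltW l0') ?(ltW y0)// /y -powRrM (mulrC tau).
  exact: (ler_powR l1 kb).
have ex : (c * y) ^+ k.+1 / (k.+1)`!%:R <= expR (c * y).
  have h0 : 0 <= c * y by rewrite mulr_ge0// ltW.
  by have := expR_ge1Dxn k h0; lra.
have f0 : 0 < (k.+1)`!%:R :> R by rewrite ltr0n fact_gt0.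
have ck : 0 < c ^+ k.+1 by rewrite exprn_gt0.
rewrite E ler_pdivrMr ?expR_gt0// mulrAC ler_pdivlMr//.
move: ex; rewrite ler_pdivrMr// exprMn => ex.
rewrite mulrC [leRHS]mulrC; apply: le_trans ex; exact: ler_wpM2l (ltW ck) _ _ yb.
Qed.

End stretched_exponential.

(** Replaces an inverse of [r], which need not be monotone. At the predecessor of a first passage
    beyond [b], [r k < l], so a nonincreasing mixing rate at [l] is controlled by its value at
    [r k]. *)
Lemma first_passage (r : nat -> nat) (b l : nat) : (exists n, (b <= n)%N && (l <= r n)%N) ->
  exists n, [/\ (b <= n)%N, (l <= r n)%N &
    n = b \/ exists k, [/\ n = k.+1, (b <= k)%N & (r k < l)%N]].
Proof.
move=> /ex_minnP[n /andP[bn lr] nmin]; exists n; split => //.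
have [nb|bn'] := leqP n b; first by left; apply/eqP; rewrite eqn_leq nb bn.
case: n bn bn' lr nmin => // n bn bn' lr nmin; right; exists n; split => //.
by rewrite ltnNge; apply/negP => lrn; have := nmin n; rewrite lrn ltnn -ltnS bn' => /(_ isT).
Qed.

(** * Consequences of the mixing and anti-clustering conditions *)

Section asymptotics.
Context {R : realType} {d} {T : measurableType d} {P : probability T R}.
Variable X : int * int -> {RV P >-> R}.
Variables (a : nat -> R) (m r : nat -> nat) (abar : nat -> R).
Hypothesis stat : strictly_stationary X.
Hypothesis norm : normalizing_sequence X a.
Hypothesis M1 : condition_M1 X a m r abar.
Hypothesis M2 : condition_M2 X a m r.
Hypothesis n7 : n%:R ^+ 7 * abar (r n) @[n --> \oo] --> (0 : R).
Implicit Types (n N : nat) (h k : int * int).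

Local Notation M n := ((m n)%:R : R).
Local Notation p n := (plevel X (a (m n))).
Local Notation pr n := (pair_prob X (a (m n))).
Local Notation gam := (extremogram X).
Local Notation al n := (abar (r n)).
Local Notation pm n := (pre_extremogram X a m n).

Lemma m_cvgy : M n @[n --> \oo] --> +oo.
Proof. by apply/cvgrnyP; case: M1 => -[]. Qed.

Lemma M_ge (A : R) : \forall n \near \oo, A <= M n.
Proof. by move: m_cvgy => /cvgryPge; exact. Qed.

Lemma M_gt0 : \forall n \near \oo, 0 < M n.
Proof. by apply: filterS (M_ge 1) => n; exact: lt_le_trans. Qed.

Lemma r_ge (A : nat) : \forall n \near \oo, (A <= r n)%N.
Proof. by case: M1 => -[_ /cvgnyPge]. Qed.

Lemma M_le_n (e : R) : 0 < e -> \forall n \near \oo, M n <= e * n%:R.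
Proof.
move=> e0; case: M1 => -[_ _ /cvgrPdist_le/(_ e e0) H _] _.
move: H (nbhs_infty_gt 0); apply: filterS2 => n.
by rewrite sub0r normrN ger0_norm ?divr_ge0// => + n0; rewrite ler_pdivrMr ?ltr0n.
Qed.

(** Makes errors of order [1 / M n] negligible after rescaling; it follows from the assumption on
    [n * r n / m n ^ (3/2)] because eventually [r n >= 1]. *)
Lemma n_over_M (e : R) : 0 < e -> \forall n \near \oo,
  n%:R / Num.sqrt (M n) / M n <= e.
Proof.
move=> e0; case: M1 => _ [/cvgrPdist_le/(_ e e0) H _ _ _].
move: H M_gt0 (r_ge 1); apply: filterS3 => n.
rewrite sub0r normrN => + M0 r1.
have E : M n `^ (3 / 2) = M n * Num.sqrt (M n).
  rewrite (_ : 3 / 2 = 1 + 2^-1 :> R); last by field.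
  by rewrite powRD ?(gt_eqF M0) ?implybT// powRr1 ?ltW// powR12_sqrt// ltW.
have s0 : 0 < Num.sqrt (M n) by rewrite sqrtr_gt0.
rewrite E ger0_norm ?divr_ge0 ?mulr_ge0 ?sqrtr_ge0//.
apply: le_trans.
rewrite -[leRHS]mulrA -mulrA -invfM [in leLHS]mulrC [in leRHS]mulrCA mulrC.
rewrite (mulrC (Num.sqrt (M n)) (M n)).
apply: ler_peMl; last by rewrite ler1n.
by rewrite mulr_ge0// invr_ge0 mulr_ge0// ltW.
Qed.

Lemma r4_le_M (e : R) : 0 < e -> \forall n \near \oo, (r n)%:R ^+ 4 <= e * M n.
Proof.
move=> e0; case: M1 => _ [_ /cvgrPdist_le/(_ e e0) H _ _].
move: H M_gt0; apply: filterS2 => n.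
by rewrite sub0r normrN ger0_norm ?divr_ge0// => + M0; rewrite ler_pdivrMr.
Qed.

Lemma abar_mono : nonincreasing_seq abar.
Proof. by case: M1 => _ [_ _ _ [[K [tau [rho []]]]]]. Qed.

Lemma abar_mix (j k l : nat) : (mixing_coef X j k l <= (abar l)%:E)%E.
Proof. by case: M1 => _ [_ _ _ [[K [tau [rho [_ _ _ _ [H _]]]]] _]]; exact: H. Qed.

Lemma mixP l (S S' : {fset int * int}) (B C : set T) :
  (forall s t, s \in S -> t \in S' -> (l <= mnorm (s - t)%R)%N) ->
  measurable B -> measurable C -> sigma_field X S B -> sigma_field X S' C ->
  `|fine (P (B `&` C)) - fine (P B) * fine (P C)| <= abar l.
Proof. exact: mixing_coefP abar_mix. Qed.

(** [abar l] dominates an absolute value, for instance that of empty sets of sites, which are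
    separated by any distance. *)
Lemma abar_ge0 l : 0 <= abar l.
Proof.
apply: le_trans (normr_ge0 _) (mixP (l := l) (S := fset0) (S' := fset0)
  _ measurableT measurableT _ _); [by move=> ? ?; rewrite !inE|exact: sigma_fieldT..].
Qed.

Lemma al7 (e : R) : 0 < e -> \forall n \near \oo, n%:R ^+ 7 * al n <= e.
Proof.
move=> e0; move: n7 => /cvgrPdist_le/(_ e e0); apply: filterS => n.
by rewrite sub0r normrN ger0_norm// mulr_ge0 ?exprn_ge0 ?abar_ge0.
Qed.

(** As [n * P (|X| > a n)] tends to 1 along levels tending to infinity, no tail probability
    vanishes. Conditional probabilities are quotients, and a zero denominator would give them the
    default value 0. *)
Lemma exceed_gt0 x : 0 < fine (P (exceed X x 0)).
Proof.
have [ay na] := norm.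
have h2 : 0 < 2^-1 :> R by rewrite invr_gt0.
have := na => /cvgrPdist_lt/(_ _ h2) H.
have ax : \forall n \near \oo, x <= a n by move: ay => /cvgryPge; exact.
near \oo => n.
have xn : x <= a n by near: n.
have Pn : 0 < fine (P (exceed X (a n) 0)).
  have : `|1 - n%:R * fine (P (exceed X (a n) 0))| < 2^-1 by near: n.
  rewrite ltr_norml => /andP[_ Hn].
  have q0 : 0 <= fine (P (exceed X (a n) 0)) by exact: fine_ge0.
  rewrite lt_neqAle q0 andbT; apply/negP => /eqP E.
  by move: Hn; rewrite -E mulr0; lra.
apply: lt_le_trans Pn _.
apply: fine_le; rewrite ?fin_num_measure//; [exact: measurable_exceed..|].
apply: le_measure; rewrite ?inE; [exact: measurable_exceed..|].
by move=> w /=; exact: le_lt_trans.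
Unshelve. all: by end_near. Qed.

Lemma p_gt0 n : 0 < p n.
Proof. exact: exceed_gt0. Qed.

Lemma extremogram0 : gam 0 = 1.
Proof.
rewrite /extremogram (_ : (fun x => _) = cst 1) ?lim_cst//.
by apply/funext => x; rewrite /cond_prob setIid divff// gt_eqF// exceed_gt0.
Qed.

Lemma preE n h : pm n h = pr n h / p n.
Proof. by rewrite /pre_extremogram /cond_prob setIC. Qed.

Lemma pre0 n : pm n 0 = 1.
Proof. by rewrite preE pair_prob0 divff// gt_eqF// p_gt0. Qed.

Lemma pre_ge0 n h : 0 <= pm n h.
Proof. by rewrite preE divr_ge0 ?pair_prob_ge0// ltW// p_gt0. Qed.

Lemma pre_le1 n h : pm n h <= 1.
Proof.
rewrite preE ler_pdivrMr ?p_gt0// mul1r /pair_prob /plevel.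
apply: fine_le; rewrite ?fin_num_measure//; try exact: measurable_exceed.
  by apply: measurableI; exact: measurable_exceed.
apply: le_measure; rewrite ?inE; try exact: measurable_exceed.
  by apply: measurableI; exact: measurable_exceed.
exact: subIsetl.
Qed.

Lemma Mp_near1 : exists2 C : R, 0 <= C & \forall n \near \oo, `|M n * p n - 1| <= C / M n.
Proof.
have [[C H] _] := M2; exists `|C| => //.
move: H; apply: filterS => n /le_trans; apply.
by rewrite ler_wpM2r ?invr_ge0// ler_norm.
Qed.

Lemma Mp_bounds : \forall n \near \oo, 2^-1 <= M n * p n <= 2.
Proof.
have [C C0 H] := Mp_near1.
move: H (M_ge (2 * C)) M_gt0; apply: filterS3 => n H MC M0.
have : C / M n <= 2^-1 by rewrite ler_pdivrMr//; lra.
by move: H; rewrite ler_norml; lra.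
Qed.

Lemma le_bigmax_mem (I : eqType) (s : seq I) (q : pred I) (F : I -> R) i :
  i \in s -> q i -> F i <= \big[Num.max/0]_(j <- s | q j) F j.
Proof.
elim: s => // j s IH; rewrite inE big_cons => /predU1P[<- ->|is_ qi].
  by rewrite le_max lexx.
by case: ifP => _; rewrite ?le_max IH ?orbT.
Qed.

Lemma pre_extremogram_near (e : R) : 0 < e -> \forall n \near \oo,
  forall h, (mnorm h <= r n)%N -> n%:R / Num.sqrt (M n) * `|pm n h - gam h| <= e.
Proof.
move=> e0; have [_ /cvgrPdist_le/(_ e e0)] := M2; apply: filterS => n.
rewrite sub0r normrN => H h hr.
(* (M2) leaves out the lag 0, at which both sides are 1. *)
have [h0|h0] := leqP 1 (mnorm h); last first.
  have -> : h = 0 by move: h0; rewrite /mnorm; case: h hr => x y /= _; case: x => -[|x]; case: y => -[|y] //=; lia.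
  by rewrite pre0 extremogram0 subrr normr0 mulr0 ltW.
apply: (le_trans _ (le_trans (ler_norm _) H)).
apply: ler_wpM2l; first by rewrite divr_ge0 ?sqrtr_ge0.
by apply: (le_bigmax_mem (fun h => `|pm n h - gam h|)); rewrite ?mem_box.
Qed.

Lemma sqrtM_le n : M n <= n%:R -> (0 < n)%N -> 0 < M n -> 1 <= n%:R / Num.sqrt (M n).
Proof.
move=> Mn n0 M0; have s0 : 0 < Num.sqrt (M n) by rewrite sqrtr_gt0.
rewrite ler_pdivlMr// mul1r; have n1 : 1 <= n%:R :> R by rewrite ler1n.
rewrite -[leRHS]ger0_norm// -sqrtr_sqr; apply: ler_wsqrtr.
by apply: (le_trans Mn); rewrite expr2 ler_peMr.
Qed.

(** The sign is inherited from [pm n h]: eventually the weight in (M2) is at least 1, so (M2) yields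
    plain convergence of [pm n h] to [gam h]. *)
Lemma extremogram_ge0 h : 0 <= gam h.
Proof.
apply/ler_addgt0Pl => e e0.
have Mn := M_le_n (ltr01 : 0 < 1 :> R).
near \oo => n.
have n0 : (0 < n)%N by near: n; exact: nbhs_infty_gt.
have M0 : 0 < M n by near: n; exact: M_gt0.
have Mn' : M n <= n%:R by rewrite -[leRHS]mul1r; near: n.
have hr : (mnorm h <= r n)%N by near: n; exact: r_ge.
have H : forall h, (mnorm h <= r n)%N -> n%:R / Num.sqrt (M n) * `|pm n h - gam h| <= e.
  by near: n; exact: pre_extremogram_near.
have := H h hr; have := sqrtM_le Mn' n0 M0; set q := _ / _ => q1 He.
have : `|pm n h - gam h| <= e by apply: le_trans He; rewrite ler_peMl.
rewrite ler_norml; have := pre_ge0 n h; lra.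
Unshelve. all: by end_near. Qed.

Lemma pair_prob_far n h : pr n h <= p n ^+ 2 + abar (mnorm h).
Proof.
have mE := @measurable_exceed _ _ _ _ X (a (m n)).
have := @mixP (mnorm h) [fset (0 : int * int)]%fset [fset h]%fset
  (exceed X (a (m n)) 0) (exceed X (a (m n)) h).
rewrite !P_exceed// -/(pr n h) -expr2.
have sep s t : s \in [fset (0 : int * int)]%fset -> t \in [fset h]%fset ->
    (mnorm h <= mnorm (s - t)%R)%N.
  by rewrite !inE => /eqP-> /eqP->; rewrite sub0r mnormN.
move=> /(_ sep (mE _) (mE _)) H; move: H => /(_ _ _)/=.
have s1 : sigma_field X [fset (0 : int * int)]%fset (exceed X (a (m n)) 0).
  by apply: sigma_field_exceed; rewrite inE.
have s2 : sigma_field X [fset h]%fset (exceed X (a (m n)) h).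
  by apply: sigma_field_exceed; rewrite inE.
by move=> /(_ s1 s2); rewrite ler_norml; lra.
Qed.

Lemma extremogram_decay : exists C : R, exists l0 : nat, 0 <= C /\
  forall h, (l0 <= mnorm h)%N -> gam h <= C / (mnorm h)%:R ^+ 4.
Proof.
have [K [tau [rho [K0 tau0 rho01 _ [_ abarK]]]]] :
    exists K tau rho : R, [/\ 0 < K, 0 < tau, 0 < rho < 1, nonincreasing_seq abar &
          (forall j k h : nat, mixing_coef X j k h <= (abar h)%:E)%E /\
          (forall h : nat, abar h <= K * rho `^ (h%:R `^ tau))].
  by case: M1 => _ [_ _ _ []].
(* 12 = 8 + 4: in the case [n1 = l ^ 8], the product [n1 * abar l] must be of order [l ^ -4]. *)
have [C1 C10 C1P] := stretched_exp_le 12 rho01 tau0.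
have e1 : 0 < 1 :> R by exact: ltr01.
have ev : \forall n \near \oo, [/\ (0 < n)%N, 1 <= M n, M n <= n%:R, (r n)%:R ^+ 4 <= M n &
    2^-1 <= M n * p n <= 2] /\ (n%:R ^+ 7 * al n <= 1 /\
    forall h, (mnorm h <= r n)%N -> n%:R / Num.sqrt (M n) * `|pm n h - gam h| <= 1).
  have r4 := r4_le_M e1; have Mn := M_le_n e1.
  near=> n; split; first split.
  - by near: n; exact: nbhs_infty_gt.
  - by near: n; exact: M_ge.
  - by rewrite -[leRHS]mul1r; near: n.
  - by rewrite -[leRHS]mul1r; near: n.
  - by near: n; exact: Mp_bounds.
  - split; first by near: n; exact: al7.
    by near: n; exact: pre_extremogram_near.
have [n0 _ n0P] := ev.
exists (7 + 2 * (K * C1)), n0.+1; split.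
  by rewrite addr_ge0// mulr_ge0// mulr_ge0// ltW.
move=> h; set l := mnorm h => hl.
have l0 : (0 < l)%N by lia.
have l0' : 0 < l%:R :> R by rewrite ltr0n.
have l1 : 1 <= l%:R :> R by rewrite ler1n.
have l4 : 0 < l%:R ^+ 4 :> R by rewrite exprn_gt0.
have [e8 e8E] : exists e : nat, e = (l ^ 8)%N by exists (l ^ 8)%N.
have ll8 : (l <= e8)%N by rewrite e8E -[leqLHS]expn1 leq_pexp2l.
have e8R : e8%:R = l%:R ^+ 8 :> R by rewrite e8E natrX.
clear e8E.
(* [gam h] is compared with [pm n1 h] for the first index [n1 >= l ^ 8] with
   [l <= r n1]: the size of [n1] makes the (M2) error at most [l ^- 4]. If
   [n1 = l ^ 8], then [n1 * abar l] is small by the stretched exponential bound;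
   otherwise [r n1.-1 < l], and it is small by the [n ^ 7 * abar (r n)] hypothesis. *)
have [|n1 [ln1 lr n1E]] := @first_passage r e8 l.
  have rl := r_ge l; near \oo => n; exists n; apply/andP; split; near: n => //.
  exact: nbhs_infty_ge.
have n1n0 : (n0 <= n1)%N := leq_trans (ltnW hl) (leq_trans ll8 ln1).
have [[n1pos M1n M1n' r4 Mp] [al1 pmg]] := n0P n1 n1n0.
have M0 : 0 < M n1 by exact: lt_le_trans M1n.
have n1R : l%:R ^+ 8 <= n1%:R :> R by rewrite -e8R ler_nat.
have n10 : 0 < n1%:R :> R by rewrite ltr0n.
have nal : n1%:R * abar l <= (K * C1 + 2) / l%:R ^+ 4.
  rewrite ler_pdivlMr//.
  case: n1E => [->|[k [-> e8k rl]]].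
    rewrite e8R; have := C1P l l0; have := abarK l; set w := _ `^ _ => ab lw.
    have w0 : 0 <= w by exact: powR_ge0.
    apply: (@le_trans _ _ (l%:R ^+ 8 * (K * w) * l%:R ^+ 4)).
      by rewrite ler_pM2r// ler_pM2l// exprn_gt0.
    rewrite (_ : _ * _ = K * (l%:R ^+ 12 * w)); last by ring.
    have : K * (l%:R ^+ 12 * w) <= K * C1 by rewrite ler_pM2l.
    lra.
  have k0 : (n0 <= k)%N := leq_trans (ltnW hl) (leq_trans ll8 e8k).
  have [[kpos _ _ _ _] [al1' _]] := n0P k k0.
  have abl : abar l <= al k by apply: abar_mono; exact: ltnW.
  set n2 := k%:R : R in al1'.
  have n2l : l%:R ^+ 4 <= n2.
    apply: (@le_trans _ _ (l%:R ^+ 8)); last by rewrite -e8R ler_nat.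
    by rewrite (_ : 8 = 4 + 4)%N// exprD ler_peMl ?exprn_ege1// ltW.
  have n21 : 1 <= n2 by rewrite ler1n.
  have n12 : k.+1%:R <= 2 * n2 by rewrite -natr1 /n2; lra.
  have ab0 : 0 <= abar l := abar_ge0 l.
  apply: (@le_trans _ _ (2 * n2 * abar l * n2)).
    have kab : 0 <= k.+1%:R * abar l by exact: mulr_ge0.
    exact: ler_pM kab (ltW l4) (ler_wpM2r ab0 n12) n2l.
  have n2ab : n2 ^+ 2 * abar l <= 1.
    apply: le_trans al1'; apply: ler_pM => //; first by rewrite exprn_ge0// (le_trans ler01).
    by rewrite -[leLHS]mulr1 (_ : 7 = 2 + 5)%N// exprD ler_wpM2l ?exprn_ege1// exprn_ge0// (le_trans ler01).
  rewrite (_ : _ * _ = 2 * (n2 ^+ 2 * abar l)); last by ring.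
  have : 0 <= K * C1 by rewrite mulr_ge0// ltW.
  lra.
(* Mixing gives [pm n1 h <= p n1 + abar l / p n1]. The first term is at most [2 / M n1], where
   [M n1 >= r n1 ^ 4 >= l ^ 4]; for the second, [1 / p n1 <= 2 * n1]. *)
have pml : pm n1 h <= 4 / l%:R ^+ 4 / 2 + 2 * ((K * C1 + 2) / l%:R ^+ 4).
  have pp := p_gt0 n1.
  have H := pair_prob_far n1 h.
  have : pm n1 h <= p n1 + abar l / p n1.
    rewrite preE ler_pdivrMr// mulrDl divfK ?gt_eqF// -expr2//.
  move=> /le_trans; apply; apply: lerD.
    have p2 : p n1 <= 2 / M n1 by rewrite ler_pdivlMr// mulrC; case/andP: Mp.
    apply: (le_trans p2); rewrite mulrAC (_ : 4 / 2 = 2); last by field.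
    rewrite ler_pM2l// lef_pV2 ?posrE//.
    apply: le_trans r4; rewrite lerXn2r ?nnegrE// ler_nat//.
  have pV : (p n1)^-1 <= 2 * n1%:R.
    have : 2^-1 <= n1%:R * p n1.
      by case/andP: Mp => Mp _; apply: (le_trans Mp); rewrite ler_pM2r.
    by move=> ?; rewrite -[leLHS]mul1r ler_pdivrMr//; lra.
  apply: (@le_trans _ _ (2 * (n1%:R * abar l))); last by rewrite ler_pM2l.
  have := ler_wpM2l (abar_ge0 l) pV; lra.
(* The weight in (M2) is at least [sqrt n1], hence at least [l ^ 4], which explains the choice of
   the eighth power. *)
have sq : Num.sqrt (M n1) * l%:R ^+ 4 <= n1%:R.
  apply: (@le_trans _ _ (Num.sqrt (n1%:R) * Num.sqrt (n1%:R))); last by rewrite -expr2 sqr_sqrtr// ltW.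
  apply: (ler_pM (sqrtr_ge0 _) (ltW l4) (ler_wsqrtr M1n') _).
  rewrite -[leLHS]ger0_norm ?(ltW l4)// -sqrtr_sqr ler_wsqrtr//.
  by rewrite -exprM.
have s0 : 0 < Num.sqrt (M n1) by rewrite sqrtr_gt0.
have gp : `|pm n1 h - gam h| <= 1 / l%:R ^+ 4.
  have := pmg h lr; rewrite mulrAC ler_pdivrMr// (mul1r (Num.sqrt _)) => H.
  rewrite ler_pdivlMr// -(ler_pM2l n10) mulr1.
  rewrite mulrA; apply: le_trans sq; by rewrite ler_pM2r.
move: gp; rewrite ler_norml => /andP[gp _].
have : gam h <= pm n1 h + 1 / l%:R ^+ 4 by lra.
move=> /le_trans; apply; apply: le_trans (lerD pml (lexx _)) _.
by rewrite -subr_ge0 (_ : _ - _ = 0)//; field; rewrite gt_eqF.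
Unshelve. all: by end_near. Qed.

End asymptotics.

Lemma size_box n : size (box n) = (n.*2.+1 * n.*2.+1)%N.
Proof. by rewrite size_allpairs !size_map !size_iota. Qed.

(** The square would do; the fourth power is the form in which [r n ^ 4 <= M n] is available. *)
Lemma sqr_odd_le q : (0 < q)%N -> (q.*2.+1 * q.*2.+1 <= 9 * q ^ 4)%N.
Proof.
move=> q0; have q3 : (q.*2.+1 <= 3 * q)%N by lia.
apply: (leq_trans (leq_mul q3 q3)); rewrite mulnACA leq_mul2l /=.
by rewrite -[leqLHS]/(q ^ 2)%N leq_pexp2l.
Qed.

(** * The variance bound and the tail of the extremogram *)

Section variance_and_bias.
Context {R : realType} {d} {T : measurableType d} {P : probability T R}.
Variable X : int * int -> {RV P >-> R}.
Variables (a : nat -> R) (m r : nat -> nat) (abar : nat -> R).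
Hypothesis stat : strictly_stationary X.
Hypothesis norm : normalizing_sequence X a.
Hypothesis M1 : condition_M1 X a m r abar.
Hypothesis M2 : condition_M2 X a m r.
Hypothesis n7 : n%:R ^+ 7 * abar (r n) @[n --> \oo] --> (0 : R).
Implicit Types (n N : nat) (h k : int * int).

Local Notation M n := ((m n)%:R : R).
Local Notation p n := (plevel X (a (m n))).
Local Notation pr n := (pair_prob X (a (m n))).
Local Notation gam := (extremogram X).
Local Notation al n := (abar (r n)).
Local Notation pm n := (pre_extremogram X a m n).
Local Notation rate n := (n%:R / Num.sqrt (M n)).

Lemma pair_prob_le n v : pr n v <= p n.
Proof.
apply: fine_le; rewrite ?fin_num_measure//; try exact: measurable_exceed.
  by apply: measurableI; exact: measurable_exceed.
apply: le_measure; rewrite ?inE; try exact: measurable_exceed.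
  by apply: measurableI; exact: measurable_exceed.
exact: subIsetl.
Qed.

(** The anti-clustering condition at [delta = 1]: some [h0] makes the upper limit less than 1, and
    an upper limit below 1 bounds the sequence eventually. *)
Lemma clustering_bound : exists h0 : nat, \forall n \near \oo,
  M n * (\sum_(v <- box (r n) | (h0 < mnorm v)%N) pr n v) <= 1.
Proof.
have [_ [_ _ H _]] := M1.
have := H 1 ltr01 => /fine_cvgP[Hfin /cvgrPdist_lt/(_ 1 ltr01) Hlt].
near \oo => h0; exists h0.
have f0 : limn_esup (fun n => ((m n)%:R%:E * \sum_(k <- box (r n) | (h0 < mnorm k)%N)
             P (exceed X (1 * a (m n))%R 0%R `&` exceed X (1 * a (m n))%R k))%E) \is a fin_num.
  by near: h0.
have : `|0 - fine (limn_esup (fun n => ((m n)%:R%:E * \sum_(k <- box (r n) | (h0 < mnorm k)%N)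
             P (exceed X (1 * a (m n))%R 0%R `&` exceed X (1 * a (m n))%R k))%E))| < 1.
  by near: h0.
rewrite sub0r normrN => /(le_lt_trans (ler_norm _)).
rewrite -lte_fin fineK// => /ereal_inf_lt[_ [V nV <-] Vlt].
apply: filterS nV => n Vn; rewrite -lee_fin.
apply: le_trans (ltW Vlt); apply: ereal_sup_ubound; exists n => //.
rewrite EFinM -sumEFin mul1r; congr (_ * _)%E; apply: eq_bigr => v _.
rewrite /pair_prob fineK// fin_num_measure//.
by apply: measurableI; exact: measurable_exceed.
Unshelve. all: by end_near. Qed.

Lemma M_Sexc_bounded : exists2 C : R, 0 <= C &
  \forall n \near \oo, M n * Sexc X (a (m n)) (r n) (al n) n <= C.
Proof.
have [h0 H0] := clustering_bound.
pose B : R := (h0.*2.+1 * h0.*2.+1)%:R.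
have B0 : 0 <= B by [].
(* [2 * B] bounds the lags within [h0], as [M n * p n <= 2], and 1 the clustering sum beyond. The
   term [7 * p n ^ 2], summed over at most [9 * M n] lags, gives 7 * 9 * 4 = 252, and mixing gives
   16. *)
exists (3 * (2 * B + 1 + 252) + 16); first by lra.
have r4 := r4_le_M M1 (ltr01 : 0 < 1 :> R); have Mn := M_le_n M1 (ltr01 : 0 < 1 :> R).
near=> n.
have n0 : (0 < n)%N by near: n; exact: nbhs_infty_gt.
have M0 : 0 < M n by near: n; exact: M_gt0 M1.
have Mn' : M n <= n%:R by rewrite -[leRHS]mul1r; near: n.
have r4' : (r n)%:R ^+ 4 <= M n by rewrite -[leRHS]mul1r; near: n.
have r1 : (1 <= r n)%N by near: n; exact: r_ge M1 _.
have rh : (h0 <= r n)%N by near: n; exact: r_ge M1 _.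
have Mp : 2^-1 <= M n * p n <= 2 by near: n; exact: Mp_bounds M1 M2.
have al1 : n%:R ^+ 7 * al n <= 1 by near: n; exact: (al7 M1 n7 ltr01).
have cl : M n * (\sum_(v <- box (r n) | (h0 < mnorm v)%N) pr n v) <= 1 by near: n.
have p0 : 0 <= p n by exact: plevel_ge0.
have ab0 : 0 <= al n by exact: abar_ge0 M1 _.
have S1 : M n * (\sum_(v <- box (r n)) pr n v) <= 2 * B + 1.
  rewrite (sum_box_split _ rh) mulrDr; apply: lerD => //.
  apply: (@le_trans _ _ (M n * (\sum_(v <- box h0) p n))).
    by rewrite ler_pM2l//; apply: ler_sum => v _; exact: pair_prob_le.
  rewrite big_const_seq count_predT size_box iter_addr_0 -[p n *+ _]mulr_natr mulrA.
  by apply: ler_wpM2r => //; case/andP: Mp.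
have S2 : M n * (\sum_(v <- box (r n)) 7 * p n ^+ 2) <= 252.
  rewrite big_const_seq count_predT size_box iter_addr_0 -[_ *+ _]mulr_natr.
  have rr : ((r n).*2.+1 * (r n).*2.+1)%:R <= 9 * M n :> R.
    apply: (@le_trans _ _ (9 * (r n)%:R ^+ 4)); last by lra.
    by rewrite -natrX -natrM ler_nat sqr_odd_le.
  have : M n * (7 * p n ^+ 2) * ((r n).*2.+1 * (r n).*2.+1)%:R <=
      M n * (7 * p n ^+ 2) * (9 * M n).
    by apply: ler_wpM2l rr; rewrite mulr_ge0 ?mulr_ge0 ?sqr_ge0// ltW.
  have : (M n * p n) ^+ 2 <= 4.
    have -> : 4 = 2 ^+ 2 :> R by ring.
    by case/andP: Mp => _ Mp2; rewrite lerXn2r ?nnegrE// mulr_ge0// ltW.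
  by lra.
have S3 : M n * (16 * n%:R ^+ 2 * al n) <= 16.
  have n1 : 1 <= n%:R :> R by rewrite ler1n.
  have : M n * (n%:R ^+ 2 * al n) <= n%:R * (n%:R ^+ 2 * al n).
    by apply: ler_wpM2r => //; rewrite mulr_ge0// exprn_ge0.
  have : n%:R ^+ 3 * al n <= n%:R ^+ 7 * al n by apply: ler_wpM2r => //; rewrite ler_weXn2l.
  lra.
rewrite /Sexc mulrDr big_split /=; lra.
Unshelve. all: by end_near. Qed.

Lemma shell_count n : (size [seq h <- box n.+1 | (n < mnorm h)%N] = 8 * n.+1)%N.
Proof.
have := count_predC (fun h => (mnorm h <= n)%N) (box n.+1).
rewrite -!size_filter size_box (perm_size (box_mono_filter (leqnSn n))) size_box.
rewrite (@eq_filter _ (predC (fun h => (mnorm h <= n)%N)) (fun h => (n < mnorm h)%N)).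
  by lia.
by move=> h /=; rewrite ltnNge.
Qed.

Lemma sum_box_tail_step (F : int * int -> R) n N : (n <= N)%N ->
  \sum_(h <- box N.+1 | (n < mnorm h)%N) F h =
  \sum_(h <- box N | (n < mnorm h)%N) F h + \sum_(h <- box N.+1 | (N < mnorm h)%N) F h.
Proof.
move=> nN; apply: (@addrI _ (\sum_(h <- box n) F h)).
by rewrite -sum_box_split ?(leqW nN)// addrA -sum_box_split// -sum_box_split.
Qed.

(** The shell at distance q contributes at most [8 * C / q ^ 3]. With the rate bounded by [n], the
    tail beyond [n] is of order [1 / n], uniformly in [N]. *)
Lemma extremogram_tail (e : R) : 0 < e -> \forall n \near \oo, forall N,
  rate n * (\sum_(h <- box N | (n < mnorm h)%N) gam h) <= e.
Proof.
move=> e0; have [C [l0 [C0 dec]]] := extremogram_decay stat norm M1 M2 n7.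
have g0 := extremogram_ge0 norm M1 M2.
near=> n => N.
have nl0 : (l0 <= n)%N by near: n; exact: nbhs_infty_ge.
have n0 : (0 < n)%N by near: n; exact: nbhs_infty_gt.
have M1' : 1 <= M n by near: n; exact: M_ge M1 _.
have n8 : 8 * C / e <= n%:R by near: n; exact: nbhs_infty_ger.
have n0' : 0 < n%:R :> R by rewrite ltr0n.
set t := \sum_(h <- _ | _) _.
have t0 : 0 <= t by apply: sumr_ge0.
suff H : n%:R * t <= 8 * C / n%:R.
  apply: (@le_trans _ _ (n%:R * t)).
    apply: ler_wpM2r => //; rewrite ler_pdivrMr ?sqrtr_gt0 ?(lt_le_trans ltr01)//.
    rewrite ler_peMr// -[leLHS]sqrtr1 ler_wsqrtr//.
  move: n8; rewrite ler_pdivrMr// => n8.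
  by apply: (le_trans H); rewrite ler_pdivrMr// (mulrC e).
have [Nn|nN] := leqP N n.
  by rewrite /t sum_box_tail_le// mulr0 divr_ge0 ?mulr_ge0.
(* Strengthened so that the induction on [N] telescopes: one factor of [q.+1 ^ 3] absorbs [n], and
   [1 / q.+1 ^ 2 <= 1 / q - 1 / q.+1]. *)
suff {}H : n%:R * t <= 8 * C * (n%:R^-1 - N%:R^-1).
  apply: (le_trans H); apply: ler_wpM2l; first by rewrite mulr_ge0.
  by rewrite lerBlDr lerDl invr_ge0.
rewrite /t -(subnKC (ltnW nN)); elim: (N - n)%N => {N nN t t0} [|N IH].
  by rewrite addn0 sum_box_tail_le// subrr !mulr0.
rewrite addnS sum_box_tail_step ?leq_addr//; set q := (n + N)%N in IH *.
have q1 : 0 < q.+1%:R :> R by rewrite ltr0n.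
have shell : \sum_(h <- box q.+1 | (q < mnorm h)%N) gam h <= (8 * q.+1)%:R * (C / q.+1%:R ^+ 4).
  rewrite (_ : (8 * q.+1)%:R * (C / q.+1%:R ^+ 4) =
    \sum_(h <- [seq h <- box q.+1 | (q < mnorm h)%N]) C / q.+1%:R ^+ 4); last first.
    by rewrite big_const_seq count_predT iter_addr_0 shell_count mulr_natl.
  rewrite -big_filter big_seq [leRHS]big_seq; apply: ler_sum => h.
  rewrite mem_filter mem_box => /andP[h1 h2].
  have E : mnorm h = q.+1 by apply/eqP; rewrite eqn_leq h2 h1.
  by rewrite -E; apply: dec; rewrite E leqW// (leq_trans nl0)// leq_addr.
have qn : n%:R <= q.+1%:R :> R by rewrite ler_nat leqW// leq_addr.
have q0 : 0 < q%:R :> R by rewrite ltr0n addn_gt0 n0.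
have qE : q.+1%:R = q%:R + 1 :> R by rewrite natr1.
have step : n%:R * ((8 * q.+1)%:R * (C / q.+1%:R ^+ 4)) <= 8 * C * (q%:R^-1 - q.+1%:R^-1).
  rewrite natrM (_ : n%:R * (8 * q.+1%:R * (C / q.+1%:R ^+ 4)) = 8 * C * (n%:R / q.+1%:R ^+ 3)); last first.
    by field; rewrite gt_eqF.
  apply: ler_wpM2l; first by rewrite mulr_ge0.
  apply: (@le_trans _ _ (q.+1%:R / q.+1%:R ^+ 3)).
    by rewrite ler_pM2r// invr_gt0 exprn_gt0.
  rewrite -subr_ge0 (_ : _ - _ = (q%:R * q.+1%:R ^+ 2)^-1); last first.
    by rewrite qE; field; rewrite !gt_eqF// -qE.
  by rewrite invr_ge0 mulr_ge0// ltW// exprn_gt0.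
rewrite mulrDr; apply: le_trans (lerD IH (le_trans (ler_wpM2l (ltW n0') shell) step)) _.
have tele (x y z : R) : (x - y) + (y - z) <= x - z by lra.
by rewrite -mulrDr; apply: ler_wpM2l; [rewrite mulr_ge0|exact: tele].
Unshelve. all: by end_near. Qed.

End variance_and_bias.

(** * The bias, uniformly over residue classes *)

Section bias.
Context {R : realType} {d} {T : measurableType d} {P : probability T R}.
Variable X : int * int -> {RV P >-> R}.
Variables (a : nat -> R) (m r : nat -> nat) (abar : nat -> R).
Hypothesis stat : strictly_stationary X.
Hypothesis norm : normalizing_sequence X a.
Hypothesis gsum : abs_summable (extremogram X).
Hypothesis M1 : condition_M1 X a m r abar.
Hypothesis M2 : condition_M2 X a m r.
Hypothesis gtail : n%:R / Num.sqrt (m n)%:R *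
    (\sum_(h <- box n | (r n < mnorm h)%N) extremogram X h)
    @[n --> \oo] --> (0 : R).
Hypothesis n7 : n%:R ^+ 7 * abar (r n) @[n --> \oo] --> (0 : R).
Implicit Types (n N : nat) (h k : int * int).

Local Notation M n := ((m n)%:R : R).
Local Notation p n := (plevel X (a (m n))).
Local Notation pr n := (pair_prob X (a (m n))).
Local Notation gam := (extremogram X).
Local Notation al n := (abar (r n)).
Local Notation pm n := (pre_extremogram X a m n).
Local Notation rate n := (n%:R / Num.sqrt (M n)).
Local Notation frac n h := ((lagcount n h)%:R / n%:R ^+ 2 : R).

Lemma rate_ge0 n : 0 <= rate n.
Proof. by rewrite divr_ge0// sqrtr_ge0. Qed.

(** Three errors at short lags: normalization, centering and edge effect. The first two are of order
    [1 / M n], with a 4 from [(M n * p n) ^ 2 <= 4]. The edge effect is at most [2 * r n / n], which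
    the rate turns into [2 * r n / sqrt (M n)]; it vanishes because [r n ^ 4 = o(M n)]. *)
Lemma lag_scale_small (e : R) : 0 < e -> \forall n \near \oo, forall h, (mnorm h <= r n)%N ->
  rate n * (`|M n * p n - 1| + M n * p n ^+ 2 + (1 - frac n h)) <= e.
Proof.
move=> e0; have [C C0 H] := Mp_near1 M2.
have e1 : 0 < e / (3 * (C + 4)) by rewrite divr_gt0// mulr_gt0// ltr_wpDl.
have e2 : 0 < (e / 6) ^+ 2 by rewrite exprn_gt0// divr_gt0.
have r4 := r4_le_M M1 e2; have nM := n_over_M M1 e1.
near=> n => h hr.
have n0 : (0 < n)%N by near: n; exact: nbhs_infty_gt.
have n0' : 0 < n%:R :> R by rewrite ltr0n.
have M0 : 0 < M n by near: n; exact: M_gt0 M1.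
have r1 : (1 <= r n)%N by near: n; exact: r_ge M1 _.
have r1' : 1 <= (r n)%:R :> R by rewrite ler1n.
have r4' : (r n)%:R ^+ 4 <= (e / 6) ^+ 2 * M n by near: n.
have nM' : n%:R / Num.sqrt (M n) / M n <= e / (3 * (C + 4)) by near: n.
have Hn : `|M n * p n - 1| <= C / M n by near: n.
have Mp : 2^-1 <= M n * p n <= 2 by near: n; exact: Mp_bounds M1 M2.
have s0 : 0 < Num.sqrt (M n) by rewrite sqrtr_gt0.
have rt0 := rate_ge0 n.
have C4 : 0 < 3 * (C + 4) by lra.
have A1 : rate n * (`|M n * p n - 1| + M n * p n ^+ 2) <= e / 3.
  apply: (@le_trans _ _ (rate n * ((C + 4) / M n))).
    apply: ler_wpM2l => //; rewrite mulrDl; apply: lerD => //.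
    rewrite ler_pdivlMr// (_ : _ * M n = (M n * p n) ^+ 2); last by ring.
    have -> : 4 = 2 ^+ 2 :> R by ring.
    by case/andP: Mp => Mp1 Mp2; rewrite lerXn2r ?nnegrE//; lra.
  have : (C + 4) * (rate n / M n) <= (C + 4) * (e / (3 * (C + 4))) by apply: ler_wpM2l => //; lra.
  rewrite (_ : (C + 4) * (e / _) = e / 3); last by field; rewrite !gt_eqF//; lra.
  by rewrite mulrCA.
have rs : (r n)%:R <= e / 6 * Num.sqrt (M n).
  have e6 : 0 <= e / 6 by rewrite divr_ge0// ltW.
  rewrite -ler_sqr ?nnegrE//; last exact: mulr_ge0 e6 (sqrtr_ge0 _).
  rewrite exprMn sqr_sqrtr ?(ltW M0)//; apply: le_trans r4'.
  by rewrite ler_weXn2l.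
have A2 : rate n * (1 - frac n h) <= e / 3.
  have := @lagcount_frac_ge R n h n0; move=> fr.
  apply: (@le_trans _ _ (rate n * (2 * (r n)%:R / n%:R))).
    apply: ler_wpM2l => //; have : 2 * (mnorm h)%:R / n%:R <= 2 * (r n)%:R / n%:R :> R.
      by rewrite ler_pM2r ?invr_gt0// ler_pM2l// ler_nat.
    lra.
  rewrite (_ : _ * _ = 2 * (r n)%:R / Num.sqrt (M n)); last by field; rewrite !gt_eqF.
  rewrite ler_pdivrMr// (_ : e / 3 * Num.sqrt (M n) = 2 * (e / 6 * Num.sqrt (M n))); last by field.
  by rewrite ler_pM2l.
rewrite mulrDr; lra.
Unshelve. all: by end_near. Qed.

(* The grid of frequencies only sees lags modulo [n]: the transforms of [f] and of the
   periodogram over the grid are sums over a residue class. *)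
Definition alias_gamma n k : R := limn (fun N => \sum_(h <- box N | zdiv n (h - k)) gam h).

Lemma alias_gamma_cvg n k :
  (fun N => \sum_(h <- box N | zdiv n (h - k)) gam h) @ \oo --> alias_gamma n k.
Proof.
have [B B0 gB] := abs_summable_box gsum.
have := @sum_box_cvg_bounded R (fun h => if zdiv n (h - k) then gam h else 0) B.
have -> : (fun N => \sum_(h <- box N) (if zdiv n (h - k) then gam h else 0)) =
    (fun N => \sum_(h <- box N | zdiv n (h - k)) gam h).
  by apply/funext => N; rewrite [RHS]big_mkcond.
apply => N; apply: le_trans (gB N); apply: ler_sum => h _.
by case: ifP => // _; rewrite normr0.
Qed.

Lemma alias_gamma_trunc n k (t : R) :
  (forall N, \sum_(h <- box N | (n < mnorm h)%N) gam h <= t) ->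
  `|\sum_(h <- box n | zdiv n (h - k)) gam h - alias_gamma n k| <= t.
Proof.
move=> Ht; have g0 := extremogram_ge0 norm M1 M2.
have L : `|\sum_(h <- box n | zdiv n (h - k)) gam h - \sum_(h <- box N | zdiv n (h - k)) gam h|
    @[N --> \oo] --> `|\sum_(h <- box n | zdiv n (h - k)) gam h - alias_gamma n k|.
  by apply: cvg_norm; apply: cvgB; [exact: cvg_cst|exact: alias_gamma_cvg].
apply: (cvgr_to_le L); near=> N.
have nN : (n <= N)%N by near: N; exact: nbhs_infty_ge.
rewrite distrC.
rewrite (_ : _ - _ = \sum_(h <- box N | (n < mnorm h)%N) (if zdiv n (h - k) then gam h else 0)).
  rewrite ger0_norm; last by apply: sumr_ge0 => h _; case: ifP.
  by apply: le_trans (Ht N); apply: ler_sum => h _; case: ifP.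
by rewrite big_mkcond [X in _ - X]big_mkcond (sum_box_split _ nN) addrC addKr.
Unshelve. all: by end_near. Qed.

Lemma bias_small (e : R) : 0 < e -> \forall n \near \oo, forall k,
  rate n * `|\sum_(h <- box n | zdiv n (h - k)) M n * frac n h * (pr n h - p n ^+ 2)
             - alias_gamma n k| <= e.
Proof.
move=> e0; have g0 := extremogram_ge0 norm M1 M2.
(* One quarter each for the extremogram beyond [n], the lags within [r n], the extremogram between
   [r n] and [n], and the mixing error there. The second takes at most 9 lags with an error of
   [2 * (e / 72)] each; the last is at most [36 * n ^ 6 * al n], whence 144. *)
have e4 : 0 < e / 4 by rewrite divr_gt0.
have e36 : 0 < e / 72 by rewrite divr_gt0.
have e144 : 0 < e / 144 by rewrite divr_gt0.
have T1 := extremogram_tail stat norm M1 M2 n7 e4.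
have S1 := lag_scale_small e36.
have G1 := pre_extremogram_near norm M2 e36.
have A1 := al7 M1 n7 e144.
have Mn := M_le_n M1 (ltr01 : 0 < 1 :> R).
move: gtail => /cvgrPdist_le/(_ _ e4) gt1.
near=> n => k.
have n0 : (0 < n)%N by near: n; exact: nbhs_infty_gt.
have n1 : 1 <= n%:R :> R by rewrite ler1n.
have M1' : 1 <= M n by near: n; exact: M_ge M1 _.
have M0 : 0 < M n by exact: lt_le_trans M1'.
have Mn' : M n <= n%:R by rewrite -[leRHS]mul1r; near: n.
have r1 : (1 <= r n)%N by near: n; exact: r_ge M1 _.
have rt0 := rate_ge0 n.
have s1 : 1 <= Num.sqrt (M n) by rewrite -[leLHS]sqrtr1 ler_wsqrtr.
have rtn : rate n <= n%:R by rewrite ler_pdivrMr ?(lt_le_trans ltr01)// ler_peMr.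
have T1n : forall N, rate n * (\sum_(h <- box N | (n < mnorm h)%N) gam h) <= e / 4 by near: n.
have S1n : forall h, (mnorm h <= r n)%N ->
  rate n * (`|M n * p n - 1| + M n * p n ^+ 2 + (1 - frac n h)) <= e / 72 by near: n.
have G1n : forall h, (mnorm h <= r n)%N -> rate n * `|pm n h - gam h| <= e / 72 by near: n.
have A1n : n%:R ^+ 7 * al n <= e / 144 by near: n.
have gt1n : `|0 - rate n * (\sum_(h <- box n | (r n < mnorm h)%N) gam h)| <= e / 4 by near: n.
have Mp : 2^-1 <= M n * p n <= 2 by near: n; exact: Mp_bounds M1 M2.
have ab0 : 0 <= al n by exact: abar_ge0 M1 _.
pose c h := M n * frac n h * (pr n h - p n ^+ 2).
have near_lag h : (mnorm h <= r n)%N -> rate n * `|c h - gam h| <= e / 36.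
  move=> hr; have f0 := @lagcount_frac_ge0 R n h; have f1 := @lagcount_frac_le1 R n h.
  have pp := p_gt0 m norm n.
  have q0 := pre_ge0 m norm n h; have q1 := pre_le1 m norm n h.
  have prE : pr n h = p n * pm n h by rewrite preE mulrC divfK// gt_eqF.
  (* Isolates the errors of normalization, centering, edge effect and (M2), in this order. *)
  have E : c h - gam h = frac n h * pm n h * (M n * p n - 1) - frac n h * (M n * p n ^+ 2) +
      (frac n h - 1) * pm n h + (pm n h - gam h) by rewrite /c prE; ring.
  have H : `|c h - gam h| <= (`|M n * p n - 1| + M n * p n ^+ 2 + (1 - frac n h)) + `|pm n h - gam h|.
    have h1 : `|frac n h * pm n h * (M n * p n - 1)| <= `|M n * p n - 1|.
      rewrite normrM ger0_norm; last exact: mulr_ge0.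
      by apply: ler_piMl => //; rewrite mulr_ile1.
    have h2 : `|frac n h * (M n * p n ^+ 2)| <= M n * p n ^+ 2.
      have mp0 : 0 <= M n * p n ^+ 2 by rewrite mulr_ge0 ?sqr_ge0.
      by rewrite normrM !ger0_norm//; apply: ler_piMl.
    have h3 : `|(frac n h - 1) * pm n h| <= 1 - frac n h.
      rewrite normrM (ger0_norm q0) distrC ger0_norm ?subr_ge0//.
      by apply: ler_piMr => //; rewrite subr_ge0.
    rewrite E; apply: le_trans (ler_normD _ _) _; apply: lerD => //.
    apply: le_trans (ler_normD _ _) _; apply: lerD => //.
    by apply: le_trans (ler_normB _ _) _; apply: lerD.
  apply: le_trans (ler_wpM2l rt0 H) _; rewrite mulrDr.
  by have := S1n h hr; have := G1n h hr; lra.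
have far_lag h : (r n < mnorm h)%N -> `|c h| <= 4 * n%:R * al n.
  move=> hr; have f0 := @lagcount_frac_ge0 R n h; have f1 := @lagcount_frac_le1 R n h.
  have := @Ex_lagprod_far _ _ _ _ X (a (m n)) (r n) (al n) ab0
    (fun S S' B C H => mixP M1 H) stat h 0 hr.
  rewrite Ex_lagprod// => H.
  have c0 : 0 <= M n * frac n h by apply: mulr_ge0 => //; exact: ltW.
  have c1 : M n * frac n h <= n%:R.
    by apply: le_trans Mn'; apply: ler_piMr => //; exact: ltW.
  rewrite /c normrM (ger0_norm c0) (_ : 4 * n%:R * al n = n%:R * (4 * al n)); last by ring.
  exact: ler_pM c0 (normr_ge0 _) c1 H.
pose t := (e / 4) / rate n.
have rtp : 0 < rate n by apply: divr_gt0; [rewrite ltr0n|exact: lt_le_trans s1].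
have B1 : rate n * `|\sum_(h <- box n | zdiv n (h - k)) gam h - alias_gamma n k| <= e / 4.
  rewrite (mulrC (rate n)) -ler_pdivlMr//; apply: alias_gamma_trunc => N.
  by rewrite ler_pdivlMr// (mulrC _ (rate n)).
have B2 : rate n * `|\sum_(h <- box n | zdiv n (h - k)) c h -
                     \sum_(h <- box n | zdiv n (h - k)) gam h| <= 3 * (e / 4).
  rewrite -sumrB; apply: le_trans (ler_wpM2l rt0 (ler_norm_sum _ _ _)) _.
  rewrite mulr_sumr (bigID (fun h => (mnorm h <= r n)%N)) /=.
  have C1 : \sum_(h <- box n | zdiv n (h - k) && (mnorm h <= r n)%N) rate n * `|c h - gam h| <= e / 4.
    apply: (@le_trans _ _ (\sum_(h <- box n | zdiv n (h - k)) e / 36)).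
      rewrite big_mkcondr; apply: ler_sum => h _; case: ifP => [/near_lag//|_].
      by rewrite divr_ge0// ltW.
    rewrite big_const_seq iter_addr_0 -[_ *+ _]mulr_natr.
    have : (count (fun h => zdiv n (h - k)%R) (box n))%:R <= 9 :> R.
      by rewrite ler_nat count_class_le.
    move=> c9; apply: (@le_trans _ _ (e / 36 * 9)); last by lra.
    by apply: ler_wpM2l => //; rewrite divr_ge0// ltW.
  have C2 : \sum_(h <- box n | zdiv n (h - k) && ~~ (mnorm h <= r n)%N) rate n * `|c h - gam h| <= 2 * (e / 4).
    apply: (@le_trans _ _ (\sum_(h <- box n | (r n < mnorm h)%N) rate n * (4 * n%:R * al n + gam h))).
      rewrite big_mkcond [leRHS]big_mkcond; apply: ler_sum => h _; rewrite -ltnNge.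
      have z0 : 0 <= rate n * (4 * n%:R * al n + gam h).
        by rewrite mulr_ge0// addr_ge0// mulr_ge0// mulr_ge0.
      case: ifP => [/andP[_ hr]|_]; last by case: ifP.
      rewrite hr; apply: ler_wpM2l => //; apply: le_trans (ler_normB _ _) _.
      by rewrite (ger0_norm (g0 h)) lerD// far_lag.
    rewrite -mulr_sumr big_split mulrDr /=.
    move: gt1n; rewrite sub0r normrN ger0_norm; last by rewrite mulr_ge0// sumr_ge0.
    move=> gt1n; have : rate n * (\sum_(h <- box n | (r n < mnorm h)%N) 4 * n%:R * al n) <= e / 4.
      apply: (@le_trans _ _ (n%:R * (\sum_(h <- box n) 4 * n%:R * al n))).
        apply: ler_pM => //; first by apply: sumr_ge0 => h _; rewrite mulr_ge0// mulr_ge0.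
        by rewrite big_mkcond; apply: ler_sum => h _; case: ifP => // _; rewrite mulr_ge0// mulr_ge0.
      rewrite big_const_seq count_predT size_box iter_addr_0 -[_ *+ _]mulr_natr.
      have s9 : (n.*2.+1 * n.*2.+1)%:R <= 9 * n%:R ^+ 4 :> R.
        by rewrite -natrX -natrM ler_nat sqr_odd_le.
      have w0 : 0 <= 4 * n%:R ^+ 2 * al n by rewrite mulr_ge0// mulr_ge0// exprn_ge0.
      have := ler_wpM2l w0 s9.
      have : n%:R ^+ 6 * al n <= n%:R ^+ 7 * al n by apply: ler_wpM2r => //; rewrite ler_weXn2l.
      lra.
    lra.
  lra.
rewrite -(subrKA (\sum_(h <- box n | zdiv n (h - k)) gam h)).
apply: le_trans (ler_wpM2l rt0 (ler_normD _ _)) _; rewrite mulrDr; lra.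
Unshelve. all: by end_near. Qed.

End bias.

(** * Fluctuations of the empirical extremogram *)

Section fluctuations.
Context {R : realType} {d} {T : measurableType d} {P : probability T R}.
Variable X : int * int -> {RV P >-> R}.
Variables (a : nat -> R) (m r : nat -> nat) (abar : nat -> R).
Hypothesis stat : strictly_stationary X.
Hypothesis norm : normalizing_sequence X a.
Hypothesis M1 : condition_M1 X a m r abar.
Hypothesis M2 : condition_M2 X a m r.
Hypothesis n7 : n%:R ^+ 7 * abar (r n) @[n --> \oo] --> (0 : R).
Implicit Types (n N : nat) (h k s t : int * int) (w : T).

Local Notation M n := ((m n)%:R : R).
Local Notation p n := (plevel X (a (m n))).
Local Notation pr n := (pair_prob X (a (m n))).
Local Notation al n := (abar (r n)).
Local Notation pm n := (pre_extremogram X a m n).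
Local Notation rate n := (n%:R / Num.sqrt (M n)).
Local Notation frac n h := ((lagcount n h)%:R / n%:R ^+ 2 : R).
Local Notation Ex := (Ex P).

Definition lagsum n h w : R := \sum_(s <- Lam n | s + h \in Lam n)
  (lagprod X (a (m n)) h s w - Ex (lagprod X (a (m n)) h s)).

Definition noise n h w : R := rate n * (M n / n%:R ^+ 2) * lagsum n h w.

Definition wdev n h w : R := rate n * (emp_extremogram X a m n h w - pm n h).

Lemma bdm_lagsum n h : bdm (lagsum n h).
Proof. by apply: bdm_sum => s; apply: bdmB; [exact: bdm_lagprod|exact: bdm_cst]. Qed.

Lemma bdm_noise n h : bdm (noise n h).
Proof. by apply: bdmZ; exact: bdm_lagsum. Qed.

Lemma bdm_emp n h : bdm (emp_extremogram X a m n h).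
Proof.
apply: bdmZ; apply: bdm_sum => s; apply: bdm_indic.
by apply: measurableI; exact: measurable_exceed.
Qed.

Lemma bdm_wdev n h : bdm (wdev n h).
Proof. by apply: bdmZ; apply: bdmB; [exact: bdm_emp|exact: bdm_cst]. Qed.

Lemma rate_sqrE n : (0 < n)%N -> 0 < M n -> (rate n * (M n / n%:R ^+ 2)) ^+ 2 = M n / n%:R ^+ 2.
Proof.
move=> n0 M0; have n0' : n%:R != 0 :> R by rewrite pnatr_eq0 -lt0n.
rewrite !exprMn exprVn sqr_sqrtr ?ltW//; field.
by rewrite n0' gt_eqF.
Qed.

Lemma Ex_norm_le_sqrt (U : T -> R) (c : R) : bdm U -> Ex (fun w => U w ^+ 2) <= c ->
  Ex (fun w => `|U w|) <= Num.sqrt c.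
Proof.
move=> bU Uc; rewrite -[leLHS]ger0_norm; last by apply: Ex_ge0 => w.
by rewrite -sqrtr_sqr ler_wsqrtr// (le_trans (Ex_norm_sqr P bU)).
Qed.

(** Bounding the mean by the root of the second moment preserves the fraction of base points, on
    which the comparison of aliased lags rests. *)
Lemma noise_L1 (C : R) n h : (0 < n)%N -> 0 < M n ->
  M n * Sexc X (a (m n)) (r n) (al n) n <= C ->
  Ex (fun w => `|noise n h w|) <= Num.sqrt (C * frac n h).
Proof.
move=> n0 M0 SC; apply: Ex_norm_le_sqrt; first exact: bdm_noise.
under eq_fun do rewrite exprMn rate_sqrE//.
rewrite ExZ; last by apply: bdmM; exact: bdm_lagsum.
have ab0 : 0 <= al n := abar_ge0 M1 (r n).
have := @lagprod_var_le _ _ _ _ X (a (m n)) (r n) (al n) ab0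
  (fun S S' B C H => mixP M1 H) stat n h.
rewrite -/(lagsum n h) => V.
have n2 : 0 < n%:R ^+ 2 :> R by rewrite exprn_gt0 ?ltr0n.
have Mn2 : 0 <= M n / n%:R ^+ 2 by rewrite divr_ge0// ltW.
apply: le_trans (ler_wpM2l Mn2 V) _.
have := ler_wpM2r (@lagcount_frac_ge0 R n h) SC.
by rewrite mulrA; apply: le_trans; rewrite le_eqVlt; apply/orP; left; apply/eqP; ring.
Qed.

(** Expanding a product of two centered indicators, minus its mean, gives the joint indicator minus
    its probability, together with [- p n] times the two single centered indicators. The latter form
    the random part of the difference. *)
Lemma noise_wdevE n k w : noise n k w - wdev n k w =
  rate n * (pm n k - M n * frac n k * pr n k) -
  (rate n * (M n / n%:R ^+ 2) * p n) *
   (\sum_(s <- Lam n | s + k \in Lam n) cexc X (a (m n)) s w +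
    \sum_(t <- Lam n | t - k \in Lam n) cexc X (a (m n)) t w).
Proof.
rewrite -sum_Lam_reindex -big_split /=.
have E : lagsum n k w = \sum_(s <- Lam n | s + k \in Lam n)
      \1_(exceed X (a (m n)) s `&` exceed X (a (m n)) (s + k)) w
   - p n * (\sum_(s <- Lam n | s + k \in Lam n)
       (cexc X (a (m n)) s w + cexc X (a (m n)) (s + k) w))
   - (lagcount n k)%:R * pr n k.
  rewrite /lagcount -sum1_count natr_sum mulr_suml mulr_sumr -!sumrB.
  apply: eq_bigr => s _; rewrite Ex_lagprod// indicI_mul /lagprod /cexc; ring.
rewrite /noise /wdev /emp_extremogram E; ring.
Qed.

(** The deterministic part is a normalization and edge error. Each linear sum is at most
    [n * sqrt (C / M n)] in mean, and after scaling the two together give [2 * p n * sqrt C], which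
    vanishes since [p n <= 2 / M n]. *)
Lemma noise_wdev_small k (e : R) : 0 < e -> \forall n \near \oo,
  Ex (fun w => `|noise n k w - wdev n k w|) <= e.
Proof.
move=> e0; have e2 : 0 < e / 2 by rewrite divr_gt0.
have [C C0 HC] := M_Sexc_bounded M1 M2 n7.
have S1 := lag_scale_small M1 M2 e2.
near=> n.
have n0 : (0 < n)%N by near: n; exact: nbhs_infty_gt.
have M0 : 0 < M n by near: n; exact: M_gt0 M1.
have kr : (mnorm k <= r n)%N by near: n; exact: r_ge M1 _.
have Mp : 2^-1 <= M n * p n <= 2 by near: n; exact: Mp_bounds M1 M2.
have SC : M n * Sexc X (a (m n)) (r n) (al n) n <= C by near: n.
have S1n : forall h, (mnorm h <= r n)%N ->
  rate n * (`|M n * p n - 1| + M n * p n ^+ 2 + (1 - frac n h)) <= e / 2 by near: n.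
have MC : 8 * Num.sqrt C / e <= M n by near: n; exact: M_ge M1 _.
have n0' : 0 < n%:R :> R by rewrite ltr0n.
have pp : 0 <= p n by exact: plevel_ge0.
have s0 : 0 < Num.sqrt (M n) by rewrite sqrtr_gt0.
have rt0 : 0 <= rate n by exact: rate_ge0.
pose A w := \sum_(s <- Lam n | s + k \in Lam n) cexc X (a (m n)) s w.
pose B w := \sum_(t <- Lam n | t - k \in Lam n) cexc X (a (m n)) t w.
have bA : bdm A by apply: bdm_sum => s; exact: bdm_cexc.
have bB : bdm B by apply: bdm_sum => s; exact: bdm_cexc.
have bAB := bdmD bA bB.
pose c1 := rate n * (pm n k - M n * frac n k * pr n k).
pose c2 := rate n * (M n / n%:R ^+ 2) * p n.
have c20 : 0 <= c2 by rewrite mulr_ge0// mulr_ge0// divr_ge0// ?ltW// exprn_gt0.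
have ab0 : 0 <= al n := abar_ge0 M1 (r n).
have L q : Ex (fun w => `|\sum_(s <- Lam n | q s) cexc X (a (m n)) s w|) <= n%:R * Num.sqrt (C / M n).
  have := @cexc_var_le _ _ _ _ X (a (m n)) (r n) (al n) ab0
    (fun S S' B C H => mixP M1 H) stat n q.
  move=> /(Ex_norm_le_sqrt (bdm_sum _ _ (fun s => bdm_cexc X (a (m n)) s))) H.
  apply: (le_trans H); rewrite sqrtrM ?sqr_ge0// sqrtr_sqr ger0_norm//.
  by apply: ler_wpM2l => //; apply: ler_wsqrtr; rewrite ler_pdivlMr// mulrC.
have c1e : `|c1| <= e / 2.
  have q0 := pre_ge0 m norm n k; have q1 := pre_le1 m norm n k.
  have pg := p_gt0 m norm n.
  have f0 := @lagcount_frac_ge0 R n k; have f1 := @lagcount_frac_le1 R n k.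
  have prE : pr n k = p n * pm n k by rewrite preE mulrC divfK// gt_eqF.
  rewrite /c1 normrM (ger0_norm rt0); apply: le_trans (S1n k kr); apply: ler_wpM2l => //.
  rewrite prE (_ : pm n k - _ = pm n k * ((1 - frac n k) - frac n k * (M n * p n - 1))); last by ring.
  rewrite normrM (ger0_norm q0).
  have H1 : `|(1 - frac n k) - frac n k * (M n * p n - 1)| <= (1 - frac n k) + `|M n * p n - 1|.
    apply: le_trans (ler_normB _ _) _; rewrite ger0_norm ?subr_ge0// normrM (ger0_norm f0).
    by rewrite lerD2l ler_piMl.
  apply: (le_trans (ler_wpM2l q0 H1)).
  have H2 : 0 <= (1 - frac n k) + `|M n * p n - 1| by rewrite addr_ge0 ?subr_ge0.
  apply: (le_trans (ler_piMl H2 q1)).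
  have : 0 <= M n * p n ^+ 2 by rewrite mulr_ge0 ?sqr_ge0.
  lra.
apply: (@le_trans _ _ (Ex (fun w => `|c1| + c2 * (`|A w| + `|B w|)))).
  have bR := bdmD (@bdm_cst R _ T `|c1|) (bdmZ c2 (bdmD (bdm_norm bA) (bdm_norm bB))).
  apply: Ex_le => [||w]; [|exact: bR|].
    by apply: bdm_norm; apply: bdmB; [exact: bdm_noise|exact: bdm_wdev].
  rewrite noise_wdevE -/c1 -/c2 -/(A w) -/(B w).
  apply: le_trans (ler_normB _ _) _; rewrite lerD2l normrM (ger0_norm c20).
  by apply: ler_wpM2l => //; exact: ler_normD.
rewrite ExD; [|exact: bdm_cst|by apply: bdmZ; apply: bdmD; exact: bdm_norm].
rewrite Ex_cst ExZ; last by apply: bdmD; exact: bdm_norm.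
rewrite ExD; [|exact: bdm_norm..].
have c2e : c2 * (2 * (n%:R * Num.sqrt (C / M n))) <= e / 2.
  have sC : Num.sqrt (C / M n) = Num.sqrt C / Num.sqrt (M n).
    by rewrite sqrtrM// sqrtrV// ltW.
  have MM : M n = Num.sqrt (M n) ^+ 2 by rewrite sqr_sqrtr// ltW.
  have -> : c2 * (2 * (n%:R * Num.sqrt (C / M n))) = 2 * p n * Num.sqrt C.
    rewrite sC /c2 [X in _ * (X / _)]MM; field.
    by rewrite !gt_eqF.
  have p2 : p n <= 2 / M n by rewrite ler_pdivlMr// mulrC; case/andP: Mp.
  have : 2 * p n * Num.sqrt C <= 2 * (2 / M n) * Num.sqrt C.
    by rewrite ler_wpM2r ?sqrtr_ge0// ler_pM2l.
  move=> /le_trans; apply.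
  rewrite (_ : 2 * (2 / M n) * Num.sqrt C = 4 * Num.sqrt C / M n); last by field; rewrite gt_eqF.
  rewrite ler_pdivrMr//; move: MC; rewrite ler_pdivrMr//; lra.
have LA := L (fun s => s + k \in Lam n); have LB := L (fun s => s - k \in Lam n).
have := ler_wpM2l c20 (lerD LA LB); rewrite -/A -/B => LAB.
move: c2e; rewrite mulr_natl mulr2n => c2e.
have := le_trans LAB c2e; lra.
Unshelve. all: by end_near. Qed.

Definition alias_noise n k w : R := \sum_(h <- box n | zdiv n (h - k)) noise n h w.

Lemma bdm_alias_noise n k : bdm (alias_noise n k).
Proof. by apply: bdm_sum => h; exact: bdm_noise. Qed.

Lemma alias_noise_L1 (C : R) n k : (0 < n)%N -> 0 < M n -> 0 <= C ->
  M n * Sexc X (a (m n)) (r n) (al n) n <= C ->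
  Ex (fun w => `|alias_noise n k w|) <= 9 * Num.sqrt C.
Proof.
move=> n0 M0 C0 SC.
apply: le_trans (Ex_norm_sum P _ _ (fun h => bdm_noise n h)) _.
apply: (@le_trans _ _ (\sum_(h <- box n | zdiv n (h - k)) Num.sqrt C)).
  apply: ler_sum => h _; apply: le_trans (noise_L1 h n0 M0 SC) _; apply: ler_wsqrtr.
  by apply: ler_piMr => //; exact: lagcount_frac_le1.
rewrite big_const_seq iter_addr_0 -[_ *+ _]mulr_natl ler_wpM2r ?sqrtr_ge0//.
by rewrite ler_nat count_class_le.
Qed.

(** Each of the at most 9 other lags in the class has a fraction of base points of at most
    [mnorm k / n]. *)
Lemma alias_noise_near (C : R) n k : (0 < n)%N -> 0 < M n -> 0 <= C -> (mnorm k <= n)%N ->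
  M n * Sexc X (a (m n)) (r n) (al n) n <= C ->
  Ex (fun w => `|alias_noise n k w - noise n k w|) <=
    9 * Num.sqrt (C * (mnorm k)%:R / n%:R).
Proof.
move=> n0 M0 C0 kn SC; have n0' : 0 < n%:R :> R by rewrite ltr0n.
have E : (fun w => `|alias_noise n k w - noise n k w|) =
    (fun w => `|\sum_(h <- box n | zdiv n (h - k) && (h != k)) noise n h w|).
  apply/funext => w; congr `|_|; rewrite /alias_noise.
  have memk : k \in [seq h <- box n | zdiv n (h - k)].
    by rewrite mem_filter mem_box kn subrr /zdiv /= !dvdz0.
  have uq : uniq [seq h <- box n | zdiv n (h - k)] by rewrite filter_uniq// box_uniq.
  rewrite -[X in X - _]big_filter (bigD1_seq k memk uq).
  by rewrite [LHS]addrC addKr big_filter_cond.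
rewrite E; apply: le_trans (Ex_norm_sum P _ _ (fun h => bdm_noise n h)) _.
apply: (@le_trans _ _ (\sum_(h <- box n | zdiv n (h - k) && (h != k))
    Num.sqrt (C * (mnorm k)%:R / n%:R))).
  apply: ler_sum => h /andP[hk hk']; apply: le_trans (noise_L1 h n0 M0 SC) _.
  apply: ler_wsqrtr; rewrite -mulrA; apply: ler_wpM2l => //.
  rewrite ler_pdivrMr ?exprn_gt0// (_ : _ / _ * _ = (mnorm k)%:R * n%:R); last first.
    by field; rewrite gt_eqF.
  by rewrite -natrM ler_nat lagcount_alias.
rewrite big_const_seq iter_addr_0 -[_ *+ _]mulr_natl ler_wpM2r ?sqrtr_ge0// ler_nat.
apply: leq_trans (count_class_le k n0); apply: sub_count => h /=.
by case/andP.
Qed.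

End fluctuations.

(** * The integrated periodogram error *)

Section decomposition.
Context {R : realType} {d} {T : measurableType d} {P : probability T R}.
Variable X : int * int -> {RV P >-> R}.
Variables (a : nat -> R) (m r : nat -> nat) (abar : nat -> R).
Hypothesis stat : strictly_stationary X.
Hypothesis norm : normalizing_sequence X a.
Hypothesis gsum : abs_summable (extremogram X).
Hypothesis M1 : condition_M1 X a m r abar.
Hypothesis M2 : condition_M2 X a m r.
Implicit Types (n N mu : nat) (h k s t j : int * int) (w : T) (x : R * R).

Local Notation M n := ((m n)%:R : R).
Local Notation p n := (plevel X (a (m n))).
Local Notation pr n := (pair_prob X (a (m n))).
Local Notation gam := (extremogram X).
Local Notation rate n := (n%:R / Num.sqrt (M n)).
Local Notation frac n h := ((lagcount n h)%:R / n%:R ^+ 2 : R).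
Local Notation per := (periodogram X a m).
Local Notation spec x := (complex.Re (spectral_density X x)).
Local Notation ce n := (cexc X (a (m n))).

Lemma sum_cis (I : Type) (l : seq I) (c th : I -> R) :
  \sum_(i <- l) (c i)%:C%C * cis (th i) =
  Complex (\sum_(i <- l) c i * cos (th i)) (\sum_(i <- l) c i * sin (th i)).
Proof.
elim: l => [|i l IH]; first by rewrite !big_nil.
by rewrite !big_cons IH /cis; congr Complex; rewrite !mul0r ?subr0 ?addr0.
Qed.

Lemma periodogramE n x w : per n x w = M n / n%:R ^+ 2 *
  \sum_(s <- Lam n) \sum_(t <- Lam n) ce n s w * ce n t w * cos (dot x (t - s)).
Proof.
rewrite /periodogram sum_cis /= sqr_sqrtr ?addr_ge0 ?sqr_ge0//.
by rewrite (sqr_trig_sum n (fun s => ce n s w) x).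
Qed.

Lemma bdm_periodogram n x : bdm (per n x).
Proof.
rewrite (_ : per n x = fun w => M n / n%:R ^+ 2 *
  \sum_(s <- Lam n) \sum_(t <- Lam n) cos (dot x (t - s)) * (ce n s w * ce n t w)); last first.
  apply/funext => w; rewrite periodogramE; congr (_ * _).
  by apply: eq_bigr => s _; apply: eq_bigr => t _; rewrite mulrC.
apply: bdmZ; apply: bdm_sum => s; apply: bdm_sum => t; apply: bdmZ.
by apply: bdmM; exact: bdm_cexc.
Qed.

Lemma periodogram_le n x w : (0 < n)%N -> `|per n x w| <= M n * n%:R ^+ 2.
Proof.
move=> n0; have n0' : n%:R != 0 :> R by rewrite pnatr_eq0 -lt0n.
rewrite periodogramE normrM ger0_norm ?divr_ge0 ?exprn_ge0//.
rewrite (_ : M n * n%:R ^+ 2 = M n / n%:R ^+ 2 * (n%:R ^+ 2 * n%:R ^+ 2)); last first.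
  by field.
apply: ler_wpM2l; first by rewrite divr_ge0 ?exprn_ge0.
apply: le_trans (ler_norm_sum _ _ _) _.
rewrite -sum_Lam_const; apply: ler_sum => s _.
apply: le_trans (ler_norm_sum _ _ _) _.
rewrite -[leRHS]mulr1 -sum_Lam_const; apply: ler_sum => t _.
have c1 : `|ce n s w * ce n t w| <= 1 by rewrite normrM mulr_ile1 ?cexc_le1.
by rewrite normrM mulr_ile1// ler_norml cos_geN1 cos_le1.
Qed.

(** The average over the grid retains exactly the pairs of sites whose lag is congruent to [k] or
    [- k]: a circular autocovariance. *)
Lemma periodogram_transform n k w : (0 < n)%N ->
  (\sum_(j <- Lam n) per n (freq n j) w * cos (dot (freq n j) k)) / n%:R ^+ 2 =
  M n / n%:R ^+ 2 * \sum_(h <- box n | zdiv n (h - k))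
    \sum_(s <- Lam n | s + h \in Lam n) lagprod X (a (m n)) h s w.
Proof.
move=> n0; have n0' : n%:R != 0 :> R by rewrite pnatr_eq0 -lt0n.
pose c s t := ce n s w * ce n t w.
have E : \sum_(j <- Lam n) per n (freq n j) w * cos (dot (freq n j) k) =
    M n / n%:R ^+ 2 * \sum_(s <- Lam n) \sum_(t <- Lam n)
      c s t * (\sum_(j <- Lam n) cos (dot (freq n j) (t - s)) * cos (dot (freq n j) k)).
  under eq_bigr do rewrite periodogramE -mulrA mulr_suml.
  rewrite -mulr_sumr exchange_big /=; congr (_ * _); apply: eq_bigr => s _.
  under eq_bigr do rewrite mulr_suml; rewrite exchange_big /=; apply: eq_bigr => t _.
  by rewrite mulr_sumr; apply: eq_bigr => j _; rewrite mulrA.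
rewrite E; under eq_bigr do under eq_bigr do rewrite sum_cosM_Lam//.
(* Exchanging the two sites of a pair turns the class of [- k] into that of [k]. *)
have sym : \sum_(s <- Lam n) \sum_(t <- Lam n) c s t * (zdiv n (t - s + k))%:R =
    \sum_(s <- Lam n) \sum_(t <- Lam n) c s t * (zdiv n (t - s - k))%:R.
  rewrite exchange_big /=; apply: eq_bigr => s _; apply: eq_bigr => t _.
  by rewrite /c mulrC [RHS]mulrC -zdivN opprD opprB mulrC [in RHS]mulrC [ce n t w * _]mulrC.
have -> : \sum_(s <- Lam n) \sum_(t <- Lam n) c s t *
     (n%:R ^+ 2 * ((zdiv n (t - s - k))%:R + (zdiv n (t - s + k))%:R) / 2) =
    n%:R ^+ 2 * \sum_(s <- Lam n) \sum_(t <- Lam n) c s t * (zdiv n (t - s - k))%:R.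
  transitivity (n%:R ^+ 2 / 2 *
    (\sum_(s <- Lam n) \sum_(t <- Lam n) c s t * (zdiv n (t - s - k))%:R +
     \sum_(s <- Lam n) \sum_(t <- Lam n) c s t * (zdiv n (t - s + k))%:R)).
    rewrite -big_split mulr_sumr; apply: eq_bigr => s _.
    by rewrite -big_split mulr_sumr; apply: eq_bigr => t _ /=; ring.
  by rewrite sym; field.
rewrite (sum_Lam_lag n (fun s t => c s t * (zdiv n (t - s - k))%:R)).
rewrite [in RHS]big_mkcond /=.
rewrite (_ : \sum_(h <- box n) \sum_(s <- Lam n | s + h \in Lam n)
     c s (s + h) * (zdiv n (s + h - s - k))%:R = \sum_(h <- box n)
   (if zdiv n (h - k) then \sum_(s <- Lam n | s + h \in Lam n) lagprod X (a (m n)) h s w else 0)).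
  by field.
apply: eq_bigr => h _; case: ifP => hk.
  by apply: eq_bigr => s _; rewrite [s + h]addrC addrK hk mulr1 addrC.
by apply: big1 => s _; rewrite [s + h]addrC addrK hk mulr0.
Qed.

Lemma spectral_cvg x : \sum_(h <- box N) cos (dot x h) * gam h @[N --> \oo] --> spec x.
Proof.
rewrite /spectral_density /sumZ2C /sumZ2 /=.
have [B B0 gB] := abs_summable_box gsum.
rewrite (_ : (fun N => \sum_(h <- box N) (cos (dot x h) * gam h - sin (dot x h) * 0)) =
  (fun N => \sum_(h <- box N) cos (dot x h) * gam h)); last first.
  by apply/funext => N; apply: eq_bigr => h _; rewrite mulr0 subr0.
apply: (@sum_box_cvg_bounded _ _ B) => N; apply: le_trans (gB N).
apply: ler_sum => h _; rewrite normrM; apply: ler_piMl => //.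
by rewrite ler_norml cos_geN1 cos_le1.
Qed.

Lemma spectral_le (B : R) x : (forall N, \sum_(h <- box N) `|gam h| <= B) -> `|spec x| <= B.
Proof.
move=> gB.
have L : `|\sum_(h <- box N) cos (dot x h) * gam h| @[N --> \oo] --> `|spec x|.
  by apply: cvg_norm; exact: spectral_cvg.
apply: (cvgr_to_le L); apply: nearW => N; apply: le_trans (ler_norm_sum _ _ _) _.
apply: le_trans (gB N); apply: ler_sum => h _; rewrite normrM; apply: ler_piMl => //.
by rewrite ler_norml cos_geN1 cos_le1.
Qed.

(** The finite grid sum commutes with the limit over boxes; evenness of the extremogram merges the
    classes of [k] and [- k]. *)
Lemma spectral_transform n k : (0 < n)%N ->
  (\sum_(j <- Lam n) spec (freq n j) * cos (dot (freq n j) k)) / n%:R ^+ 2 = alias_gamma X n k.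
Proof.
move=> n0; have n0' : n%:R != 0 :> R by rewrite pnatr_eq0 -lt0n.
have L : (\sum_(j <- Lam n) (\sum_(h <- box N) cos (dot (freq n j) h) * gam h) *
     cos (dot (freq n j) k)) / n%:R ^+ 2 @[N --> \oo] -->
    (\sum_(j <- Lam n) spec (freq n j) * cos (dot (freq n j) k)) / n%:R ^+ 2.
  apply: cvgM; last exact: cvg_cst.
  by apply: cvg_sumr => j; apply: cvgM; [exact: spectral_cvg|exact: cvg_cst].
rewrite -(cvg_lim _ L)// /alias_gamma; congr (limn _); apply/funext => N.
have -> : \sum_(j <- Lam n) (\sum_(h <- box N) cos (dot (freq n j) h) * gam h) *
     cos (dot (freq n j) k) = n%:R ^+ 2 / 2 * (\sum_(h <- box N) gam h * (zdiv n (h - k))%:R +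
       \sum_(h <- box N) gam h * (zdiv n (h + k))%:R).
  under eq_bigr do rewrite mulr_suml; rewrite exchange_big /= -big_split mulr_sumr.
  apply: eq_bigr => h _.
  rewrite (_ : n%:R ^+ 2 / 2 * (gam h * (zdiv n (h - k))%:R + gam h * (zdiv n (h + k))%:R) =
    gam h * (n%:R ^+ 2 * ((zdiv n (h - k))%:R + (zdiv n (h + k))%:R) / 2)); last by ring.
  rewrite -sum_cosM_Lam// mulr_sumr; apply: eq_bigr => j _; ring.
have -> : \sum_(h <- box N) gam h * (zdiv n (h + k))%:R = \sum_(h <- box N) gam h * (zdiv n (h - k))%:R.
  rewrite -(perm_big _ (box_opp N)) big_map; apply: eq_bigr => h _.
  by rewrite extremogramN// -[in RHS]zdivN opprB addrC.
transitivity (\sum_(h <- box N) gam h * (zdiv n (h - k))%:R); first by field.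
rewrite [RHS]big_mkcond; apply: eq_bigr => h _.
by case: ifP => _; rewrite ?mulr1 ?mulr0.
Qed.

Lemma cos_refl n j h : (0 < n)%N -> cos (dot (freq n (refl n j)) h) = cos (dot (freq n j) h) :> R.
Proof.
move=> n0; have [k [l ->]] := @refl_freq R n j n0.
rewrite (_ : dot (- freq n j + period k l) h = - dot (freq n j) h + 2 * pi * (k * h.1 + l * h.2)%:~R).
  by rewrite cos_int cosN.
by rewrite /dot /period /= intrD !intrM; ring.
Qed.

Definition ferror n j w : R := per n (freq n j) w - spec (freq n j).

Lemma ferror_refl n j w : (0 < n)%N -> ferror n (refl n j) w = ferror n j w.
Proof.
move=> n0; rewrite /ferror !periodogramE; congr (_ * _ - _).
  by apply: eq_bigr => s _; apply: eq_bigr => t _; rewrite cos_refl.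
rewrite -(cvg_lim _ (@spectral_cvg (freq n j)))// -(cvg_lim _ (@spectral_cvg (freq n (refl n j))))//.
congr (limn _); apply/funext => N; apply: eq_bigr => h _; by rewrite cos_refl.
Qed.

(** The reflection permutes the grid and fixes [ferror], so the sums against [g] and its reflection
    agree. *)
Lemma integrated_error_even (g : R * R -> R) n w : (0 < n)%N -> periodic2 g ->
  integrated_error X a m g n w = rate n * ((\sum_(j <- Lam n) ferror n j w *
    ((2 * pi) ^+ 2 * ((g (freq n j) + g (- freq n j)) / 2))) / n%:R ^+ 2).
Proof.
move=> n0 gp; rewrite /integrated_error; congr (_ * _).
have sym : \sum_(j <- Lam n) ferror n j w * g (- freq n j) =
    \sum_(j <- Lam n) ferror n j w * g (freq n j).
  rewrite -[RHS]sum_refl; apply: eq_bigr => j _; rewrite ferror_refl//; congr (_ * _).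
  by have [k [l ->]] := @refl_freq R n j n0; rewrite periodic2_int.
have E : \sum_(j <- Lam n) ferror n j w * ((2 * pi) ^+ 2 * ((g (freq n j) + g (- freq n j)) / 2)) =
   (2 * pi) ^+ 2 / 2 * (\sum_(j <- Lam n) ferror n j w * g (freq n j) +
     \sum_(j <- Lam n) ferror n j w * g (- freq n j)).
  by rewrite -big_split mulr_sumr; apply: eq_bigr => j _ /=; ring.
rewrite E sym; set A := \sum_(j <- _) ferror n j w * _.
transitivity ((2 * pi) ^+ 2 / n%:R ^+ 2 * A); first by [].
have n0' : n%:R != 0 :> R by rewrite pnatr_eq0 -lt0n.
by field.
Qed.

Lemma bdm_integrated_error (g : R * R -> R) n : bdm (integrated_error X a m g n).
Proof.
apply: bdmZ; apply: bdmZ; apply: bdm_sum => j.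
under eq_fun do rewrite mulrC.
by apply: bdmZ; apply: bdmB; [exact: bdm_periodogram|exact: bdm_cst].
Qed.

Variable psi : int * int -> R.

(** The Fejer mean, over squares, of the cosine series with coefficients [psi]. *)
Definition fejer_sum mu x : R :=
  (\sum_(s <- Lam mu) \sum_(t <- Lam mu) psi (t - s) * cos (dot x (t - s))) / mu%:R ^+ 2.

Lemma fejer_sumE mu x : fejer_sum mu x = \sum_(h <- box mu) frac mu h * psi h * cos (dot x h).
Proof.
rewrite /fejer_sum (sum_Lam_lag mu (fun s t => psi (t - s) * cos (dot x (t - s)))) mulr_suml.
apply: eq_bigr => h _.
under eq_bigr do rewrite [_ + h]addrC addrK.
rewrite /lagcount -sum1_count natr_sum !mulr_suml; apply: eq_bigr => s _; ring.
Qed.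

Definition alias_bias n k : R := rate n *
  (\sum_(h <- box n | zdiv n (h - k)) M n * frac n h * (pr n h - p n ^+ 2) - alias_gamma X n k).

Lemma ferror_fejer n mu w : (0 < n)%N ->
  rate n * ((\sum_(j <- Lam n) ferror n j w * fejer_sum mu (freq n j)) / n%:R ^+ 2) =
  \sum_(k <- box mu) frac mu k * psi k * (alias_noise X a m n k w + alias_bias n k).
Proof.
move=> n0; have n0' : n%:R != 0 :> R by rewrite pnatr_eq0 -lt0n.
under eq_bigr do rewrite fejer_sumE mulr_sumr.
rewrite exchange_big mulr_suml mulr_sumr; apply: eq_bigr => k _ /=.
have -> : \sum_(j <- Lam n) ferror n j w * (frac mu k * psi k * cos (dot (freq n j) k)) =
    frac mu k * psi k * (\sum_(j <- Lam n) per n (freq n j) w * cos (dot (freq n j) k) -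
       \sum_(j <- Lam n) spec (freq n j) * cos (dot (freq n j) k)).
  by rewrite -sumrB mulr_sumr; apply: eq_bigr => j _; rewrite /ferror; ring.
rewrite (_ : rate n * (_ * (_ - _) / _) = frac mu k * psi k * (rate n *
   ((\sum_(j <- Lam n) per n (freq n j) w * cos (dot (freq n j) k)) / n%:R ^+ 2 -
    (\sum_(j <- Lam n) spec (freq n j) * cos (dot (freq n j) k)) / n%:R ^+ 2))); last by ring.
rewrite periodogram_transform// spectral_transform//; congr (_ * _).
rewrite /alias_bias /alias_noise -[RHS]/(_ + _) mulrBr mulrBr addrA; congr (_ - _).
rewrite [in LHS]mulr_sumr !mulr_sumr -big_split; apply: eq_bigr => h _ /=.
rewrite /noise /lagsum sumrB -mulrA.
have -> : \sum_(s <- Lam n | s + h \in Lam n) Ex P (lagprod X (a (m n)) h s) =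
   (lagcount n h)%:R * (pr n h - p n ^+ 2).
  rewrite /lagcount -sum1_count natr_sum mulr_suml; apply: eq_bigr => s _.
  by rewrite Ex_lagprod// mul1r.
ring.
Qed.

(** With [n] fixed, [ferror] is at most [M n * n ^ 2 + B] at every frequency and every [w].
    Pointwise convergence of the Fejer means at finitely many frequencies therefore gives a bound
    uniform in [w]. *)
Lemma integrated_error_fejer (g : R * R -> R) n (e : R) : (0 < n)%N -> 0 < e -> periodic2 g ->
  (forall x, fejer_sum mu x @[mu --> \oo] --> (2 * pi) ^+ 2 * ((g x + g (- x)) / 2)) ->
  \forall mu \near \oo, forall w, `|integrated_error X a m g n w -
    \sum_(k <- box mu) frac mu k * psi k * (alias_noise X a m n k w + alias_bias n k)| <= e.
Proof.
move=> n0 e0 gp fg; have [B B0 gB] := abs_summable_box gsum.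
have n0' : 0 < n%:R :> R by rewrite ltr0n.
pose D := M n * n%:R ^+ 2 + B.
have D0 : 0 <= D by rewrite addr_ge0// mulr_ge0// exprn_ge0.
have rt0 : 0 <= rate n by rewrite divr_ge0// sqrtr_ge0.
have c0 : 0 < rate n * D + 1 by rewrite ltr_wpDl// mulr_ge0.
pose ge j := (2 * pi) ^+ 2 * ((g (freq n j) + g (- freq n j)) / 2).
have L : \sum_(j <- Lam n) `|ge j - fejer_sum mu (freq n j)| @[mu --> \oo] -->
    \sum_(j <- Lam n) `|ge j - ge j|.
  by apply: cvg_sumr => j; apply: cvg_norm; apply: cvgB; [exact: cvg_cst|exact: fg].
have Z : \sum_(j <- Lam n) `|ge j - ge j| = 0 by rewrite big1// => j _; rewrite subrr normr0.
rewrite Z in L.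
have e' : 0 < e / (rate n * D + 1) by rewrite divr_gt0.
move: L => /cvgrPdist_le/(_ _ e'); apply: filterS => mu.
rewrite sub0r normrN ger0_norm ?sumr_ge0// => Hmu w.
rewrite integrated_error_even// -ferror_fejer// -mulrBr -mulrBl -sumrB normrM (ger0_norm rt0).
under eq_bigr do rewrite -mulrBr.
have H : `|(\sum_(j <- Lam n) ferror n j w * (ge j - fejer_sum mu (freq n j))) / n%:R ^+ 2| <=
    D * (e / (rate n * D + 1)).
  have n21 : 1 <= n%:R ^+ 2 :> R by rewrite exprn_ege1// ler1n.
  have n2 : 0 < n%:R ^+ 2 :> R by exact: lt_le_trans n21.
  rewrite normrM normfV (ger0_norm (ltW n2)) ler_pdivrMr//.
  apply: (@le_trans _ _ (D * (e / (rate n * D + 1)))); last first.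
    by rewrite ler_peMr// mulr_ge0// ltW.
  apply: (le_trans (ler_norm_sum _ _ _)).
  apply: le_trans (ler_wpM2l D0 Hmu); rewrite mulr_sumr; apply: ler_sum => j _.
  rewrite normrM; apply: ler_wpM2r => //.
  apply: (le_trans (ler_normB _ _)); apply: lerD; first exact: periodogram_le.
  exact: spectral_le.
apply: (le_trans (ler_wpM2l rt0 H)).
rewrite (_ : rate n * (D * (e / (rate n * D + 1))) = e * (rate n * D) / (rate n * D + 1)).
  by rewrite ler_pdivrMr// ler_pM2l// lerDl.
ring.
Qed.

End decomposition.

(** * Consequences of the finite-dimensional limits *)

Section finite_dimensional_limits.
Context {R : realType} {d} {T : measurableType d} {P : probability T R}.
Variable X : int * int -> {RV P >-> R}.
Variables (a : nat -> R) (m : nat -> nat).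
Context {dZ} {TZ : measurableType dZ} {PZ : probability TZ R}.
Variable Z : int * int -> {RV PZ >-> R}.
Hypothesis clt : extremogram_clt X a m Z.

Lemma box_fset_sum K (c y : int * int -> R) :
  let A := [fset h in box K]%fset in
  \sum_(i < #|` A|) c (nth 0 A i) * restr A y ord0 i = \sum_(h <- box K) c h * y h.
Proof.
move=> A; under eq_bigr do rewrite mxE.
rewrite -(big_mkord xpredT (fun i => c (nth 0 A i) * y (nth 0 A i))).
rewrite -(big_nth 0 xpredT (fun h => c h * y h)); apply: perm_big.
apply: uniq_perm; [exact: fset_uniq|exact: box_uniq|].
move=> h; have E : (h \in A) = (h \in box K) by rewrite /A in_fset.
exact: E.
Qed.

Lemma extremogram_clt_sum K (c : int * int -> R) :
  cvg_dist P PZ (fun n w => \sum_(h <- box K) c h * wdev X a m n h w)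
    (fun w => \sum_(h <- box K) c h * Z h w).
Proof.
pose A := [fset h in box K]%fset.
pose lin (v : 'rV[R]_#|` A|) := \sum_(i < #|` A|) c (nth 0 A i) * v ord0 i.
have linc : continuous lin.
  apply: continuous_big => [|i _ v]; first exact: add_continuous.
  apply: (@continuousM R _ (fun=> c (nth 0 A i)) (fun u : 'rV[R]_#|` A| => u ord0 i)).
    exact: cst_continuous.
  exact: coord_continuous.
move=> phi phic phib; have phil : continuous (phi \o lin).
  by move=> v; apply: continuous_comp; [exact: linc|exact: phic].
have philb : bounded_fun (phi \o lin).
  by move: phib => /bounded_funP[B phiB]; apply/bounded_funP; exists B => v; exact: phiB.
have H := clt (A := A) phil philb.
have E1 : (fun w => (phi \o lin) (restr A (fun h => Z h w))) =
    (fun w => phi (\sum_(h <- box K) c h * Z h w)).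
  by apply/funext => w; rewrite /= /lin box_fset_sum.
have E2 n : (fun w => (phi \o lin) (restr A (fun h => n%:R / Num.sqrt (m n)%:R *
     (emp_extremogram X a m n h w - pre_extremogram X a m n h)))) =
    (fun w => phi (\sum_(h <- box K) c h * wdev X a m n h w)).
  by apply/funext => w; rewrite /= /lin box_fset_sum.
rewrite -E1; under eq_cvg do rewrite -E2.
exact: H.
Qed.

(** The modulus is not a bounded test function. Its truncations at [K] are, their limits stay below
    [C], and monotone convergence in [K] removes the truncation. *)
Lemma limit_L1_le (C : R) h :
  (\forall n \near \oo, Ex P (fun w => `|wdev X a m n h w|) <= C) ->
  (\int[PZ]_w (`|Z h w|)%:E <= C%:E)%E.
Proof.
move=> HC.
have clt1 : cvg_dist P PZ (wdev X a m ^~ h) (Z h).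
  have E (y : int * int -> R) : \sum_(k <- box (mnorm h)) (k == h)%:R * y k = y h.
    rewrite (bigD1_seq h) ?mem_box ?box_uniq//= eqxx mul1r big1 ?addr0// => k /negbTE->.
    by rewrite mul0r.
  have := @extremogram_clt_sum (mnorm h) (fun k => (k == h)%:R).
  have -> : (fun w => \sum_(k <- box (mnorm h)) (k == h)%:R * Z k w) = Z h.
    by apply/funext => w; rewrite (E (fun k => Z k w)).
  have -> : (fun n w => \sum_(k <- box (mnorm h)) (k == h)%:R * wdev X a m n k w) =
     (wdev X a m ^~ h).
    by apply/funext => n; apply/funext => w; rewrite (E (fun k => wdev X a m n k w)).
  by [].
pose tr (K : nat) (x : R) := Num.min `|x| K%:R.
have tr0 K x : 0 <= tr K x by rewrite le_min normr_ge0 ler0n.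
have trK K x : `|tr K x| <= K%:R by rewrite ger0_norm// ge_min lexx orbT.
have trc K : continuous (tr K).
  by move=> x; apply: continuous_min; [exact: norm_continuous|exact: cvg_cst].
have mW n : measurable_fun setT (wdev X a m n h) by case: (bdm_wdev X a m n h).
have mZ : measurable_fun setT (Z h) by [].
have trC K : Ex PZ (tr K \o Z h) <= C.
  have := clt1 => /(cvg_distR P PZ mW mZ)/(_ (tr K) K%:R (trc K) (trK K)) L.
  apply: (cvgr_to_le L); move: HC; apply: filterS => n; apply: le_trans.
  have bW := bdm_wdev X a m n h.
  apply: Ex_le => [||w]; [exact: bdm_comp (trK K) _|exact: bdm_norm|].
  by rewrite /= ge_min lexx.
have H := @cvg_monotone_convergence _ _ R PZ setT measurableT (fun K => EFin \o (tr K \o Z h)).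
have limE w : limn (fun K => (EFin \o (tr K \o Z h)) w) = (`|Z h w|)%:E.
  apply/cvg_lim => //; apply: cvg_EFin; first exact: nearW.
  apply: cvg_near_cst; near=> K; rewrite /= /tr min_l//.
  near: K; exact: nbhs_infty_ger.
have {}H : (\int[PZ]_w ((tr K \o Z h) w)%:E)%E @[K --> \oo] --> (\int[PZ]_w (`|Z h w|)%:E)%E.
  under [X in _ --> X]eq_integral do rewrite -limE.
  apply: H => [K|K w _|w _ k l kl].
  - by apply/measurable_EFinP; apply: measurableT_comp mZ; exact: continuous_measurable_fun.
  - by rewrite lee_fin tr0.
  - by rewrite lee_fin /= /tr le_min !ge_min lexx /= ler_nat kl orbT.
apply: (cvge_to_le H); apply: nearW => K.
have b : bdm (tr K \o Z h) by exact: bdm_comp (trK K) mZ.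
have iK := bdm_integrable PZ b.
by rewrite -[leLHS]fineK ?lee_fin ?trC//; exact: integrable_fin_num.
Unshelve. all: by end_near. Qed.

End finite_dimensional_limits.

Lemma near_all_seq (I : eqType) (s : seq I) (Q : I -> nat -> Prop) :
  (forall i, \forall n \near \oo, Q i n) -> \forall n \near \oo, forall i, i \in s -> Q i n.
Proof.
move=> H; elim: s => [|i s IH]; first by apply: nearW.
move: (H i) IH; apply: filterS2 => n Qi Qs j; rewrite inE => /predU1P[->//|]; exact: Qs.
Qed.

(** * Approximation of the integrated error by finitely many lags *)

Section approximation.
Context {R : realType} {d} {T : measurableType d} {P : probability T R}.
Variable X : int * int -> {RV P >-> R}.
Variables (a : nat -> R) (m r : nat -> nat) (abar : nat -> R) (g : R * R -> R).
Hypothesis stat : strictly_stationary X.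
Hypothesis norm : normalizing_sequence X a.
Hypothesis gsum : abs_summable (extremogram X).
Hypothesis M1 : condition_M1 X a m r abar.
Hypothesis M2 : condition_M2 X a m r.
Hypothesis gtail : n%:R / Num.sqrt (m n)%:R *
    (\sum_(h <- box n | (r n < mnorm h)%N) extremogram X h)
    @[n --> \oo] --> (0 : R).
Hypothesis n7 : n%:R ^+ 7 * abar (r n) @[n --> \oo] --> (0 : R).
Hypothesis gper : periodic2 g.
Variable psi : int * int -> R.
Hypothesis psis : abs_summable psi.
Hypothesis psig : forall x, fejer_sum psi mu x @[mu --> \oo] -->
  (2 * pi) ^+ 2 * ((g x + g (- x)) / 2).

Local Notation M n := ((m n)%:R : R).
Local Notation frac n h := ((lagcount n h)%:R / n%:R ^+ 2 : R).

(** [C] is common to all lags while the range of [n] depends on [h]: enough for a uniform bound on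
    the limits [Z h]. *)
Lemma wdev_L1_bounded : exists C : R, forall h, \forall n \near \oo,
  Ex P (fun w => `|wdev X a m n h w|) <= C.
Proof.
have [C C0 HC] := M_Sexc_bounded M1 M2 n7.
exists (Num.sqrt C + 1) => h.
have D := noise_wdev_small stat norm M1 M2 n7 h (ltr01 : 0 < 1 :> R).
near=> n.
have n0 : (0 < n)%N by near: n; exact: nbhs_infty_gt.
have M0 : 0 < M n by near: n; exact: M_gt0 M1.
have SC : M n * Sexc X (a (m n)) (r n) (abar (r n)) n <= C by near: n.
have Dn : Ex P (fun w => `|noise X a m n h w - wdev X a m n h w|) <= 1 by near: n.
have bn := bdm_noise X a m n h; have bw := bdm_wdev X a m n h.
have bd := bdmB bn bw.
apply: (@le_trans _ _ (Ex P (fun w => `|noise X a m n h w| + `|noise X a m n h w - wdev X a m n h w|))).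
  apply: Ex_le => [||w]; [exact: bdm_norm|by apply: bdmD; exact: bdm_norm|].
  by have := ler_normB (noise X a m n h w) (noise X a m n h w - wdev X a m n h w); rewrite subKr.
rewrite ExD; [|exact: bdm_norm..]; apply: lerD => //.
apply: le_trans (noise_L1 stat M1 h n0 M0 SC) _; apply: ler_wsqrtr.
by apply: ler_piMr => //; exact: lagcount_frac_le1.
Unshelve. all: by end_near. Qed.

(** Six errors of [e / 6]: the Fejer approximation, the bias, the lags beyond [K] ([U1]), the
    weights replaced by 1 ([U2]), aliasing ([U3]), and the passage from [noise] to [wdev] ([U4]).
    [K] depends on the tail of [psi] only, because the mean of [alias_noise] is bounded uniformly in
    [k] and large [n]. *)
Lemma integrated_error_approx (e : R) : 0 < e -> \forall K \near \oo, \forall n \near \oo,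
  Ex P (fun w => `|integrated_error X a m g n w -
                   \sum_(k <- box K) psi k * wdev X a m n k w|) <= e.
Proof.
move=> e0; have [C C0 HC] := M_Sexc_bounded M1 M2 n7.
have [B B0 psiB] := abs_summable_box psis.
pose S9 := 9 * Num.sqrt C.
have S90 : 0 <= S9 by rewrite mulr_ge0// sqrtr_ge0.
have eS : 0 < e / 6 / (S9 + 1) by rewrite !divr_gt0// ltr_wpDl.
have eB : 0 < e / 6 / (B + 1) by rewrite !divr_gt0// ltr_wpDl.
have e6 : 0 < e / 6 by rewrite divr_gt0.
have [K0 tailK] := abs_summable_tail psis eS.
have B_e : B * (e / 6 / (B + 1)) <= e / 6.
  by rewrite mulrCA ger_pMr// ler_pdivrMr ?mul1r ?ltr_wpDl// lerDl.
exists K0 => // K /= K0K.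
have bias := bias_small stat norm gsum M1 M2 gtail n7 eB.
have nw := near_all_seq (box K) (fun k => noise_wdev_small stat norm M1 M2 n7 k eB).
near=> n.
have n0 : (0 < n)%N by near: n; exact: nbhs_infty_gt.
have n0' : 0 < n%:R :> R by rewrite ltr0n.
have M0 : 0 < M n by near: n; exact: M_gt0 M1.
have Kn : (K <= n)%N by near: n; exact: nbhs_infty_ge.
have SC : M n * Sexc X (a (m n)) (r n) (abar (r n)) n <= C by near: n.
have biasn : forall k, n%:R / Num.sqrt (M n) * `|\sum_(h <- box n | zdiv n (h - k))
   M n * frac n h * (pair_prob X (a (m n)) h - plevel X (a (m n)) ^+ 2)
             - alias_gamma X n k| <= e / 6 / (B + 1) by near: n.
have nwn : forall k, k \in box K ->
  Ex P (fun w => `|noise X a m n k w - wdev X a m n k w|) <= e / 6 / (B + 1) by near: n.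
have sq : 9 * Num.sqrt (C * K%:R / n%:R) <= e / 6 / (B + 1).
  have c0 : 0 < e / 6 / (B + 1) / 9 by rewrite divr_gt0.
  have : C * K%:R / (e / 6 / (B + 1) / 9) ^+ 2 <= n%:R by near: n; exact: nbhs_infty_ger.
  rewrite ler_pdivrMr ?exprn_gt0// => H.
  have : Num.sqrt (C * K%:R / n%:R) <= e / 6 / (B + 1) / 9.
    rewrite -[leRHS]ger0_norm ?(ltW c0)// -sqrtr_sqr; apply: ler_wsqrtr.
    by rewrite ler_pdivrMr// [leRHS]mulrC.
  by rewrite -(ler_pM2l (ltr0n R 9)) => /le_trans; apply; rewrite mulrC divfK.
have ief := integrated_error_fejer a m stat gsum n0 e6 gper psig.
(* the Fejer order is chosen last, depending on [n] *)
have [mu [muK mu0 mue muf]] : exists mu : nat, [/\ (K <= mu)%N, (0 < mu)%N,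
   (forall w, `|integrated_error X a m g n w - \sum_(k <- box mu) frac mu k * psi k *
      (alias_noise X a m n k w + alias_bias X a m n k)| <= e / 6) &
   B * (2 * K%:R / mu%:R * S9) <= e / 6].
  near \oo => mu; exists mu; split.
  - by near: mu; exact: nbhs_infty_ge.
  - by near: mu; exact: nbhs_infty_gt.
  - by near: mu; exact: ief.
  - have mu0 : 0 < mu%:R :> R by rewrite ltr0n; near: mu; exact: nbhs_infty_gt.
    rewrite (_ : B * _ = B * 2 * K%:R * S9 / mu%:R); last by ring.
    rewrite ler_pdivrMr// [leRHS]mulrC -ler_pdivrMr//.
    by near: mu; exact: nbhs_infty_ger.
pose al k w := alias_noise X a m n k w.
pose b k := alias_bias X a m n k.
have bal k : bdm (al k) by exact: bdm_alias_noise.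
have alS k : Ex P (fun w => `|al k w|) <= S9 by exact: (alias_noise_L1 stat M1).
have fr01 k : 0 <= frac mu k <= 1 by rewrite lagcount_frac_ge0 lagcount_frac_le1.
pose U1 w := \sum_(k <- box mu | (K < mnorm k)%N) `|psi k| * `|al k w|.
pose U2 w := \sum_(k <- box K) `|psi k| * (2 * K%:R / mu%:R * `|al k w|).
pose U3 w := \sum_(k <- box K) `|psi k| * `|al k w - noise X a m n k w|.
pose U4 w := \sum_(k <- box K) `|psi k| * `|noise X a m n k w - wdev X a m n k w|.
have bnal k : bdm (fun w => al k w - noise X a m n k w).
  by apply: bdmB => //; exact: bdm_noise.
have bnw k : bdm (fun w => noise X a m n k w - wdev X a m n k w).
  by apply: bdmB; [exact: bdm_noise|exact: bdm_wdev].
have bU1 : bdm U1 by apply: bdm_sum => k; apply: bdmZ; exact: bdm_norm.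
have bU2 : bdm U2 by apply: bdm_sum => k; apply: bdmZ; apply: bdmZ; exact: bdm_norm.
have bU3 : bdm U3 by apply: bdm_sum => k; apply: bdmZ; exact: bdm_norm.
have bU4 : bdm U4 by apply: bdm_sum => k; apply: bdmZ; exact: bdm_norm.
have bU34 := bdmD bU3 bU4; have bU234 := bdmD bU2 bU34; have bU := bdmD bU1 bU234.
have bE := @bdm_cst R _ T (e / 6 + e / 6).
have E1 : Ex P U1 <= e / 6.
  rewrite Ex_sum; last by move=> k; apply: bdmZ; exact: bdm_norm.
  apply: (@le_trans _ _ (\sum_(k <- box mu | (K < mnorm k)%N) `|psi k| * S9)).
    by apply: ler_sum => k _; rewrite ExZ ?ler_wpM2l//; exact: bdm_norm.
  rewrite -mulr_suml; apply: le_trans (ler_wpM2r S90 (tailK K mu K0K)) _.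
  by rewrite mulrAC ler_pdivrMr ?ltr_wpDl// ler_pM2l// lerDl.
have E2 : Ex P U2 <= e / 6.
  have c0 : 0 <= 2 * K%:R / mu%:R :> R by rewrite divr_ge0.
  rewrite Ex_sum; last by move=> k; apply: bdmZ; apply: bdmZ; exact: bdm_norm.
  apply: (@le_trans _ _ (\sum_(k <- box K) `|psi k| * (2 * K%:R / mu%:R * S9))).
    apply: ler_sum => k _; rewrite ExZ; last by apply: bdmZ; exact: bdm_norm.
    by rewrite ExZ ?ler_wpM2l//; exact: bdm_norm.
  rewrite -mulr_suml; apply: le_trans muf; apply: ler_wpM2r => //; exact: mulr_ge0.
have E3 : Ex P U3 <= e / 6.
  rewrite Ex_sum; last by move=> k; apply: bdmZ; exact: bdm_norm.
  apply: (@le_trans _ _ (\sum_(k <- box K) `|psi k| * (e / 6 / (B + 1)))).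
    rewrite big_seq [leRHS]big_seq; apply: ler_sum => k; rewrite mem_box => kK.
    rewrite ExZ; last exact: bdm_norm.
    apply: ler_wpM2l => //; apply: le_trans sq.
    apply: le_trans (alias_noise_near stat M1 n0 M0 C0 (leq_trans kK Kn) SC) _.
    apply: ler_wpM2l => //; apply: ler_wsqrtr.
    by apply: ler_wpM2r; [rewrite invr_ge0|apply: ler_wpM2l => //; rewrite ler_nat].
  by rewrite -mulr_suml; apply: le_trans B_e; apply: ler_wpM2r => //; exact: ltW.
have E4 : Ex P U4 <= e / 6.
  rewrite Ex_sum; last by move=> k; apply: bdmZ; exact: bdm_norm.
  apply: (@le_trans _ _ (\sum_(k <- box K) `|psi k| * (e / 6 / (B + 1)))).
    rewrite big_seq [leRHS]big_seq; apply: ler_sum => k kK.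
    rewrite ExZ; last exact: bdm_norm.
    by apply: ler_wpM2l => //; exact: nwn.
  by rewrite -mulr_suml; apply: le_trans B_e; apply: ler_wpM2r => //; exact: ltW.
apply: (@le_trans _ _ (Ex P (fun w => (e / 6 + e / 6) + (U1 w + (U2 w + (U3 w + U4 w)))))); last first.
  rewrite ExD// Ex_cst ExD// ExD// ExD//; lra.
have bY := bdm_integrated_error X a m g n.
have bV : bdm (fun w => \sum_(k <- box K) psi k * wdev X a m n k w).
  by apply: bdm_sum => k; apply: bdmZ; exact: bdm_wdev.
apply: Ex_le => [||w]; [exact/bdm_norm/bdmB|exact: bdmD|].
set Y := integrated_error X a m g n w; set V := \sum_(k <- box K) _.
pose St := \sum_(k <- box mu) frac mu k * psi k * (al k w + b k).
have Sb : `|\sum_(k <- box mu) frac mu k * psi k * b k| <= e / 6.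
  apply: le_trans (ler_norm_sum _ _ _) _; apply: le_trans B_e.
  apply: (@le_trans _ _ (\sum_(k <- box mu) `|psi k| * (e / 6 / (B + 1)))); last first.
    by rewrite -mulr_suml; apply: ler_wpM2r => //; exact: ltW.
  apply: ler_sum => k _; have /andP[f0 f1] := fr01 k.
  rewrite normrM (normrM (frac mu k)) (ger0_norm f0); apply: ler_pM => //; first exact: ler_piMl.
  by rewrite /b /alias_bias normrM ger0_norm ?divr_ge0 ?sqrtr_ge0//; exact: biasn.
have split : St - V = \sum_(k <- box mu) frac mu k * psi k * b k +
   (\sum_(k <- box mu | (K < mnorm k)%N) frac mu k * psi k * al k w +
   (\sum_(k <- box K) psi k * ((frac mu k - 1) * al k w) +
   (\sum_(k <- box K) psi k * (al k w - noise X a m n k w) +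
    \sum_(k <- box K) psi k * (noise X a m n k w - wdev X a m n k w)))).
  rewrite -!big_split /=.
  have -> : St = \sum_(k <- box mu) frac mu k * psi k * b k +
       \sum_(k <- box mu) frac mu k * psi k * al k w.
    by rewrite -big_split; apply: eq_bigr => k _ /=; ring.
  rewrite (sum_box_split (fun k => frac mu k * psi k * al k w) muK) -addrA; congr (_ + _).
  rewrite addrAC addrC; congr (_ + _).
  by rewrite /V -sumrB; apply: eq_bigr => k _ /=; ring.
have -> : Y - V = (Y - St) + (St - V) by rewrite addrA subrK.
rewrite split; apply: le_trans (ler_normD _ _) _; rewrite -addrA; apply: lerD; first exact: mue.
apply: le_trans (ler_normD _ _) _; apply: lerD; first exact: Sb.
apply: le_trans (ler_normD _ _) _; apply: lerD.
  apply: le_trans (ler_norm_sum _ _ _) _; apply: ler_sum => k _.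
  have /andP[f0 f1] := fr01 k.
  by rewrite normrM (normrM (frac mu k)) (ger0_norm f0) -mulrA; apply: ler_piMl => //; exact: mulr_ge0.
apply: le_trans (ler_normD _ _) _; apply: lerD.
  apply: le_trans (ler_norm_sum _ _ _) _; rewrite /U2 big_seq [leRHS]big_seq.
  apply: ler_sum => k; rewrite mem_box => kK.
  have /andP[f0 f1] := fr01 k; have f2 := @lagcount_frac_ge R mu k mu0.
  have mu0' : 0 < mu%:R :> R by rewrite ltr0n.
  rewrite !normrM; apply: ler_wpM2l => //; apply: ler_wpM2r => //.
  rewrite distrC ger0_norm ?subr_ge0//.
  have : 2 * (mnorm k)%:R / mu%:R <= 2 * K%:R / mu%:R :> R.
    by rewrite ler_pM2r ?invr_gt0// ler_pM2l// ler_nat.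
  lra.
apply: le_trans (ler_normD _ _) _; apply: lerD;
  by apply: le_trans (ler_norm_sum _ _ _) _; apply: ler_sum => k _; rewrite normrM.
Unshelve. all: by end_near. Qed.

End approximation.

Theorem theorem2p6 (R : realType)
    (d : measure_display) (T : measurableType d) (P : probability T R)
    (X : int * int -> {RV P >-> R}) (alpha : R)
    (a : nat -> R) (m r : nat -> nat) (abar : nat -> R)
    (g : R * R -> R)
    (dZ : measure_display) (TZ : measurableType dZ) (PZ : probability TZ R)
    (Z : int * int -> {RV PZ >-> R}) :
  0 < alpha ->
  strictly_stationary X ->
  regularly_varying X alpha ->
  normalizing_sequence X a ->
  abs_summable (extremogram X) ->
  condition_M1 X a m r abar ->
  condition_M2 X a m r ->
  n%:R / Num.sqrt (m n)%:R *
    (\sum_(h <- box n | (r n < mnorm h)%N) extremogram X h)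
    @[n --> \oo] --> (0 : R) ->
  n%:R ^+ 7 * abar (r n) @[n --> \oo] --> (0 : R) ->
  ln n%:R ^+ 4 * ((r n)%:R ^+ 2 / (m n)%:R) + (r n)%:R ^+ 4 / (m n)%:R
    @[n --> \oo] --> (0 : R) ->
  periodic2 g ->
  bounded_mixed_partial g ->
  abs_summable (fourier_coef g) ->
  centered_gaussian_field Z ->
  extremogram_clt X a m Z ->
  exists (dG : measure_display) (TG : measurableType dG)
    (PG : probability TG R) (G : {RV PG >-> R}),
    cvg_dist PZ PG
      (fun N w => \sum_(h <- box N) fourier_coef g h * Z h w) G /\
    cvg_dist P PG (fun n w => integrated_error X a m g n w) G.
Proof.
move=> _ stat _ norm gsum M1 M2 gtail n7 _ gper gmix psis _ clt.
have gc := bounded_mixed_partial_continuous gper gmix.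
have [B B0 gB] := periodic_continuous_bounded gper gc.
have psig x : fejer_sum (fourier_coef g) mu x @[mu --> \oo] -->
    (2 * pi) ^+ 2 * ((g x + g (- x)) / 2).
  apply: (fejer_inversion gper gc gB) => h.
  exact: rcoef_cvg gc gB.
have [C HC] := wdev_L1_bounded stat norm M1 M2 n7.
have ZC h : (\int[PZ]_w (`|Z h w|)%:E <= C%:E)%E by exact: (limit_L1_le clt).
have mZ h : measurable_fun setT (Z h) by [].
have [G GP] := random_series_cvg psis mZ ZC.
exists dZ, TZ, PZ, G; split; first exact: GP.
(* [K] truncates both the statistic and the limiting series; [G] lives on the space of [Z], so [GP]
   also serves as the convergence of the truncated limits. *)
apply: (@cvg_dist_approx _ _ _ P _ _ PZ _
  (fun K n w => \sum_(k <- box K) fourier_coef g k * wdev X a m n k w) _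
  (fun K w => \sum_(k <- box K) fourier_coef g k * Z k w)).
- by move=> n; exact: bdm_integrated_error.
- by move=> K n; apply: bdm_sum => k; apply: bdmZ; exact: bdm_wdev.
- by [].
- by move=> K; apply: measurable_sum => k; exact: measurable_funM.
- by move=> K; exact: extremogram_clt_sum.
- exact: GP.
- by move=> e e0; exact: (integrated_error_approx stat norm gsum M1 M2 gtail n7 gper psis psig).
Qed.
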